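(* (Generalization of the Reynolds Transport Theorem) Let $U\subseteq\mathbb R^n$ be open, $V\in\mathcal V(U)$, and let $J_t=V_{t*}J_0\in{}'\mathcal B_n(U)$ $(0\le t<t_0)$ be an evolving differential chain of top dimension $n$ under the flow of $V$, where $J_0\in{}'\mathcal B_n(U)$ has compact support in $U$. Let $\{\omega_t\}$ be a one-parameter family of forms of top degree in $\mathcal B_n(U)$ which is differentiable in time. Then $$\frac{\partial}{\partial t}\int_{J_t}\omega_t=\int_{J_t}\frac{\partial}{\partial t}\omega_t+\int_{\partial J_t}i_V\omega_t .$$
   Context: Chains and forms in an open set $U\subseteq\mathbb R^n$. Fix the standard inner product on $\mathbb R^n$, extended to $k$-vectors by $\langle u_1\wedge\dots\wedge u_k,v_1\wedge\dots\wedge v_k\rangle=\det(\langle u_i,v_j\rangle)$. A simple $k$-vector has mass $\|\alpha\|=\sqrt{\langle\alpha,\alpha\rangle}$; a general one has mass $\|\alpha\|=\inf\{\sum\|\alpha_j\|:\alpha=\sum\alpha_j,\ \alpha_j \text{ simple}\}$. $\mathcal A_k(U)$ is the space of Dirac $k$-chains in $U$: finite formal sums $\sum(p_i;\alpha_i)$, $p_i\in U$, $\alpha_i\in\Lambda_k(\mathbb R^n)$. With $T_u(p;\alpha)=(p+u;\alpha)$ and $\sigma=u_1\circ\dots\circ u_j$ a symmetric product of vectors, put $\|\sigma\|=\|u_1\|\cdots\|u_j\|$ and $\Delta_{\sigma}(p;\alpha)=(T_{u_1}-I)\cdots(T_{u_j}-I)(p;\alpha)$ (for $j=0$: $(p;\alpha)$,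 $\|\sigma\|=1$); this has order $j$ and is inside $U$ if the convex hull of its support is contained in $U$. $\|A\|_{B^{r,U}}=\inf\{\sum_i\|\sigma_i\|\|\alpha_i\|: A=\sum_i\Delta_{\sigma_i}(p_i;\alpha_i)$ (finite sum), all terms inside $U$, orders $\le r\}$; $\hat{\mathcal B}_k^r(U)$ is the completion of $\mathcal A_k(U)$; ${}'\mathcal B_k(U)=\varinjlim_r\hat{\mathcal B}_k^r(U)$ (locally convex inductive limit, linking maps induced by the identity). A $k$-form on $U$ is a linear functional $\omega$ on $\mathcal A_k(U)$; $\|\omega\|_{B^{r,U}}=\max_{0\le j\le r}\sup\{|\omega(\Delta_\sigma(p;\alpha))|:\sigma\text{ of order }j,\ \Delta_\sigma(p;\alpha)\text{ inside }U,\ \|\sigma\|\|\alpha\|=1\}$; $\mathcal B_k(U)$ is the Fréchet space of forms with all these norms finite (smooth $k$-forms on $U$ with all derivatives bounded). $\int_J\omega=\lim\omega(A_i)$, where $A_i\in\mathcal A_k(U)$ converge to a representative of $J$ in some $\hat{\mathcal B}_k^r(U)$. A family $\omega_t$ is differentiable in time if $\frac{\partial}{\partial t}\omega_t=\lim_{h\to0}(\omega_{t+h}-\omega_t)/h$ exists in $\mathcal B_k(U)$. Support: $K\in{}'\mathcal B_k(\mathbb R^n)$ is accessible in $X$ if for every open $W\supseteq X$ there are Dirac chains supported in $W$ converging to $K$; $\mathrm{supp}(K)$ is the smallest closed set in which $K$ is accessible. The support of $J\in{}'\mathcal B_k(U)$ is that of its image in ${}'\mathcal B_k(\mathbb R^n)$;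 $J$ has compact support in $U$ if this is a compact subset of $U$. $\mathcal V(U)$: bounded smooth maps $V:U\to\mathbb R^n$ all of whose partial derivatives are bounded on $U$. $V_t$ is the time-$t$ map of the flow of $V$; $t_0>0$ is such that $V_t$ is defined with values in $U$ on a neighborhood $N$ of $\mathrm{supp}\,J_0$ for $0\le t<t_0$. The pushforward $V_{t*}J_0\in{}'\mathcal B_k(U)$ (given on Dirac chains by $(p;\alpha)\mapsto(V_t(p);D(V_t)_p\alpha)$) is the unique chain with $\int_{V_{t*}J_0}\omega=\int_{J_0}g\,V_t^*\omega$ for all $\omega\in\mathcal B_k(U)$, where $g\in C_c^\infty(N)$ equals $1$ near $\mathrm{supp}\,J_0$ and $gV_t^*\omega$ is extended by $0$. $i_V$ is interior product. Boundary: $E_v^\dagger(p;v_1\wedge\dots\wedge v_k)=\sum_{i=1}^k(-1)^{i+1}\langle v,v_i\rangle(p;v_1\wedge\cdots\widehat{v_i}\cdots\wedge v_k)$ and $P_v(p;\alpha)=\lim_{t\to0}[(p+tv;\alpha/t)-(p;\alpha/t)]$ extend continuously to ${}'\mathcal B_k(U)$, and $\partial=\sum_iP_{e_i}E_{e_i}^\dagger:{}'\mathcal B_k(U)\to{}'\mathcal B_{k-1}(U)$ with $\{e_i\}$ the standard orthonormal basis. *)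

(* Defs.v *)
From HB Require Import structures.
From mathcomp Require Import all_boot all_order all_algebra.
From mathcomp Require Import all_classical all_reals all_analysis.

Set Implicit Arguments.
Unset Strict Implicit.
Unset Printing Implicit Defensive.

Import Order.TTheory GRing.Theory Num.Theory.
Import numFieldNormedType.Exports.

Local Open Scope classical_set_scope.
Local Open Scope ring_scope.

Section Multivectors.
Context {R : realType} {n : nat}.

Definition edot (u v : 'rV[R]_n) : R := (u *m v^T) 0 0.
Definition enorm (u : 'rV[R]_n) : R := Num.sqrt (edot u u).

(* Strictly increasing multi-indices I_0 < ... < I_(k-1) *)
Definition mindex (k : nat) :=
  {I : {ffun 'I_k -> 'I_n} | [forall i : 'I_k, forall j : 'I_k, (i < j)%N ==> (I i < I j)%N]}.

(* The k-vectors Lambda_k(R^n), by their coordinates in the basis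
   e_I = e_(I_0) /\ ... /\ e_(I_(k-1)). *)
Definition kvec (k : nat) := {ffun mindex k -> R^o}.

HB.instance Definition _ k := GRing.Lmodule.on (kvec k).

(* u_1 /\ ... /\ u_k, where the u_i are the rows of u *)
Definition wedge k (u : 'M[R]_(k, n)) : kvec k :=
  [ffun I : mindex k => \det (colsub (val I) u)].

Definition basis_rows k (I : mindex k) : 'M[R]_(k, n) := rowsub (val I) 1%:M.

(* Linear extension to k-vectors of an expression F(u_1, ..., u_k) that is
   multilinear and alternating, i.e. a function of u_1 /\ ... /\ u_k. *)
Definition lext k (W : lmodType R) (F : 'M[R]_(k, n) -> W) (a : kvec k) : W :=
  \sum_(I : mindex k) a I *: F (basis_rows I).

(* u *m v^T is the matrix of the inner products <u_i, v_j> *)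
Definition kdot k (a b : kvec k) : R :=
  lext (fun u => lext (fun v => \det (u *m v^T) : R^o) b) a.

(* The scalar matters for k = 0 only, where the empty wedge product is 1. *)
Definition simple k (a : kvec k) : Prop :=
  exists (c : R) (u : 'M[R]_(k, n)), a = c *: wedge u.

Definition mass k (a : kvec k) : R :=
  inf [set x | exists s : seq (kvec k),
    [/\ forall b, b \in s -> simple b,
        a = \sum_(b <- s) b &
        x = \sum_(b <- s) Num.sqrt (kdot b b)]].

Definition kcontract (v : 'rV[R]_n) k (a : kvec k.+1) : kvec k :=
  lext (fun u : 'M[R]_(k.+1, n) => \sum_(i < k.+1)
    ((-1) ^+ i * edot v (row i u)) *: wedge (row' i u)) a.

Definition lwedge (v : 'rV[R]_n) k (a : kvec k) : kvec k.+1 :=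
  lext (fun u : 'M[R]_(k, n) => wedge (col_mx v u)) a.

Definition kpush (L : 'rV[R]_n -> 'rV[R]_n) k (a : kvec k) : kvec k :=
  lext (fun u : 'M[R]_(k, n) => wedge (\matrix_i L (row i u))) a.

End Multivectors.

Arguments mindex : clear implicits.
Arguments kvec : clear implicits.

Section DiracChains.
Context {R : realType} {n : nat}.
Local Notation E := 'rV[R]_n.

(* The k-element (p; a), as a finitely supported section of Lambda_k(R^n);
   for such sections (p; a) + (p; b) = (p; a + b). *)
Definition kelt k (p : E) (a : kvec R n k) : E -> kvec R n k :=
  fun q => if q == p then a else 0.

Definition csupp k (A : E -> kvec R n k) : set E := [set q | A q != 0].

Definition dirac_pred (U : set E) k : {pred E -> kvec R n k} :=
  fun A => `[< finite_set (csupp A) /\ csupp A `<=` U >].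

Definition translate k (u : E) (A : E -> kvec R n k) : E -> kvec R n k :=
  fun q => A (q - u).

Definition Delta k (s : seq E) (p : E) (a : kvec R n k) : E -> kvec R n k :=
  foldr (fun u A => translate u A - A) (kelt p a) s.

Definition snorm (s : seq E) : R := \prod_(u <- s) enorm u.

Definition inside (U : set E) k (s : seq E) (p : E) (a : kvec R n k) : Prop :=
  smallest (@convex_set R E) (csupp (Delta s p a)) `<=` U.

(* The possible costs of A as a sum of difference chains of order <= r *)
Definition bcost (U : set E) k (r : nat) (A : E -> kvec R n k) : set R :=
  [set x | exists s : seq (seq E * E * kvec R n k),
    [/\ forall t, t \in s -> (size t.1.1 <= r)%N /\ inside U t.1.1 t.1.2 t.2,
        A = \sum_(t <- s) Delta t.1.1 t.1.2 t.2 &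
        x = \sum_(t <- s) snorm t.1.1 * mass t.2]].

Definition bnorm (U : set E) k (r : nat) (A : E -> kvec R n k) : R :=
  inf (bcost U r A).

End DiracChains.

Section DiracModule.
Context {R : realType} {n : nat} (U : set 'rV[R]_n) (k : nat).

Lemma csupp0 : csupp (0 : 'rV[R]_n -> kvec R n k) = set0.
Proof. by rewrite -subset0 => q /=; rewrite /csupp /= eqxx. Qed.

Fact dirac_submod_closed : submod_closed (@dirac_pred R n U k).
Proof.
split; first by apply/asboolP; rewrite csupp0; split.
move=> c A B /asboolP[fA sA] /asboolP[fB sB].
have sub : csupp (c *: A + B) `<=` csupp A `|` csupp B.
  move=> q; rewrite /csupp /= !fctE.
  have [->|] := eqVneq (A q) 0; last by left.
  by rewrite scaler0 add0r; right.
apply/asboolP; split.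
  by apply: sub_finite_set sub _; rewrite finite_setU.
by move=> q /sub[/sA|/sB].
Qed.

HB.instance Definition _ := GRing.isSubmodClosed.Build R ('rV[R]_n -> kvec R n k)
  (@dirac_pred R n U k) dirac_submod_closed.

(* A_k(U) *)
Record dchain := DChain {
  dval :> 'rV[R]_n -> kvec R n k;
  dvalP : dval \in @dirac_pred R n U k }.

HB.instance Definition _ := [isSub for dval].
HB.instance Definition _ := [Choice of dchain by <:].
HB.instance Definition _ :=
  [SubChoice_isSubLmodule of dchain by <:].

End DiracModule.

Section NormLemmas.
Context {R : realType} {n : nat}.
Local Notation E := 'rV[R]_n.

Lemma nonneg_inf_ge0 (X : set R) : (forall x, X x -> 0 <= x) -> 0 <= inf X.
Proof.
move=> X0; have [->|/set0P X1] := eqVneq X set0; first by rewrite inf0.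
exact: lb_le_inf.
Qed.

Lemma nonneg_inf_le (X : set R) x : (forall x, X x -> 0 <= x) -> X x -> inf X <= x.
Proof. by move=> X0 Xx; apply: ge_inf => //; exists 0 => y /X0. Qed.

Lemma mass_ge0 k (a : kvec R n k) : 0 <= mass a.
Proof.
apply: nonneg_inf_ge0 => x [s [_ _ ->]]; apply: sumr_ge0 => *; exact: sqrtr_ge0.
Qed.

Lemma lextZ k (W : lmodType R) (F : 'M[R]_(k, n) -> W) c (a : kvec R n k) :
  lext F (c *: a) = c *: lext F a.
Proof.
by rewrite /lext scaler_sumr; apply: eq_bigr => I _; rewrite ffunE scalerA.
Qed.

Lemma kdotZZ k c (a : kvec R n k) : kdot (c *: a) (c *: a) = c ^+ 2 * kdot a a.
Proof.
rewrite /kdot lextZ expr2 -mulrA; congr (_ * _).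
rewrite /lext mulr_sumr; apply: eq_bigr => I _.
rewrite /GRing.scale /= mulrCA; congr (_ * _).
by rewrite mulr_sumr; apply: eq_bigr => K _; rewrite ffunE mulrA.
Qed.

Lemma simpleZ k c (a : kvec R n k) : simple a -> simple (c *: a).
Proof. by move=> [d [u ->]]; exists (c * d), u; rewrite scalerA. Qed.

Lemma mass_leZ k c (a : kvec R n k) : mass (c *: a) <= `|c| * mass a.
Proof.
have pos (b : kvec R n k) : forall x, [set x | exists s : seq (kvec R n k),
    [/\ forall b, b \in s -> simple b, b = \sum_(b <- s) b &
        x = \sum_(b <- s) Num.sqrt (kdot b b)]] x -> 0 <= x.
  by move=> x [s [_ _ ->]]; apply: sumr_ge0 => *; exact: sqrtr_ge0.
have sc d (b : kvec R n k) (s : seq (kvec R n k)) :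
    (forall b, b \in s -> simple b) -> b = \sum_(b <- s) b ->
    mass (d *: b) <= `|d| * \sum_(b <- s) Num.sqrt (kdot b b).
  move=> ss bE; apply: nonneg_inf_le; first exact: pos.
  exists [seq d *: b | b <- s]; split.
  - by move=> _ /mapP[x xs ->]; apply/simpleZ/ss.
  - by rewrite big_map bE scaler_sumr.
  - rewrite big_map mulr_sumr; apply: eq_bigr => x _.
    by rewrite kdotZZ sqrtrM ?sqr_ge0// sqrtr_sqr.
have [->|c0] := eqVneq c 0.
  rewrite scale0r normr0 mul0r; apply: nonneg_inf_le; first exact: pos.
  by exists [::]; split => //; rewrite !big_nil.
have nc0 : 0 < `|c| by rewrite normr_gt0.
rewrite -ler_pdivrMl //.
have [em|] := eqVneq [set x | exists s : seq (kvec R n k),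
    [/\ forall b, b \in s -> simple b, a = \sum_(b <- s) b &
        x = \sum_(b <- s) Num.sqrt (kdot b b)]] set0.
  have -> : mass (c *: a) = 0.
    rewrite /mass (_ : [set _ | _] = set0) ?inf0//.
    apply/seteqP; split => // x [s [ss ca xE]].
    have : set0 (\sum_(b <- [seq c^-1 *: b | b <- s]) Num.sqrt (kdot b b)).
      rewrite -em; exists [seq c^-1 *: b | b <- s]; split => //.
        by move=> _ /mapP[y ys ->]; apply/simpleZ/ss.
      by rewrite big_map -scaler_sumr -ca scalerA mulVf// scale1r.
    by [].
  by rewrite mulr0 mass_ge0.
move=> /set0P ne; apply: lb_le_inf => // x [s [ss aE ->]].
by rewrite ler_pdivrMl//; exact: sc.
Qed.

Lemma enorm_ge0 (u : E) : 0 <= enorm u.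
Proof. exact: sqrtr_ge0. Qed.

Lemma snorm_ge0 (s : seq E) : 0 <= snorm s.
Proof. by apply: prodr_ge0 => *; exact: enorm_ge0. Qed.

Lemma keltZ k c p (a : kvec R n k) : kelt p (c *: a) = c *: kelt p a.
Proof.
by apply/funext => q; rewrite !fctE /kelt; case: ifP; rewrite ?scaler0.
Qed.

Lemma DeltaZ k c s p (a : kvec R n k) : Delta s p (c *: a) = c *: Delta s p a.
Proof.
elim: s => [|u s IH] /=; first exact: keltZ.
by rewrite IH scalerBr.
Qed.

Lemma bcost_ge0 (U : set E) k r (A : E -> kvec R n k) x :
  bcost U r A x -> 0 <= x.
Proof.
move=> [s [_ _ ->]]; apply: sumr_ge0 => t _.
by rewrite mulr_ge0 ?snorm_ge0 ?mass_ge0.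
Qed.

Lemma bnorm_ge0 (U : set E) k r (A : E -> kvec R n k) : 0 <= bnorm U r A.
Proof. by apply: nonneg_inf_ge0; exact: bcost_ge0. Qed.

Lemma insideZ (U : set E) k c s p (a : kvec R n k) :
  inside U s p a -> inside U s p (c *: a).
Proof.
rewrite /inside DeltaZ => iU q hq; apply: iU => C [cC sC].
apply: hq; split => // x; rewrite /csupp /= !fctE => Dx; apply: sC.
by apply: contra_neq Dx; rewrite /= => ->; rewrite scaler0.
Qed.

Lemma bcost_mono (U : set E) k r r' (A : E -> kvec R n k) : (r <= r')%N ->
  bcost U r A `<=` bcost U r' A.
Proof.
move=> rr x [s [ss AE xE]]; exists s; split => // t /ss[h ?]; split => //.
exact: leq_trans rr.
Qed.

Lemma convex_set1 (p : E) : @convex_set R E [set p].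
Proof. by move=> x y l /set_mem -> /set_mem ->; rewrite convmm; exact: mem_set. Qed.

Lemma inside_nil (U : set E) k p (a : kvec R n k) : U p -> inside U [::] p a.
Proof.
move=> Up q hq; have -> // : q = p; apply: (hq [set p]); split.
  exact: convex_set1.
by move=> x; rewrite /csupp /= /kelt; have [->//|_] := eqVneq x p; rewrite eqxx.
Qed.

Lemma bcost_neq0 (U : set E) k r (A : dchain U k) : bcost U r (dval A) !=set0.
Proof.
have /asboolP[/finite_seqP[s0 sE] sA] := dvalP A.
pose s := undup s0.
have {}sE : csupp (dval A) = [set` s].
  by rewrite sE; apply/seteqP; split => x /=; rewrite mem_undup.
pose t : seq (seq E * E * kvec R n k) := [seq ([::], p, dval A p) | p <- s].
exists (\sum_(t <- t) snorm t.1.1 * mass t.2), t; split => //.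
- move=> _ /mapP[p pA ->]; split => //=.
  by apply: inside_nil; apply: sA; move: pA; rewrite -[is_true _]/([set` s] p) -sE.
- rewrite big_map /=; apply/funext => q.
  rewrite (_ : (\sum_(j <- s) kelt j (dval A j)) q =
     \sum_(j <- s) kelt j (dval A j) q); last first.
    by elim: (s) => [|x l IH]; rewrite ?big_nil// !big_cons -IH.
  have [qs|qs] := boolP (q \in s).
    rewrite (bigD1_seq q) ?undup_uniq//= big1 ?addr0 /kelt ?eqxx// => i iq.
    by rewrite eq_sym (negbTE iq).
  have /negP : ~ csupp (dval A) q by rewrite sE /= (negbTE qs).
  rewrite /csupp /= negbK => /eqP ->; rewrite big_seq big1// => i si.
  by rewrite /kelt; case: eqP => // qi; move: qs; rewrite qi si.
Qed.

Lemma bnorm_le (U : set E) k r (A : E -> kvec R n k) x :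
  bcost U r A x -> bnorm U r A <= x.
Proof. by apply: nonneg_inf_le; exact: bcost_ge0. Qed.

Lemma bnormD (U : set E) k r (A B : dchain U k) :
  bnorm U r (dval (A + B)) <= bnorm U r (dval A) + bnorm U r (dval B).
Proof.
have hl (C : dchain U k) : has_inf (bcost U r (dval C)).
  by split; [exact: bcost_neq0|exists 0 => x; exact: bcost_ge0].
apply/ler_addgt0Pr => e e0.
have e20 : 0 < e / 2 by rewrite divr_gt0.
have [x [s [ss As xs]] xA] := inf_adherent e20 (hl A).
have [y [t [ts Bt yt]] yB] := inf_adherent e20 (hl B).
apply: (@le_trans _ _ (x + y)).
  apply: bnorm_le; exists (s ++ t); split.
  - by move=> z; rewrite mem_cat => /orP[/ss|/ts].
  - by rewrite big_cat /= -As -Bt.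
  - by rewrite big_cat /= -xs -yt.
by rewrite [e]splitr addrACA ltW// ltrD.
Qed.

Lemma bnormZ_le (U : set E) k r c (A : dchain U k) :
  bnorm U r (dval (c *: A)) <= `|c| * bnorm U r (dval A).
Proof.
have sc x : bcost U r (dval A) x -> bnorm U r (dval (c *: A)) <= `|c| * x.
  move=> [s [ss As ->]].
  apply: (@le_trans _ _ (\sum_(t <- s) snorm t.1.1 * mass (c *: t.2))); last first.
    rewrite mulr_sumr; apply: ler_sum => t _; rewrite mulrCA.
    by rewrite ler_wpM2l ?snorm_ge0 ?mass_leZ.
  apply: bnorm_le; exists [seq (t.1, c *: t.2) | t <- s]; split.
  - by move=> _ /mapP[t /ss[tr ti] ->]; split => //; exact: insideZ.
  - rewrite big_map; transitivity (c *: dval A); first by [].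
    by rewrite As scaler_sumr; apply: eq_bigr => t _; rewrite DeltaZ.
  - by rewrite big_map.
have [x0 Ax0] := bcost_neq0 r A.
have [c0|c0] := eqVneq c 0.
  by have := sc _ Ax0; rewrite c0 normr0 !mul0r.
have nc0 : 0 < `|c| by rewrite normr_gt0.
rewrite -ler_pdivrMl //; apply: lb_le_inf; first by exists x0.
by move=> x Ax; rewrite ler_pdivrMl//; exact: sc.
Qed.

Lemma bnorm0 (U : set E) k r : bnorm U r (dval (0 : dchain U k)) = 0.
Proof.
apply/eqP; rewrite eq_le bnorm_ge0 andbT.
by have := bnormZ_le r 0 (0 : dchain U k); rewrite scale0r normr0 mul0r.
Qed.

Lemma bnorm_mono (U : set E) k r r' (A : dchain U k) : (r <= r')%N ->
  bnorm U r' (dval A) <= bnorm U r (dval A).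
Proof.
move=> rr; apply: lb_le_inf; first exact: bcost_neq0.
by move=> x /(bcost_mono rr) h; exact: bnorm_le.
Qed.

End NormLemmas.

Section Chains.
Context {R : realType} {n : nat} (U : set 'rV[R]_n) (k : nat).
Local Notation dchain := (dchain U k).

Definition bcauchy (r : nat) (A : nat -> dchain) : Prop :=
  forall e, 0 < e -> exists m, forall i j, (m <= i)%N -> (m <= j)%N ->
    bnorm U r (dval (A i - A j)) < e.

Definition bnull (r : nat) (A : nat -> dchain) : Prop :=
  forall e, 0 < e -> exists m, forall i, (m <= i)%N ->
    bnorm U r (dval (A i)) < e.

Definition cauchy_pred : {pred nat -> dchain} :=
  fun A => `[< exists r, bcauchy r A >].

Lemma bnullD r r' A B : bnull r A -> bnull r' B -> bnull (maxn r r') (A + B).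
Proof.
move=> nA nB e e0; have e20 : 0 < e / 2 by rewrite divr_gt0.
have [a Ha] := nA _ e20; have [b Hb] := nB _ e20.
exists (maxn a b) => i; rewrite geq_max => /andP[/Ha hA /Hb hB].
apply: le_lt_trans (bnormD _ _ _) _; rewrite [e]splitr; apply: ltrD.
  by apply: le_lt_trans hA; apply: bnorm_mono; exact: leq_maxl.
by apply: le_lt_trans hB; apply: bnorm_mono; exact: leq_maxr.
Qed.

Lemma bnullZ r c A : bnull r A -> bnull r (c *: A).
Proof.
move=> nA e e0; have c0 : 0 < `|c| + 1 by rewrite ltr_wpDl.
have [m Hm] := nA (e / (`|c| + 1)) (divr_gt0 e0 c0); exists m => i /Hm h.
apply: le_lt_trans (bnormZ_le _ _ _) _.
apply: (@le_lt_trans _ _ ((`|c| + 1) * bnorm U r (dval (A i)))).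
  by rewrite ler_wpM2r ?bnorm_ge0// lerDl.
by rewrite mulrC -ltr_pdivlMr.
Qed.

Lemma bcauchyD r r' A B :
  bcauchy r A -> bcauchy r' B -> bcauchy (maxn r r') (A + B).
Proof.
move=> nA nB e e0; have e20 : 0 < e / 2 by rewrite divr_gt0.
have [a Ha] := nA _ e20; have [b Hb] := nB _ e20.
exists (maxn a b) => i j.
rewrite !geq_max => /andP[/Ha hA /Hb hB] /andP[/hA {}hA /hB {}hB].
rewrite (_ : (A + B) i - (A + B) j = (A i - A j) + (B i - B j)); last first.
  by rewrite !fctE opprD addrACA.
apply: le_lt_trans (bnormD _ _ _) _; rewrite [e]splitr; apply: ltrD.
  by apply: le_lt_trans hA; apply: bnorm_mono; exact: leq_maxl.
by apply: le_lt_trans hB; apply: bnorm_mono; exact: leq_maxr.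
Qed.

Lemma bcauchyZ r c A : bcauchy r A -> bcauchy r (c *: A).
Proof.
move=> nA e e0; have c0 : 0 < `|c| + 1 by rewrite ltr_wpDl.
have [m Hm] := nA (e / (`|c| + 1)) (divr_gt0 e0 c0); exists m => i j mi /(Hm _ _ mi) h.
rewrite !fctE -scalerBr; apply: le_lt_trans (bnormZ_le _ _ _) _.
apply: (@le_lt_trans _ _ ((`|c| + 1) * bnorm U r (dval (A i - A j)))).
  by rewrite ler_wpM2r ?bnorm_ge0// lerDl.
by rewrite mulrC -ltr_pdivlMr.
Qed.

Lemma bcauchy_cst r A : bcauchy r (fun=> A).
Proof. by move=> e e0; exists 0%N => i j _ _; rewrite subrr bnorm0. Qed.

Fact cauchy_submod_closed : submod_closed cauchy_pred.
Proof.
split; first by apply/asboolP; exists 0%N; exact: bcauchy_cst.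
move=> c A B /asboolP[r cA] /asboolP[r' cB]; apply/asboolP.
by exists (maxn r r'); apply: bcauchyD => //; exact: bcauchyZ.
Qed.

HB.instance Definition _ := GRing.isSubmodClosed.Build R (nat -> dchain)
  cauchy_pred cauchy_submod_closed.

(* Sequences of Dirac chains that are Cauchy for some B^r-norm *)
Record cseq := CSeq {
  cval :> nat -> dchain;
  cvalP : cval \in cauchy_pred }.

HB.instance Definition _ := [isSub for cval].
HB.instance Definition _ := [Choice of cseq by <:].
HB.instance Definition _ := [SubChoice_isSubLmodule of cseq by <:].

Definition null_pred : {pred cseq} := fun A => `[< exists r, bnull r (cval A) >].

Fact null_submod_closed : submod_closed null_pred.
Proof.
split.
  apply/asboolP; exists 0%N => e e0; exists 0%N => i _.
  by rewrite (_ : cval 0 i = 0) ?bnorm0.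
move=> c A B /asboolP[r nA] /asboolP[r' nB]; apply/asboolP.
by exists (maxn r r'); apply: (@bnullD _ _ (c *: cval A)) => //; exact: bnullZ.
Qed.

HB.instance Definition _ := GRing.isSubmodClosed.Build R cseq
  null_pred null_submod_closed.

(* The inductive limit over r of the completions of A_k(U): an element of the
   limit comes from the completion for some r, hence from a B^r-Cauchy sequence,
   and two such sequences have the same image in the limit iff their difference
   is null for some B^s, s large. *)
Definition chain := Quotient.quot null_pred.

HB.instance Definition _ := GRing.Zmodule.on chain.
HB.instance Definition _ := EqQuotient.on chain.

Local Notation pi := (\pi_(chain)%qT).

Definition chain_scale (c : R) (J : chain) : chain := pi (c *: repr J).

Lemma chain_scale_pi c (A : cseq) : chain_scale c (pi A) = pi (c *: A).
Proof.
apply/eqP; rewrite /chain_scale -Quotient.idealrBE -scalerBr.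
by apply: rpredZ; rewrite Quotient.idealrBE reprK eqxx.
Qed.

Fact chain_scaleA a b J : chain_scale a (chain_scale b J) = chain_scale (a * b) J.
Proof. by elim/quotW: J => A; rewrite (chain_scale_pi b) !chain_scale_pi scalerA. Qed.
Fact chain_scale1 : left_id 1 chain_scale.
Proof. by elim/quotW => A; rewrite chain_scale_pi scale1r. Qed.
Fact chain_scaleDr : right_distributive chain_scale +%R.
Proof.
move=> c; elim/quotW => A; elim/quotW => B.
by rewrite -raddfD /= 3!chain_scale_pi -raddfD scalerDr.
Qed.
Fact chain_scaleDl J : {morph chain_scale^~ J : a b / a + b}.
Proof.
by move=> a b; elim/quotW: J => A; rewrite 3!chain_scale_pi -raddfD scalerDl.
Qed.

HB.instance Definition _ := GRing.Zmodule_isLmodule.Build R chain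
  chain_scaleA chain_scale1 chain_scaleDr chain_scaleDl.

Lemma piD (A B : cseq) : pi (A + B) = pi A + pi B.
Proof. by rewrite raddfD. Qed.

Lemma piZ c (A : cseq) : pi (c *: A) = c *: pi A.
Proof. by rewrite -chain_scale_pi. Qed.

End Chains.

Section Topology.
Context {R : realType} {n : nat} (U : set 'rV[R]_n) (k : nat).
Local Notation chain := (chain U k).
Local Notation pi := (\pi_(chain)%qT).

(* A neighbourhood of 0 in the image of the completion for the B^r-norm: it
   lies between the images of the open and of the closed balls of radius e. *)
Definition step_ball (r : nat) (e : R) : set chain :=
  [set J | exists A : cseq U k, [/\ bcauchy r (cval A), J = pi A &
    exists m, forall i, (m <= i)%N -> bnorm U r (dval (cval A i)) < e]].

(* The absolutely convex sets that meet every completion in a neighbourhood of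
   0 form a base at 0 of the locally convex inductive limit topology. *)
Definition disk_nbhs0 (B : set chain) : Prop :=
  (forall a b x y, `|a| + `|b| <= 1 -> B x -> B y -> B (a *: x + b *: y)) /\
  (forall r, exists2 e, 0 < e & step_ball r e `<=` B).

Definition chain_nbhs (J : chain) : set_system chain :=
  [set W | exists2 B, disk_nbhs0 B & forall K, B K -> W (J + K)].

HB.instance Definition _ := hasNbhs.Build chain chain_nbhs.
HB.instance Definition _ := isPointed.Build chain 0.

Lemma step_ballZ r e c : 0 < c ->
  step_ball r (c * e) `<=` [set J | step_ball r e (c^-1 *: J)].
Proof.
move=> c0 _ [A [cA -> [m Am]]]; exists (c^-1 *: A); split.
- exact: (bcauchyZ c^-1 cA).
- by rewrite piZ.
- exists m => i /Am h; apply: le_lt_trans (bnormZ_le _ _ _) _.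
  by rewrite gtr0_norm ?invr_gt0// ltr_pdivrMl.
Qed.

Lemma disk_nbhs0_0 B : disk_nbhs0 B -> B 0.
Proof.
move=> [_ /(_ 0%N)[e e0]]; apply; exists 0; split.
- exact: (@bcauchy_cst _ _ _ _ _ 0).
- by rewrite raddf0.
- by exists 0%N => i _; rewrite (_ : cval 0 i = 0) ?bnorm0.
Qed.

Lemma disk_nbhs0Z B c : 0 < c -> disk_nbhs0 B -> disk_nbhs0 [set J | B (c *: J)].
Proof.
move=> c0 [cB sB]; split.
  move=> a b x y ab Bx By /=; rewrite scalerDr !scalerA ![c * _]mulrC -!scalerA.
  exact: cB.
move=> r; have [e e0 He] := sB r; exists (c^-1 * e); first by rewrite mulr_gt0 ?invr_gt0.
have ci : 0 < c^-1 by rewrite invr_gt0.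
by move=> J /(step_ballZ ci) /=; rewrite invrK => /He.
Qed.

Lemma disk_nbhs0I B C : disk_nbhs0 B -> disk_nbhs0 C -> disk_nbhs0 (B `&` C).
Proof.
move=> [cB sB] [cC sC]; split.
  by move=> a b x y ab [Bx Cx] [By Cy]; split; [exact: cB|exact: cC].
move=> r; have [e e0 He] := sB r; have [d d0 Hd] := sC r.
exists (Num.min e d); first by rewrite lt_min e0.
move=> _ [A [cA -> [m Am]]]; split.
- by apply: He; exists A; split => //; exists m => i /Am; rewrite lt_min => /andP[].
- by apply: Hd; exists A; split => //; exists m => i /Am; rewrite lt_min => /andP[].
Qed.

Lemma disk_nbhs0T : disk_nbhs0 setT.
Proof. by split => // r; exists 1. Qed.

Lemma disk_nbhs0_half B x y : disk_nbhs0 B ->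
  B (2 *: x) -> B (2 *: y) -> B (x + y).
Proof.
move=> [cB _] Bx By.
have -> : x + y = 2^-1 *: (2 *: x) + 2^-1 *: (2 *: y).
  by rewrite !scalerA mulVf ?pnatr_eq0// !scale1r.
by apply: cB => //; rewrite gtr0_norm ?invr_gt0// [leRHS]splitr div1r.
Qed.

Lemma disk_nbhs0_bal B c x : disk_nbhs0 B -> `|c| <= 1 -> B x -> B (c *: x).
Proof.
move=> [cB _] c1 Bx; have := cB c 0 x x; rewrite scale0r addr0 normr0 addr0.
exact.
Qed.

Lemma disk_nbhs0_abs B x : disk_nbhs0 B -> exists2 c, 0 < c & B (c *: x).
Proof.
move=> [_ sB]; elim/quotW: x => A.
have /asboolP[r cA] := cvalP A; have [e e0 He] := sB r.
have [m Am] := cA 1 ltr01; set M := bnorm U r (dval (cval A m)) + 1.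
have M0 : 0 < M by rewrite ltr_wpDl ?bnorm_ge0.
exists (e / M); first by rewrite divr_gt0.
apply: He; exists ((e / M) *: A); split.
- exact: bcauchyZ.
- by rewrite piZ.
- exists m => i mi; apply: le_lt_trans (bnormZ_le r (e / M) (cval A i)) _.
  rewrite gtr0_norm ?divr_gt0// mulrAC ltr_pdivrMr// ltr_pM2l//.
  have := bnormD r (cval A i - cval A m) (cval A m); rewrite subrK.
  by move/le_lt_trans; apply; rewrite addrC ltrD2l; exact: Am.
Qed.

Lemma chain_nbhs_filter (J : chain) : ProperFilter (nbhs J).
Proof.
apply: Build_ProperFilter.
  by move=> [B dB BW]; apply: (BW 0); exact: disk_nbhs0_0.
split.
- by exists setT => //; exact: disk_nbhs0T.
- move=> V W [B dB BV] [C dC CW]; exists (B `&` C); first exact: disk_nbhs0I.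
  by move=> K [/BV ? /CW].
- by move=> V W VW [B dB BV]; exists B => // K /BV /VW.
Qed.

Lemma chain_nbhs_singleton (J : chain) (W : set chain) : nbhs J W -> W J.
Proof. by move=> [B dB BW]; have := BW _ (disk_nbhs0_0 dB); rewrite addr0. Qed.

Lemma chain_nbhs_nbhs (J : chain) (W : set chain) : nbhs J W -> nbhs J (nbhs^~ W).
Proof.
move=> [B dB BW]; have dB2 := disk_nbhs0Z (ltr0n R 2) dB.
exists [set K | B (2 *: K)] => // K BK; exists [set K | B (2 *: K)] => // L BL.
by rewrite -addrA; apply: BW; exact: disk_nbhs0_half.
Qed.

HB.instance Definition _ := Nbhs_isNbhsTopological.Build chain
  chain_nbhs_filter chain_nbhs_singleton chain_nbhs_nbhs.

Lemma nbhs_disk (J : chain) B : disk_nbhs0 B -> nbhs J [set J + K | K in B].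
Proof. by move=> dB; exists B => // K BK; exists K. Qed.

Lemma chain_add_continuous : continuous (fun x : chain * chain => x.1 + x.2).
Proof.
move=> [x y] W [B dB BW] /=; have dB2 := disk_nbhs0Z (ltr0n R 2) dB.
exists ([set x + K | K in [set K | B (2 *: K)]],
        [set y + K | K in [set K | B (2 *: K)]]).
  by split; exact: nbhs_disk.
move=> [_ _] [/= [K BK <-] [L BL <-]] /=; rewrite addrACA.
by apply: BW; exact: disk_nbhs0_half.
Qed.

Lemma chain_scale_continuous : continuous (fun z : R^o * chain => z.1 *: z.2).
Proof.
move=> [c x] W [B dB BW] /=.
have [d d0 Bd] := disk_nbhs0_abs (2 *: x) dB.
have c20 : 0 < 2 * (`|c| + d) by rewrite mulr_gt0// ltr_wpDl.
have dB2 := disk_nbhs0Z c20 dB.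
exists ([set a : R^o | `|c - a| < d],
        [set x + K | K in [set K | B ((2 * (`|c| + d)) *: K)]]).
  split => /=; last exact: nbhs_disk.
  by exists d.
move=> [a _] [/= ca [K BK <-]] /=.
have -> : a *: (x + K) = c *: x + ((a - c) *: x + a *: K).
  by rewrite scalerDr addrA -scalerDl addrCA subrr addr0.
apply: BW; apply: disk_nbhs0_half => //.
- rewrite scalerA mulrC -scalerA -[a - c](@mulfVK _ d) ?gt_eqF// -scalerA.
  apply: disk_nbhs0_bal => //.
  by rewrite normrM normfV (gtr0_norm d0) ler_pdivrMr// mul1r distrC ltW.
- have cd0 : 0 < `|c| + d by rewrite ltr_wpDl.
  have -> : 2 *: (a *: K) = (a / (`|c| + d)) *: ((2 * (`|c| + d)) *: K).
    by rewrite !scalerA mulrCA divfK ?gt_eqF// mulrC.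
  apply: disk_nbhs0_bal => //.
  rewrite normrM normfV (gtr0_norm cd0) ler_pdivrMr// mul1r.
  rewrite -[a](subrK c) addrC; apply: le_trans (ler_normD _ _) _.
  by rewrite lerD2l distrC ltW.
Qed.

Lemma chain_locally_convex : exists2 B : set_system chain,
  (forall b, b \in B -> convex_set b) & basis B.
Proof.
exists [set W | open W /\ convex_set W]; first by move=> b /set_mem[].
split; first by move=> W [].
move=> x W [B dB BW].
pose B' := [set K | exists2 C, disk_nbhs0 C & forall L, C L -> B (K + L)].
exists [set x + K | K in B'].
  split; last first.
    by exists 0; [exists B => // L; rewrite add0r|rewrite addr0].
  split.
  - rewrite openE => _ [K [C dC CB] <-].
    have dC2 := disk_nbhs0Z (ltr0n R 2) dC.
    exists [set L | C (2 *: L)] => // L CL; exists (K + L); last by rewrite addrA.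
    exists [set L | C (2 *: L)] => // M CM.
    by rewrite -addrA; apply: CB; exact: disk_nbhs0_half.
  - apply/convex_setW => _ _ /set_mem[K [C dC CB] <-] /set_mem[L [D dD DB] <-] t t0 t1.
    apply/mem_set; rewrite /conv /=.
    exists (t%:num *: K + (1 - t%:num) *: L); last first.
      by rewrite !scalerDr [RHS]addrACA -scalerDl subrKC scale1r.
    exists (C `&` D) => [|M [CM DM]]; first exact: disk_nbhs0I.
    have -> : t%:num *: K + (1 - t%:num) *: L + M =
        t%:num *: (K + M) + (1 - t%:num) *: (L + M).
      by rewrite !scalerDr [RHS]addrACA -scalerDl subrKC scale1r.
    apply: dB.1; [|exact: CB|exact: DB].
    by rewrite !ger0_norm ?subr_ge0// subrKC.
move=> _ [K [C dC CB] <-]; apply: BW.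
by rewrite -[K]addr0; apply: CB; exact: disk_nbhs0_0.
Qed.

HB.instance Definition _ := PreTopologicalLmod_isTvs.Build R chain
  chain_add_continuous chain_scale_continuous chain_locally_convex.
HB.instance Definition _ :=
  PreTopologicalNmodule_isTopologicalNmodule.Build chain chain_add_continuous.
HB.instance Definition _ :=
  TopologicalNmodule_isTopologicalLmodule.Build R chain chain_scale_continuous.
HB.instance Definition _ := Uniform_isTvs.Build R chain chain_locally_convex.


End Topology.

Section Integration.
Context {R : realType} {n : nat}.
Local Notation E := 'rV[R]_n.

Lemma cst_cauchy_subproof (U : set E) k (A : dchain U k) :
  (fun=> A) \in @cauchy_pred R n U k.
Proof. by apply/asboolP; exists 0%N; exact: bcauchy_cst. Qed.

Definition dirac_chain (U : set E) k (A : dchain U k) : chain U k :=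
  \pi_(chain U k)%qT (CSeq (cst_cauchy_subproof A)).

(* The given finitely supported section, as an element of A_k(U) whenever its
   support lies in U, and 0 otherwise *)
Definition to_dchain (U : set E) k (A : E -> kvec R n k) : dchain U k :=
  insubd (0 : dchain U k) A.

Definition pelem (U : set E) k (p : E) (a : kvec R n k) : dchain U k :=
  to_dchain U (kelt p a).

(* Forms are functionals on A_k(U); the supremum over an empty set is -oo,
   hence the maximum with 0. *)
Definition fnorm (U : set E) k (r : nat) (w : dchain U k -> R) : \bar R :=
  \big[maxe/0%E]_(j < r.+1) ereal_sup [set y | exists s p (a : kvec R n k),
    [/\ size s = j, inside U s p a, snorm s * mass a = 1 &
        y = `|w (to_dchain U (Delta s p a))|%:E]].

(* w belongs to the Frechet space B_k(U) *)
Definition bounded_form (U : set E) k (w : dchain U k -> R) : Prop :=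
  scalar w /\ forall r, (fnorm r w < +oo)%E.

(* The functional given by (p; a) |-> h p a, for h linear in a *)
Definition pointwise_form (U : set E) k (h : E -> kvec R n k -> R)
    (A : dchain U k) : R :=
  \sum_(p \in [set: E]) h p (dval A p).

(* Any representative of J is a sequence converging to (a representative of) J
   in the completion for some B^r-norm. *)
Definition chain_integral (U : set E) k (J : chain U k) (w : dchain U k -> R) : R :=
  lim (w (cval (repr J) i) @[i --> \oo]).

Lemma widen_subproof (U : set E) k (A : dchain U k) :
  dval A \in @dirac_pred R n [set: E] k.
Proof. by have /asboolP[fA _] := dvalP A; apply/asboolP; split. Qed.

Definition widen (U : set E) k (A : dchain U k) : dchain [set: E] k :=
  DChain (widen_subproof A).

Lemma bnorm_widen (U : set E) k r (A : dchain U k) :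
  bnorm [set: E] r (dval A) <= bnorm U r (dval A).
Proof.
apply: lb_le_inf; first exact: bcost_neq0.
move=> x [s [ss As xs]]; apply: bnorm_le; exists s; split => //.
by move=> t /ss[]; split.
Qed.

Lemma widen_cauchy_subproof (U : set E) k (A : cseq U k) :
  (fun i => widen (cval A i)) \in @cauchy_pred R n [set: E] k.
Proof.
have /asboolP[r cA] := cvalP A; apply/asboolP; exists r => e /cA[m Am].
exists m => i j mi /(Am _ _ mi); apply: le_lt_trans.
exact: (bnorm_widen r (cval A i - cval A j)).
Qed.

(* The image of J in the space of chains in R^n *)
Definition chain_widen (U : set E) k (J : chain U k) : chain [set: E] k :=
  \pi_(chain [set: E] k)%qT (CSeq (widen_cauchy_subproof (repr J))).

Definition accessible k (K : chain [set: E] k) (X : set E) : Prop :=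
  forall W : set E, open W -> X `<=` W ->
    exists A : nat -> dchain [set: E] k,
      (forall i, csupp (dval (A i)) `<=` W) /\
      dirac_chain (A i) @[i --> \oo] --> K.

Definition is_support k (K : chain [set: E] k) (X : set E) : Prop :=
  [/\ closed X, accessible K X &
      forall Y, closed Y -> accessible K Y -> X `<=` Y].

End Integration.

Section Boundary.
Context {R : realType} {n : nat} (U : set 'rV[R]_n).

(* The continuous linear extensions to chains of the operators given on
   k-elements; there is at most one since Dirac chains are dense. *)
Definition is_retraction (v : 'rV[R]_n) k (T : chain U k.+1 -> chain U k) : Prop :=
  [/\ linear T, continuous T & forall p a, U p ->
      T (dirac_chain (pelem U p a)) = dirac_chain (pelem U p (kcontract v a))].

Definition is_prederivative (v : 'rV[R]_n) k (T : chain U k -> chain U k) : Prop :=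
  [/\ linear T, continuous T & forall p a, U p ->
      dirac_chain (pelem U (p + t *: v) (t^-1 *: a)) -
        dirac_chain (pelem U p (t^-1 *: a))
      @[t --> (0 : R)^'] --> T (dirac_chain (pelem U p a))].

Definition retraction (v : 'rV[R]_n) k : chain U k.+1 -> chain U k :=
  xget (fun=> 0) (@is_retraction v k).

Definition prederivative (v : 'rV[R]_n) k : chain U k -> chain U k :=
  xget (fun=> 0) (@is_prederivative v k).

Definition boundary k (J : chain U k.+1) : chain U k :=
  \sum_(i < n) prederivative (delta_mx 0 i) (retraction (delta_mx 0 i) J).

End Boundary.

Section Flows.
Context {R : realType} {n : nat}.
Local Notation E := 'rV[R]_n.

Definition pderivs {W : normedModType R} (s : seq 'I_n) (f : E -> W) : E -> W :=
  foldr (fun i h x => 'D_(delta_mx 0 i) h x) f s.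

Definition smooth_on {W : normedModType R} (U : set E) (f : E -> W) : Prop :=
  forall s x, U x -> differentiable (pderivs s f) x.

(* V belongs to V(U); the empty list of partial derivatives gives V itself. *)
Definition bounded_smooth_field (U : set E) (V : E -> E) : Prop :=
  smooth_on U V /\ forall s, exists M : R, forall x, U x -> `|pderivs s V x| <= M.

(* h -> 0 with t + h in [0, t0[, i.e. one-sided limits at t = 0 *)
Definition time_filter (t0 t : R) : set_system R :=
  within [set h | 0 <= t + h < t0] (0 : R)^'.

Definition time_derivative {W : normedModType R} (t0 : R) (f : R -> W) (t : R)
    (l : W) : Prop :=
  h^-1 *: (f (t + h) - f t) @[h --> time_filter t0 t] --> l.

Definition form_time_derivative (U : set E) k (t0 : R)
    (w : R -> dchain U k -> R) (t : R) (w' : dchain U k -> R) : Prop :=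
  forall r, fnorm r (fun A => h^-1 * (w (t + h) A - w t A) - w' A)
    @[h --> time_filter t0 t] --> 0%E.

(* phi t is the time-t map of the flow of V, with values in U on N. *)
Definition is_flow (U : set E) (V : E -> E) (N : set E) (t0 : R)
    (phi : R -> E -> E) : Prop :=
  forall p, N p -> phi 0 p = p /\ forall t, 0 <= t < t0 ->
    U (phi t p) /\ time_derivative t0 (phi^~ p) t (V (phi t p)).

(* g in C_c^oo(N) equals 1 on a neighbourhood of S. *)
Definition cutoff (S N : set E) (g : E -> R) : Prop :=
  [/\ smooth_on [set: E] g,
      compact (closure [set x | g x != 0]),
      closure [set x | g x != 0] `<=` N &
      exists W, [/\ open W, S `<=` W & forall x, W x -> g x = 1]].

(* g f^* w; as g vanishes outside N, this is the extension by 0 of a form on N. *)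
Definition cut_pullback (U : set E) k (g : E -> R) (f : E -> E)
    (w : dchain U k -> R) : dchain U k -> R :=
  pointwise_form (fun p a => g p * w (pelem U (f p) (kpush ('d f p) a))).

(* J is the pushforward by f, defined on N, of a chain J0 with support S. The
   integral over J0 is the same for all cutoffs g. *)
Definition is_pushforward (U : set E) k (S N : set E) (f : E -> E)
    (J0 J : chain U k) : Prop :=
  exists g, cutoff S N g /\ forall w, bounded_form w ->
    chain_integral J w = chain_integral J0 (cut_pullback g f w).

(* i_V w : (p; a) |-> w (p; V(p) /\ a) *)
Definition interior_product (U : set E) (V : E -> E) k
    (w : dchain U k.+1 -> R) : dchain U k -> R :=
  pointwise_form (fun p a => w (pelem U p (lwedge (V p) a))).

End Flows.

(* Main.v *)
Require Import Defs.
From HB Require Import structures.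
From mathcomp Require Import all_boot all_order all_algebra.
From mathcomp Require Import all_classical all_reals all_analysis.
From mathcomp Require Import perm ring lra zify.

Set Implicit Arguments.
Unset Strict Implicit.
Unset Printing Implicit Defensive.

Import Order.TTheory GRing.Theory Num.Theory.
Import numFieldNormedType.Exports.

Local Open Scope classical_set_scope.
Local Open Scope ring_scope.

(** A form [w] of top degree m = n+1 is a function f, its value on the unit
m-vector, times the volume form, and its pullback by the flow [phi] of [V] is
det(D phi_t) f(phi_t) times the volume form. By Liouville's formula and the
chain rule the time derivative of this function is det(D phi_t) times
div(f V)(phi_t) ([pullback_primitive]): the derivative of the pullback of w is the
pullback of the form with density div(f V). This is Cartan's formula, dw being
0. Stokes' theorem identifies the integral of the latter form over J with that
of i_V w over the boundary of J ([boundary_formula]). Hence the theorem holds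
for a Dirac chain and a fixed form.

An arbitrary chain J_0 is a limit of Dirac chains for one of the B^r norms. The
pointwise identity passes to the limit because the integrals over the Dirac
chains and their time derivatives converge uniformly on [0,T]
([integral_primitive]), which holds as soon as the B^r norm of g phi_t^* w is bounded
uniformly in t, for g the cutoff function ([cut_pullback_bnd]). This reduces
the theorem to regularity statements. A form, which is only a functional on
Dirac chains, has a smooth density, with partial derivatives the densities of
the forms w o P_(e_i) ([form_nice]); conversely a function with bounded
derivatives is the density of a bounded form ([pointwise_form_bnd]). The
derivatives of phi_t of every order are locally bounded, uniformly in t
([flow_nice]): the first derivatives solve the variation equation, a linear
equation with coefficients DV(phi_t), so that regularity of order k of the flow
gives regularity of order k+1. Finally the cutoff turns local bounds into global
ones ([cutoff_nice]), and the choice of the cutoff does not matter since J_0 is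
a limit of Dirac chains supported where two given cutoffs are both 1
([cut_pullback_unique]).

For a family w_t, the difference quotient of the integral of w_t over J_t is the
sum of the integral over J_(t+h) of the error of the difference quotient of w_t,
of the integral of w'_t over J_(t+h), and of the difference quotient for the
fixed form w_t. The first tends to 0 because that error does in the B^r norm,
and the chains J_s are uniformly bounded on forms of bounded B^r norm. *)

(** * Calculus on spaces of row vectors *)

Lemma cvg_sumf {K : numFieldType} {W : normedModType K} {T I : Type} (F : set_system T)
  (FF : Filter F) (r : seq I) (f : I -> T -> W) (l : I -> W) :
  (forall i, f i x @[x --> F] --> l i) ->
  \sum_(i <- r) f i x @[x --> F] --> \sum_(i <- r) l i.
Proof.
move=> h; elim: r => [|i r IH].
  by rewrite big_nil; under eq_fun do rewrite big_nil; exact: cvg_cst.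
by rewrite big_cons; under eq_fun do rewrite big_cons; apply: cvgD.
Qed.

Lemma real_cauchy_cvg {R : realType} (u : nat -> R) :
  (forall e, 0 < e -> exists m, forall i j, (m <= i)%N -> (m <= j)%N -> `|u i - u j| < e) ->
  cvg (u i @[i --> \oo]).
Proof.
move=> h; apply/cauchy_cvgP/cauchy_ballP => e e0.
have [m hm] := h _ e0.
pose X : set R := [set z | exists2 i, (m <= i)%N & z = u i].
exists (X, X); first by split; exists m => // i mi; exists i.
by move=> [_ _] /= [[i mi ->] [j mj ->]]; exact: hm.
Qed.

Section GeneralDiff.
Context {R : realType} {V W : normedModType R}.

(** A quadratic remainder is negligible with respect to the increment. *)
Lemma differentiable_quad (f : V -> W) (L : {linear V -> W}) p (C d : R) :
  continuous L ->
  0 < d -> (forall u, `|u| < d -> `|f (p + u) - f p - L u| <= C * `|u| ^+ 2) ->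
  differentiable f p /\ 'd f p = L :> (V -> W).
Proof.
move=> cL d0 h.
have ho : f \o shift p = cst (f p) + L +o_ 0 id.
  apply/eqaddoP => e e0; have C0 : 0 < `|C| + 1 by rewrite ltr_wpDl.
  have m0 : 0 < Num.min d (e / (`|C| + 1)) by rewrite lt_min d0 divr_gt0.
  near=> u.
  have : `|u| < Num.min d (e / (`|C| + 1)).
    by near: u; exact: (nbhs0_lt m0).
  rewrite lt_min => /andP[ud ue]; rewrite !fctE /= opprD addrA [u + p]addrC.
  apply: le_trans (h u ud) _; rewrite expr2 mulrA ler_wpM2r//.
  rewrite ltr_pdivlMr// in ue; apply: le_trans (ltW ue); rewrite mulrC ler_wpM2l//.
  by apply: le_trans (ler_norm _) _; rewrite lerDl.
have dE := diff_unique cL ho.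
by split => //; apply/diff_locallyP; rewrite dE.
Unshelve. all: by end_near. Qed.

Lemma differentiable_near (f g : V -> W) p : (\near p, f p = g p) ->
  differentiable f p -> differentiable g p.
Proof.
move=> fg df; have fgp := nbhs_singleton fg.
have cL := diff_continuous df.
have ho : g \o shift p = cst (g p) + 'd f p +o_ 0 id.
  apply/eqaddoP => e e0.
  have /diff_locallyP[_ /eqaddoP/(_ e e0) hf] := df.
  have sh : \forall u \near (0 : V), f (u + p) = g (u + p).
    have : (fun u : V => u + p) @ 0 --> p.
      by rewrite -[X in _ --> X]add0r; apply: cvgD; [exact: cvg_id|exact: cvg_cst].
    by move=> /(_ _ fg).
  near=> u; have : `|(f \o shift p - (cst (f p) + 'd f p)) u| <= e * `|u| by near: u.
  rewrite !fctE /= fgp (_ : f (u + p) = g (u + p))//; near: u; exact: sh.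
have dE := diff_unique cL ho.
by apply/diff_locallyP; rewrite dE.
Unshelve. all: by end_near. Qed.

End GeneralDiff.

Lemma diff_sum {R : realType} {n : nat} (W : normedModType R) (f : 'rV[R]_n -> W) p u : differentiable f p ->
  'd f p u = \sum_i u 0 i *: 'D_(delta_mx 0 i) f p.
Proof.
move=> df; rewrite [u in LHS]row_sum_delta linear_sum; apply: eq_bigr => i _.
by rewrite linearZ /= deriveE.
Qed.

Section Calculus.
Context {R : realType} {n : nat}.
Local Notation E := 'rV[R]_n.

Lemma coord_norm (u : E) i : `|u 0 i| <= `|u|.
Proof.
rewrite [X in _ <= X]mx_normrE.
exact: (le_bigmax _ (fun ij : 'I_1 * 'I_n => `|u ij.1 ij.2|) (0, i)).
Qed.

Lemma norm_coord (u : E) c : 0 <= c -> (forall i, `|u 0 i| <= c) -> `|u| <= c.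
Proof.
move=> c0 h; rewrite [X in X <= _]mx_normrE; apply/bigmax_leP; split => // -[i j] _ /=.
by rewrite ord1.
Qed.

Lemma linear_rV_continuous (W : normedModType R) (L : {linear E -> W}) : continuous L.
Proof.
move=> x; have -> : (L : E -> W) = (fun u => \sum_i u 0 i *: L (delta_mx 0 i)).
  apply/funext => u; rewrite {1}[u]row_sum_delta linear_sum.
  by apply: eq_bigr => i _; rewrite linearZ.
apply: (@cvg_sumf _ _ _ _ _ (nbhs_filter x)) => i; apply: cvgZr_tmp; exact: coord_continuous.
Qed.

Lemma is_derive_line (W : normedModType R) (f : E -> W) p u (t : R) :
  differentiable f (p + t *: u) ->
  is_derive t 1 (fun s : R => f (p + s *: u)) (\sum_i u 0 i *: 'D_(delta_mx 0 i) f (p + t *: u)).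
Proof.
move=> df; rewrite -diff_sum//.
have dl : is_diff t (fun s : R => p + s *: u) (fun s : R => s *: u).
  by apply: is_diff_eq; rewrite add0r.
have dc : is_diff t (f \o (fun s : R => p + s *: u)) ('d f (p + t *: u) \o (fun s : R => s *: u)).
  by apply: is_diff_comp; exact: DiffDef.
split; first by apply/derivable1_diffP; case: dc.
rewrite deriveE; last by case: dc.
have [_ ->] := dc; by rewrite /= scale1r.
Qed.

(** The one-variable mean value theorem on the segment from [p] to [p + u]. *)
Lemma mvt_line (f : E -> R) p u : (forall t : R, 0 <= t <= 1 -> differentiable f (p + t *: u)) ->
  exists2 t : R, 0 <= t <= 1 &
    f (p + u) - f p = \sum_i u 0 i * 'D_(delta_mx 0 i) f (p + t *: u).
Proof.
move=> df.
have [| |t] := @MVT_segment R (fun s => f (p + s *: u))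
    (fun t => \sum_i u 0 i *: 'D_(delta_mx 0 i) f (p + t *: u)) 0 1 ler01.
- move=> t; rewrite in_itv/= => /andP[t0 t1].
  by apply: is_derive_line; apply: df; rewrite !ltW.
- apply: derivable_within_continuous => t; rewrite in_itv/= => t01.
  by have [] := is_derive_line (df t t01).
by rewrite in_itv/= scale1r scale0r addr0 subr0 mulr1 => t01 ->; exists t.
Qed.

Lemma mvt_bound (f : E -> R) p u M :
  (forall t : R, 0 <= t <= 1 -> differentiable f (p + t *: u)) ->
  (forall t : R, 0 <= t <= 1 -> forall i, `|'D_(delta_mx 0 i) f (p + t *: u)| <= M) ->
  `|f (p + u) - f p| <= M * \sum_i `|u 0 i|.
Proof.
move=> df hM; have [t t01 ->] := mvt_line df.
apply: le_trans (ler_norm_sum _ _ _) _; rewrite mulr_sumr; apply: ler_sum => i _.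
by rewrite normrM mulrC ler_wpM2r// hM.
Qed.

(** The derivative of f - L, for L the differential of f at p, is controlled by
   the oscillation of the partial derivatives. *)
Lemma mvt_taylor (f : E -> R) p u M :
  (forall t : R, 0 <= t <= 1 -> differentiable f (p + t *: u)) ->
  (forall t : R, 0 <= t <= 1 -> forall i,
     `|'D_(delta_mx 0 i) f (p + t *: u) - 'D_(delta_mx 0 i) f p| <= M) ->
  `|f (p + u) - f p - \sum_i u 0 i * 'D_(delta_mx 0 i) f p| <= M * \sum_i `|u 0 i|.
Proof.
move=> df hM; have [t t01 ->] := mvt_line df; rewrite -sumrB.
apply: le_trans (ler_norm_sum _ _ _) _; rewrite mulr_sumr; apply: ler_sum => i _.
by rewrite -mulrBr normrM mulrC ler_wpM2r// hM.
Qed.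

Lemma sum_coord_norm (u : E) : \sum_i `|u 0 i| <= n%:R * `|u|.
Proof.
apply: le_trans (ler_sum _ (fun i _ => coord_norm u i)) _.
by rewrite sumr_const card_ord mulr_natl.
Qed.

Section Partial.
Variable i : 'I_n.
Local Notation pd := (fun f x => 'D_(delta_mx 0 i) f x).

Lemma pdD (f g : E -> R) p : differentiable f p -> differentiable g p ->
  pd (fun x => f x + g x) p = pd f p + pd g p.
Proof. by move=> df dg; apply: deriveD; exact: diff_derivable. Qed.

Lemma pdM (f g : E -> R) p : differentiable f p -> differentiable g p ->
  pd (fun x => f x * g x) p = pd f p * g p + f p * pd g p.
Proof.
move=> df dg; rewrite [LHS]deriveM; [|exact: diff_derivable..].
by rewrite /GRing.scale /= addrC [g p * _]mulrC.
Qed.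

Lemma pd_cst (c : R) (p : E) : pd (fun=> c) p = 0.
Proof. exact: derive_cst. Qed.

Lemma diff_coord m (g : E -> 'rV[R]_m) j p : differentiable g p ->
  differentiable (fun x => g x 0 j) p /\
  forall u, 'd (fun x => g x 0 j) p u = 'd g p u 0 j.
Proof.
move=> dg.
pose h (M : 'rV[R]_m) : R := M 0 j.
have lh : linear h by move=> a u v; rewrite /h !mxE.
pose hL := GRing.isLinear.Build _ _ _ _ h lh.
pose h' : {linear 'rV[R]_m -> R} := HB.pack h hL.
have dh : differentiable h' (g p) by exact: differentiable_coord.
have -> : (fun x => g x 0 j) = h' \o g by [].
split; first exact: differentiable_comp.
have ch : continuous h' by move=> x; exact: coord_continuous.
move=> u; have := congr1 (@^~ u) (diff_comp dg dh) => /= ->.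
by have := congr1 (@^~ ('d g p u)) (diff_lin (g p) ch).
Qed.

Lemma pd_coord m (g : E -> 'rV[R]_m) j p : differentiable g p ->
  pd (fun x => g x 0 j) p = (pd g p) 0 j.
Proof.
move=> dg; have [dgj dE] := diff_coord j dg.
by rewrite !deriveE// dE.
Qed.

Lemma pd_comp m (f : 'rV[R]_m -> R) (g : E -> 'rV[R]_m) p :
  differentiable g p -> differentiable f (g p) ->
  differentiable (fun x => f (g x)) p /\
  pd (fun x => f (g x)) p =
    \sum_j 'D_(delta_mx 0 j) f (g p) * pd (fun x => g x 0 j) p.
Proof.
move=> dg df; have dfg : differentiable (f \o g) p by exact: differentiable_comp.
split => //; rewrite deriveE// [LHS](congr1 (@^~ _) (diff_comp dg df)) [LHS]/=.
rewrite (diff_sum _ df); apply: eq_bigr => j _.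
by rewrite (pd_coord _ dg) (deriveE _ dg) mulrC.
Qed.

End Partial.

End Calculus.

(** * Iterated partial derivatives in a class of functions *)

Lemma differentiable_rV {R : realType} {n m : nat} (f : 'rV[R]_n -> 'rV[R]_m) p :
  (forall j, differentiable (fun x => f x 0 j) p) -> differentiable f p.
Proof.
move=> df; have -> : f = \sum_(j < m) (fun x => f x 0 j *: (delta_mx 0 j : 'rV[R]_m)).
  apply/funext => x; rewrite fct_sumE {1}[f x]row_sum_delta.
  by [].
by apply: differentiable_sum => j; exact: differentiableZl.
Qed.

Section Nice.
Context {R : realType} {n : nat} {P : Type} (X : set P) (D : set 'rV[R]_n).
Local Notation E := 'rV[R]_n.
Hypothesis oD : open D.
Implicit Types (Q : (P -> E -> R) -> Prop) (G H : P -> E -> R).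

(** The indices [x : P] are times, forms, or pairs of both, and [Q] is a class of
   families of functions, such as the uniformly bounded ones: the uniformity in
   the index, which all later estimates need, is part of [Q]. *)
Fixpoint nice Q (k : nat) G : Prop := Q G /\
  if k is k'.+1 then
    (forall x p, X x -> D p -> differentiable (G x) p) /\
    forall i, nice Q k' (fun x p => 'D_(delta_mx 0 i) (G x) p)
  else True.

(** What [Q] must satisfy for the class [nice Q k] to be stable under the Leibniz
   and chain rules. *)
Definition adequate Q : Prop :=
  [/\ forall G H, (forall x p, X x -> D p -> G x p = H x p) -> Q G -> Q H,
      forall G H, Q G -> Q H -> Q (fun x p => G x p + H x p),
      forall G H, Q G -> Q H -> Q (fun x p => G x p * H x p) &
      forall c, Q (fun _ _ => c)].

Lemma nice_base Q k G : nice Q k G -> Q G.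
Proof. by case: k => [|k] []. Qed.

Lemma nice_le Q k k' G : (k' <= k)%N -> nice Q k G -> nice Q k' G.
Proof.
elim: k k' G => [|k IH] [|k'] G //=; first by move=> _ [].
by rewrite ltnS => kk [QG [dG nG]]; split => //; split => // i; exact: IH (nG i).
Qed.

Lemma near_open p : D p -> forall (S : E -> Prop), (forall q, D q -> S q) -> \near p, S p.
Proof. by move=> Dp S DS; apply: filterS DS _; exact: open_nbhs_nbhs. Qed.

Lemma nice_congr Q k G H :
  (forall G H, (forall x p, X x -> D p -> G x p = H x p) -> Q G -> Q H) ->
  (forall x p, X x -> D p -> G x p = H x p) -> nice Q k G -> nice Q k H.
Proof.
move=> Qeq; elim: k G H => [|k IH] G H GH /= [QG dG]; split => //.
- exact: Qeq QG.
- exact: Qeq QG.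
have [dG1 nG] := dG; split.
  move=> x p Xx Dp; apply: differentiable_near (dG1 x p Xx Dp).
  by apply: near_open => // q; exact: GH.
move=> i; apply: IH (nG i) => x p Xx Dp; apply: near_eq_derive.
by apply: near_open => // q; exact: GH.
Qed.

Variable Q : (P -> E -> R) -> Prop.
Hypothesis aQ : adequate Q.

Let Qeq G H : (forall x p, X x -> D p -> G x p = H x p) -> Q G -> Q H.
Proof. by case: aQ => h _ _ _; exact: h. Qed.

Lemma nice_eq k G H : (forall x p, X x -> D p -> G x p = H x p) ->
  nice Q k G -> nice Q k H.
Proof. exact: nice_congr. Qed.

Lemma niceD k G H : nice Q k G -> nice Q k H -> nice Q k (fun x p => G x p + H x p).
Proof.
have [_ QD _ _] := aQ.
elim: k G H => [|k IH] G H /= [QG dG] [QH dH]; split => //; try exact: QD.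
have [dG1 nG] := dG; have [dH1 nH] := dH; split.
  by move=> x p Xx Dp; apply: differentiableD; [exact: dG1|exact: dH1].
move=> i; apply: nice_eq (IH _ _ (nG i) (nH i)) => x p Xx Dp.
by rewrite pdD//; [exact: dG1|exact: dH1].
Qed.

Lemma niceM k G H : nice Q k G -> nice Q k H -> nice Q k (fun x p => G x p * H x p).
Proof.
have [_ _ QM _] := aQ.
elim: k G H => [|k IH] G H nG nH.
  by split => //; apply: QM; [exact: nice_base nG|exact: nice_base nH].
split; first by apply: QM; [exact: nice_base nG|exact: nice_base nH].
have [_ [dG1 nG1]] := nG; have [_ [dH1 nH1]] := nH; split.
  by move=> x p Xx Dp; apply: differentiableM; [exact: dG1|exact: dH1].
move=> i.
have n1 := IH _ _ (nG1 i) (nice_le (leqnSn k) nH).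
have n2 := IH _ _ (nice_le (leqnSn k) nG) (nH1 i).
apply: nice_eq (niceD n1 n2) => x p Xx Dp.
by rewrite pdM//; [exact: dG1|exact: dH1].
Qed.

Lemma nice_cst k (c : R) : nice Q k (fun _ _ => c).
Proof.
have [_ _ _ Qc] := aQ.
elim: k c => [|k IH] c; split=> //.
split => [x p _ _|i]; first exact: differentiable_cst.
by apply: nice_eq (IH 0) => x p _ _; rewrite pd_cst.
Qed.

Lemma nice_sum k (I : Type) (r : seq I) (F : I -> P -> E -> R) :
  (forall i, nice Q k (F i)) -> nice Q k (fun x p => \sum_(i <- r) F i x p).
Proof.
move=> nF; elim: r => [|i r IH].
  by apply: nice_eq (nice_cst k 0) => x p _ _; rewrite big_nil.
by apply: nice_eq (niceD (nF i) IH) => x p _ _; rewrite big_cons.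
Qed.

Lemma nice_prod k (I : Type) (r : seq I) (F : I -> P -> E -> R) :
  (forall i, nice Q k (F i)) -> nice Q k (fun x p => \prod_(i <- r) F i x p).
Proof.
move=> nF; elim: r => [|i r IH].
  by apply: nice_eq (nice_cst k 1) => x p _ _; rewrite big_nil.
by apply: nice_eq (niceM (nF i) IH) => x p _ _; rewrite big_cons.
Qed.

Lemma nice_det k m (M : P -> E -> 'M[R]_m) :
  (forall i j, nice Q k (fun x p => M x p i j)) -> nice Q k (fun x p => \det (M x p)).
Proof.
move=> nM; rewrite /determinant.
by apply: nice_sum => s; apply: niceM; [exact: nice_cst|apply: nice_prod].
Qed.

End Nice.

(** By induction on the order: the chain rule expresses the derivatives of the
   composition by derivatives of [f] of lower order, composed with [psi]. The two
   classes differ because [f] and the composition live on different spaces. *)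
Lemma nice_comp {R : realType} {n m : nat} {P : Type} (X : set P) (D : set 'rV[R]_n)
    (U : set 'rV[R]_m) Q Q' (psi : P -> 'rV[R]_n -> 'rV[R]_m) :
  open D -> adequate X D Q -> (forall x p, X x -> D p -> U (psi x p)) ->
  (forall f, Q' f -> Q (fun x p => f x (psi x p))) ->
  forall k f, (forall j, nice X D Q k (fun x p => psi x p 0 j)) ->
  nice X U Q' k f -> nice X D Q k (fun x p => f x (psi x p)).
Proof.
move=> oD aQ psiU QQ; elim=> [|k IH] f npsi nf.
  by split => //; apply/QQ/(nice_base nf).
have dpsi x p : X x -> D p -> differentiable (psi x) p.
  by move=> Xx Dp; apply: differentiable_rV => j; have [_ [+ _]] := npsi j; apply.
split; first by apply/QQ/(nice_base nf).
have [_ [df nf1]] := nf.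
have dc x p : X x -> D p -> forall i, differentiable (fun x0 => f x (psi x x0)) p /\
  'D_(delta_mx 0 i) (fun x0 => f x (psi x x0)) p =
    \sum_j 'D_(delta_mx 0 j) (f x) (psi x p) * 'D_(delta_mx 0 i) (fun y => psi x y 0 j) p.
  move=> Xx Dp i; apply: pd_comp; first exact: dpsi.
  by apply: df => //; exact: psiU.
split=> [x p Xx Dp|i].
  have [n0|n0] := posnP n; last by have [] := dc x p Xx Dp (Ordinal n0).
  by apply: (@differentiable_comp _ _ _ _ (psi x) (f x)); [exact: dpsi|apply: df => //; exact: psiU].
apply: (@nice_eq _ _ _ _ _ oD _ aQ _ (fun x p => \sum_j
    'D_(delta_mx 0 j) (f x) (psi x p) * 'D_(delta_mx 0 i) (fun y => psi x y 0 j) p)).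
  by move=> x p Xx Dp; have [_ ->] := dc x p Xx Dp i.
apply: nice_sum => // j; apply: niceM => //.
  apply: IH (nf1 j) => l; exact: nice_le (leqnSn k) (npsi l).
by have [_ [_ +]] := npsi j; apply.
Qed.

Lemma nice_reparam {R : realType} {n : nat} {P P' : Type} (X : set P) (X' : set P')
    (D D' : set 'rV[R]_n) Q Q' (pi : P' -> P) :
  (forall x, X' x -> X (pi x)) -> D' `<=` D ->
  (forall G, Q G -> Q' (fun x => G (pi x))) ->
  forall k G, nice X D Q k G -> nice X' D' Q' k (fun x => G (pi x)).
Proof.
move=> XX DD QQ; elim=> [|k IH] G [QG dG]; split => //; try exact: QQ.
have [dG1 nG] := dG; split => [x p Xx Dp|i]; first by apply: dG1; [exact: XX|exact: DD].
exact: IH (nG i).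
Qed.

(** * Continuously differentiable functions of time *)

Section TimeSolutions.
Context {R : realType} (T : R).
Hypothesis T0 : 0 < T.

(** Derivatives are asked for in the interior only; at the end points they are
   recovered from the continuity of [G] by the mean value inequality [primitive_mvt]. *)
Definition primitive (F G : R -> R) : Prop :=
  [/\ {within `[0, T], continuous F}, {within `[0, T], continuous G} &
      forall t, 0 < t < T -> is_derive t 1 F (G t)].

Lemma within_continuousP (a b : R) (f : R -> R) :
  {within `[a, b], continuous f} <->
  forall t, a <= t <= b -> forall e, 0 < e -> exists2 d, 0 < d &
    forall s, a <= s <= b -> `|s - t| < d -> `|f s - f t| < e.
Proof.
split=> [/subspace_continuousP h t tab e e0|h].
  have /h/cvgrPdist_lt/(_ e e0) : `[a, b]%classic t by rewrite /= in_itv.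
  move=> [d /= d0 hd]; exists d => // s sab sd; rewrite distrC; apply: hd.
    by rewrite /= distrC.
  by rewrite /= in_itv.
apply/subspace_continuousP => t; rewrite /= in_itv/= => tab.
apply/cvgrPdist_lt => e e0; have [d d0 hd] := h t tab e e0.
exists d => // s /=; rewrite distrC in_itv/= => sd sab.
by rewrite distrC; exact: hd.
Qed.

Lemma within_continuousM (a b : R) (f g : R -> R) : {within `[a, b], continuous f} ->
  {within `[a, b], continuous g} -> {within `[a, b], continuous (fun t => f t * g t)}.
Proof.
move=> /subspace_continuousP hf /subspace_continuousP hg.
by apply/subspace_continuousP => t tab; apply: cvgM; [exact: hf|exact: hg].
Qed.

Lemma within_continuousD (a b : R) (f g : R -> R) : {within `[a, b], continuous f} ->
  {within `[a, b], continuous g} -> {within `[a, b], continuous (fun t => f t + g t)}.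
Proof.
move=> /subspace_continuousP hf /subspace_continuousP hg.
by apply/subspace_continuousP => t tab; apply: cvgD; [exact: hf|exact: hg].
Qed.

Lemma within_continuous_cst (a b c : R) : {within `[a, b], continuous (fun _ : R => c)}.
Proof. by apply/subspace_continuousP => t tab; exact: cvg_cst. Qed.

Lemma within_continuous_sum (a b : R) (I : Type) (r : seq I) (f : I -> R -> R) :
  (forall i, {within `[a, b], continuous (f i)}) ->
  {within `[a, b], continuous (fun t => \sum_(i <- r) f i t)}.
Proof.
move=> h; apply/subspace_continuousP => t tab.
by apply: cvg_sumf => i; have /subspace_continuousP := h i; apply.
Qed.

Lemma within_continuous_eq (a b : R) (f g : R -> R) : (forall t, a <= t <= b -> f t = g t) ->
  {within `[a, b], continuous f} -> {within `[a, b], continuous g}.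
Proof.
move=> fg /within_continuousP h; apply/within_continuousP => t tab e e0.
have [d d0 hd] := h t tab e e0; exists d => // s sab sd.
by rewrite -!fg//; exact: hd.
Qed.

Lemma primitive_eq F G H K : (forall t, 0 <= t <= T -> F t = H t) ->
  (forall t, 0 <= t <= T -> G t = K t) -> primitive F G -> primitive H K.
Proof.
move=> FH GK [cF cG dF]; split.
- exact: within_continuous_eq cF.
- exact: within_continuous_eq cG.
move=> t /andP[t0 tT]; rewrite -GK ?(ltW t0) ?(ltW tT)//.
apply: near_eq_is_derive (dF t _); last by rewrite t0.
have : t \in `]0, T[ by rewrite in_itv/= t0.
move/near_in_itvoo; apply: filterS => s.
by rewrite in_itv/= => /andP[s0 sT]; apply: FH; rewrite !ltW.
Qed.

Lemma primitive_cst c : primitive (fun=> c) (fun=> 0).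
Proof.
split; [exact: within_continuous_cst|exact: within_continuous_cst|].
by move=> t _; exact: is_derive_cst.
Qed.

Lemma primitiveD F G H K : primitive F G -> primitive H K ->
  primitive (fun t => F t + H t) (fun t => G t + K t).
Proof.
move=> [cF cG dF] [cH cK dH]; split.
- exact: within_continuousD.
- exact: within_continuousD.
by move=> t tT; have ? := dF t tT; have ? := dH t tT; exact: is_deriveD.
Qed.

Lemma primitiveM F G H K : primitive F G -> primitive H K ->
  primitive (fun t => F t * H t) (fun t => G t * H t + F t * K t).
Proof.
move=> [cF cG dF] [cH cK dH]; split.
- exact: within_continuousM.
- by apply: within_continuousD; apply: within_continuousM.
move=> t tT; have ? := dF t tT; have ? := dH t tT.
have -> : G t * H t + F t * K t = F t *: K t + H t *: G t.
  by rewrite /GRing.scale /= addrC [G t * _]mulrC.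
exact: is_deriveM.
Qed.

Lemma primitiveZ c F G : primitive F G -> primitive (fun t => c * F t) (fun t => c * G t).
Proof.
move=> h; apply: primitive_eq (primitiveM (primitive_cst c) h) => // t _.
by rewrite mul0r add0r.
Qed.

Lemma primitiveB F G H K : primitive F G -> primitive H K ->
  primitive (fun t => F t - H t) (fun t => G t - K t).
Proof.
move=> hF hH; apply: primitive_eq (primitiveD hF (primitiveZ (-1) hH)) => t _.
  by rewrite mulN1r.
by rewrite mulN1r.
Qed.

Lemma primitive_sum (I : Type) (r : seq I) (F G : I -> R -> R) :
  (forall i, primitive (F i) (G i)) ->
  primitive (fun t => \sum_(i <- r) F i t) (fun t => \sum_(i <- r) G i t).
Proof.
move=> h; elim: r => [|i r IH].
  by apply: primitive_eq (primitive_cst 0) => t _; rewrite big_nil.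
by apply: primitive_eq (primitiveD (h i) IH) => t _; rewrite big_cons.
Qed.

Lemma primitive_mvt_le F G (c M s t : R) : primitive F G -> 0 <= s -> s <= t -> t <= T ->
  (forall x, s <= x <= t -> `|G x - c| <= M) ->
  `|F t - F s - (t - s) * c| <= M * `|t - s|.
Proof.
move=> [cF cG dF] s0 st tT hM.
have [x| |x] := @MVT_segment R F G s t st.
- rewrite in_itv/= => /andP[sx xt]; apply: dF.
  by rewrite (le_lt_trans s0 sx) (lt_le_trans xt tT).
- apply: continuous_subspaceW cF => x /=; rewrite !in_itv/= => /andP[sx xt].
  by rewrite (le_trans s0 sx) (le_trans xt tT).
rewrite in_itv/= => xst ->; rewrite [(t - s) * c]mulrC -mulrBl normrM.
by rewrite ler_wpM2r// hM.
Qed.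

(** For [c = G s] this says that [F] has derivative [G s] at [s], also one-sided
   at the ends of the interval. *)
Lemma primitive_mvt F G (c M s t : R) : primitive F G -> 0 <= s <= T -> 0 <= t <= T ->
  (forall x, 0 <= x <= T -> `|x - s| <= `|t - s| -> `|G x - c| <= M) ->
  `|F t - F s - (t - s) * c| <= M * `|t - s|.
Proof.
move=> hF /andP[s0 sT] /andP[t0 tT] hM; have [st|/ltW ts] := leP s t.
  apply: (primitive_mvt_le hF) => // x /andP[sx xt]; apply: hM.
    by rewrite (le_trans s0 sx) (le_trans xt tT).
  by rewrite !ger0_norm ?subr_ge0// lerD2r.
have -> : F t - F s - (t - s) * c = - (F s - F t - (s - t) * c) by ring.
rewrite normrN [`|t - s|]distrC; apply: (primitive_mvt_le hF) => //.
move=> x /andP[tx xs]; apply: hM; first by rewrite (le_trans t0 tx) (le_trans xs sT).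
by rewrite ![`|_ - s|]distrC !ger0_norm ?subr_ge0// lerD2l lerN2.
Qed.

Lemma is_derive_eps (F : R -> R) (t l : R) :
  (forall e, 0 < e -> exists2 d, 0 < d &
     forall h, `|h| < d -> `|F (t + h) - F t - h * l| <= e * `|h|) ->
  is_derive t 1 F l.
Proof.
move=> H.
have cv : h^-1 *: (F (h *: 1 + t) - F t) @[h --> (0 : R)^'] --> l.
  apply/cvgrPdist_le => e e0; have [d d0 hd] := H e e0.
  exists d => // h /=; rewrite sub0r normrN => hd' h0.
  have := hd h hd'; rewrite -ler_pdivrMr ?normr_gt0//.
  rewrite -normf_div distrC; congr (_ <= _); congr `|_|.
  rewrite /GRing.scale /= mulr1 [t + h]addrC; field.
  by [].
split; first by apply/cvg_ex; exists l.
exact: cvg_lim cv.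
Qed.

Lemma is_derive_lin (a t : R) : is_derive t 1 (fun s : R => a * s) a.
Proof.
apply: is_derive_eps => e e0; exists 1 => // h _.
rewrite (_ : a * (t + h) - a * t - h * a = 0); last by ring.
by rewrite normr0 mulr_ge0// ltW.
Qed.

(** The mean value inequality for the [F i] passes to the limit and shows that
   the limit of the derivatives is the derivative of the limit. *)
Lemma primitive_lim (F G : nat -> R -> R) (f g : R -> R) :
  (forall i, primitive (F i) (G i)) ->
  (forall e, 0 < e -> exists i, forall t, 0 <= t <= T -> `|F i t - f t| <= e /\ `|G i t - g t| <= e) ->
  primitive f g.
Proof.
move=> FG lim.
have cf (h : nat -> R -> R) (u : R -> R) : (forall i, {within `[0, T], continuous (h i)}) ->
    (forall e, 0 < e -> exists i, forall t, 0 <= t <= T -> `|h i t - u t| <= e) ->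
    {within `[0, T], continuous u}.
  move=> ch hu; apply/within_continuousP => t tT e e0.
  have e4 : 0 < e / 4 by rewrite divr_gt0.
  have [i hi] := hu _ e4; have /within_continuousP/(_ t tT _ e4)[d d0 hd] := ch i.
  exists d => // s sT sd; have := hi s sT; have := hi t tT; have := hd s sT sd.
  rewrite ltr_norml !ler_norml ltr_norml => /andP[? ?] /andP[? ?] /andP[? ?].
  by apply/andP; split; lra.
have cg : {within `[0, T], continuous g}.
  apply: (cf G) => [i|e /lim[i hi]]; first by have [] := FG i.
  by exists i => t /hi[].
split => //.
  apply: (cf F) => [i|e /lim[i hi]]; first by have [] := FG i.
  by exists i => t /hi[].
move=> t /andP[t0 tT]; apply: is_derive_eps => e e0.
have e2 : 0 < e / 2 by rewrite divr_gt0.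
have tT' : 0 <= t <= T by rewrite !ltW.
have /within_continuousP/(_ t tT' _ e2)[d d0 hd] := cg.
have m0 : 0 < Num.min d (Num.min t (T - t)) by rewrite !lt_min d0 t0 subr_gt0.
exists (Num.min d (Num.min t (T - t))) => // h; rewrite !lt_min => /andP[hd1 /andP[ht hTt]].
have [h1 h2] : - t < h /\ h < T - t.
  by move: ht hTt; rewrite !ltr_norml => /andP[? ?] /andP[? ?].
have thT : 0 <= t + h <= T by apply/andP; split; lra.
apply/ler_addgt0Pl => e' e'0.
have m20 : 0 < Num.min (e / 2) (e' / 2) by rewrite lt_min e2 divr_gt0.
have [i hi] := lim _ m20.
have := @primitive_mvt (F i) (G i) (g t) e t (t + h) (FG i) tT' thT.
rewrite (_ : t + h - t = h); last by ring.
move=> H; have {}H := H _.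
have Fh := (hi _ thT).1; have Ft := (hi _ tT').1.
rewrite le_min in Fh; rewrite le_min in Ft.
have /andP[_ {}Fh] := Fh; have /andP[_ {}Ft] := Ft.
have {}H : `|F i (t + h) - F i t - h * g t| <= e * `|h|.
  apply: H => x xT xh; have xd := le_lt_trans xh hd1.
  have := (hi _ xT).2; rewrite le_min => /andP[Gx _].
  have := hd x xT xd; rewrite ltr_norml; move: Gx; rewrite !ler_norml.
  by move=> /andP[? ?] /andP[? ?]; apply/andP; split; lra.
move: H Fh Ft; rewrite !ler_norml => /andP[? ?] /andP[? ?] /andP[? ?].
by apply/andP; split; lra.
Qed.

End TimeSolutions.

(** The sum E of the squares of the components satisfies E' <= L E + c e^2, where
   c is the number of components, so that E exp(-L t) - c e^2 t does not increase.
   The estimate is asked for on the open interval ]0, b[ only, in order that [b]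
   can be the exit time of a region where it holds. *)
Lemma gronwall {R : realType} (J : finType) (M T : R) : 0 <= M -> 0 < T ->
  exists2 K, 0 <= K & forall (z z' : J -> R -> R) b e, 0 <= b <= T -> 0 <= e ->
  (forall j, primitive T (z j) (z' j)) ->
  (forall t, 0 < t < b -> forall j, `|z' j t| <= M * (\sum_l `|z l t|) + e) ->
  forall j, `|z j b| <= K * (\sum_l `|z l 0| + e).
Proof.
move=> M0 T0; pose c : R := \sum_(l : J) 1; have c0 : 0 <= c by apply: sumr_ge0.
have csum (x : R) : \sum_(l : J) x = c * x.
  by rewrite mulr_suml; apply: eq_bigr => l _; rewrite mul1r.
pose L := 2 * M * c + 1; have L0 : 0 <= L by rewrite addr_ge0// !mulr_ge0.
exists (Num.sqrt ((1 + c * T) * expR (L * T))); first exact: sqrtr_ge0.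
move=> z z' b e /andP[b0 bT] e0 zz hz j.
pose E t := \sum_l z l t ^+ 2; pose S t := \sum_l `|z l t|.
have S0 t : 0 <= S t by apply: sumr_ge0.
have E0 t : 0 <= E t by apply: sumr_ge0 => l _; exact: sqr_ge0.
have SE t : S t ^+ 2 <= c * E t.
  rewrite expr2 mulr_suml.
  apply: (@le_trans _ _ (\sum_i \sum_l (z i t ^+ 2 + z l t ^+ 2) / 2)).
    apply: ler_sum => i _; rewrite mulr_sumr; apply: ler_sum => l _.
    rewrite -[z i t ^+ 2]real_normK ?num_real// -[z l t ^+ 2]real_normK ?num_real//.
    by have := sqr_ge0 (`|z i t| - `|z l t|); rewrite !expr2; nra.
  apply: (@le_trans _ _ ((c * E t + c * E t) / 2)); last by lra.
  rewrite le_eqVlt; apply/orP; left; apply/eqP.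
  under eq_bigr do rewrite -mulr_suml big_split /= csum.
  by rewrite -mulr_suml big_split /= csum -mulr_sumr.
have E0S : E 0 <= S 0 ^+ 2.
  rewrite expr2 mulr_suml; apply: ler_sum => i _.
  rewrite -[z i 0 ^+ 2]real_normK ?num_real// expr2 ler_wpM2l//.
  by rewrite /S (bigD1 i)//= lerDl; apply: sumr_ge0.
have SzE t : `|z j t| ^+ 2 <= E t.
  rewrite real_normK ?num_real// /E (bigD1 j)//= lerDl.
  by apply: sumr_ge0 => l _; exact: sqr_ge0.
pose E' t := \sum_l (z' l t * z l t + z l t * z' l t).
have tE : primitive T E E'.
  by apply: primitive_sum => l; apply: primitiveM.
(* The linear term 2 e S is split between E and e^2. *)
have E'le t : 0 < t < b -> E' t <= L * E t + c * e ^+ 2.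
  move=> tb; apply: (@le_trans _ _ (2 * S t * (M * S t + e))).
    have -> : 2 * S t * (M * S t + e) = \sum_l `|z l t| * (2 * (M * S t + e)).
      by rewrite -mulr_suml -/(S t); ring.
    apply: ler_sum => l _; have h := hz t tb l; rewrite -/(S t) in h.
    have h2 : z' l t * z l t <= `|z l t| * (M * S t + e).
      by apply: le_trans (ler_norm _) _; rewrite normrM mulrC ler_wpM2l.
    by move: h2; move: (z' l t) (z l t) (S t) `|_| => x y s u; lra.
  have h2 : 2 * e * S t <= c * e ^+ 2 + E t.
    rewrite -csum mulr_sumr -big_split /=; apply: ler_sum => l _.
    rewrite -[z l t ^+ 2]real_normK ?num_real//.
    by have := sqr_ge0 (e - `|z l t|); rewrite !expr2; nra.
  have := ler_wpM2l M0 (SE t); rewrite /L.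
  have -> : 2 * S t * (M * S t + e) = 2 * (M * S t ^+ 2) + 2 * e * S t by ring.
  have -> : (2 * M * c + 1) * E t + c * e ^+ 2 = 2 * (M * (c * E t)) + (c * e ^+ 2 + E t) by ring.
  lra.
pose g t := E t * expR (- L * t) - (c * e ^+ 2) * t.
have dexp (t : R) : is_derive t 1 (fun s : R => expR (- L * s)) (expR (- L * t) * - L).
  have dl := is_derive_lin (- L) t.
  exact: (@is_derive1_comp _ (@expR R) (fun s : R => - L * s)).
have key : g b <= g 0.
  have [->//|bn0] := eqVneq b 0.
  have bp : 0 < b by rewrite lt0r bn0.
  have [cE _ dE] := tE.
  pose g' t := (E' t - L * E t) * expR (- L * t) - c * e ^+ 2.
  have dg (t : R) : t \in `]0, b[ -> is_derive t 1 g (g' t).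
    rewrite in_itv/= => /andP[t0 tb].
    have tT : 0 < t < T by rewrite t0 (lt_le_trans tb).
    have d1 := dE t tT; have d2 := dexp t.
    have d3 := is_derive_lin (c * e ^+ 2) t.
    apply: is_derive_eq (is_deriveB (is_deriveM d1 d2) d3) _.
    by rewrite /g' /GRing.scale /=; ring.
  have cg : {within `[0, b], continuous g}.
    apply: (@continuous_subspaceW _ _ _ `[0, T]%classic).
      by move=> t /=; rewrite !in_itv/= => /andP[-> /le_trans]; apply.
    have ce : {within `[0, T], continuous (fun s => expR (- L * s))}.
      apply: continuous_subspaceT => s; apply: differentiable_continuous.
      by apply/derivable1_diffP; have [] := dexp s.
    apply: within_continuousD; first exact: within_continuousM.
    apply: continuous_subspaceT => s; apply: cvgN.
    by apply: cvgM; [exact: cvg_cst|exact: cvg_id].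
  have [t] := MVT bp dg cg; rewrite in_itv/= => tb; rewrite subr0.
  have gt : g' t <= 0.
    rewrite /g' subr_le0; have := E'le t tb; rewrite -lerBlDl => h.
    have h2 : expR (- L * t) <= 1.
      rewrite -expR0 ler_expR mulNr oppr_le0 mulr_ge0//.
      by case/andP: tb => /ltW.
    have h3 := expR_gt0 (- L * t).
    have h4 : 0 <= c * e ^+ 2 by rewrite mulr_ge0// sqr_ge0.
    have h5 := ler_wpM2r (ltW h3) h; apply: le_trans h5 _.
    by rewrite ler_piMr.
  move=> h; rewrite -subr_le0 h; exact: mulr_le0_ge0 gt b0.
have key2 : E b <= (E 0 + c * e ^+ 2 * b) * expR (L * b).
  move: key; rewrite /g !mulr0 subr0 expR0 mulr1 lerBlDr => h.
  rewrite -ler_pdivrMr ?expR_gt0// -expRN -mulNr.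
  exact: h.
have cT : 0 <= c * T by rewrite mulr_ge0// ltW.
have hfin : `|z j b| ^+ 2 <= (1 + c * T) * expR (L * T) * (S 0 + e) ^+ 2.
  apply: le_trans (SzE b) _; apply: le_trans key2 _.
  rewrite [X in _ <= X]mulrAC; apply: ler_pM.
  - by rewrite addr_ge0// !mulr_ge0// sqr_ge0.
  - exact: expR_ge0.
  - have h1 : E 0 <= (S 0 + e) ^+ 2.
      by apply: le_trans E0S _; rewrite lerXn2r ?nnegrE ?addr_ge0// lerDl.
    have h2 : e ^+ 2 <= (S 0 + e) ^+ 2 by rewrite lerXn2r ?nnegrE ?addr_ge0// lerDr.
    have h3 : c * e ^+ 2 * b <= c * T * (S 0 + e) ^+ 2.
      rewrite mulrAC; apply: ler_pM => //; rewrite ?mulr_ge0 ?sqr_ge0//.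
      by rewrite ler_wpM2l.
    by rewrite mulrDl mul1r lerD.
  - by rewrite ler_expR ler_wpM2l.
rewrite -[X in X <= _]sqrtr_sqr -/(S 0).
rewrite -[S 0 + e](ger0_norm (addr_ge0 (S0 0) e0)) -sqrtr_sqr.
rewrite -sqrtrM; last by rewrite mulr_ge0 ?expR_ge0// addr_ge0.
by rewrite ler_wsqrtr// -[z j b ^+ 2]real_normK ?num_real.
Qed.

(** * Linearization in a parameter *)

Section Linearization.
Context {R : realType} {n : nat} (T : R) (J : finType).
Local Notation E := 'rV[R]_n.
Hypothesis T0 : 0 < T.
Variables (p : E) (Y Y' : J -> R -> E -> R) (a : J -> J -> R -> R).
Variables (b : 'I_n -> J -> R -> R) (c : 'I_n -> J -> R) (d C M : R).
Hypotheses (d0 : 0 < d) (C0 : 0 <= C) (M0 : 0 <= M).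
Hypothesis solY : forall u, `|u| < d -> forall j,
  primitive T (fun t => Y j t (p + u)) (fun t => Y' j t (p + u)).
Hypothesis linY : forall u, `|u| < d -> forall j t, 0 <= t <= T ->
  `|Y' j t (p + u) - Y' j t p - \sum_l a j l t * (Y l t (p + u) - Y l t p)
    - \sum_i u 0 i * b i j t| <= C * `|u| ^+ 2.
Hypothesis boundA : forall j l t, 0 <= t <= T -> `|a j l t| <= M.
Hypothesis initY : forall u, `|u| < d -> forall j,
  Y j 0 (p + u) - Y j 0 p = \sum_i u 0 i * c i j.

Let K := projT1 (cid2 (@gronwall R J M T M0 T0)).
Let K0 : 0 <= K. Proof. by rewrite /K; case: cid2. Qed.

Let gron (z z' : J -> R -> R) e : 0 <= e -> (forall j, primitive T (z j) (z' j)) ->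
  (forall j, z j 0 = 0) ->
  (forall t, 0 <= t <= T -> forall j, `|z' j t - \sum_l a j l t * z l t| <= e) ->
  forall j t, 0 <= t <= T -> `|z j t| <= K * e.
Proof.
move=> e0 zz z0 hz j t tT; rewrite /K; case: cid2 => K' K'0 /= /(_ z z' t e tT e0 zz).
under eq_bigr do rewrite z0 normr0.
rewrite sumr_const mul0rn add0r; apply => s /andP[s0 st] l.
have sT : 0 <= s <= T by rewrite ltW//= (le_trans (ltW st))//; case/andP: tT.
rewrite -[z' l s](subrK (\sum_k a l k s * z k s)) addrC.
apply: le_trans (ler_normD _ _) _; apply: lerD; last exact: hz.
rewrite mulr_sumr.
apply: le_trans (ler_norm_sum _ _ _) _; apply: ler_sum => k _.
by rewrite normrM ler_wpM2r// boundA.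
Qed.

Let e_ i : E := delta_mx 0 i.

Let e_norm i (h : R) : `|h *: e_ i| <= `|h|.
Proof.
apply: norm_coord => // j; rewrite !mxE eqxx /= normrM ler_piMr//.
by case: (j == i); rewrite ?normr1// normr0.
Qed.

Let e_sum i (h : R) (x : 'I_n -> R) : \sum_k (h *: e_ i) 0 k * x k = h * x i.
Proof.
rewrite (bigD1 i)//= !mxE !eqxx mulr1 big1 ?addr0// => k ki.
by rewrite !mxE (negbTE ki) andbF mulr0 mul0r.
Qed.

Let W i h j t := h^-1 * (Y j t (p + h *: e_ i) - Y j t p).
Let W' i h j t := h^-1 * (Y' j t (p + h *: e_ i) - Y' j t p).

Let solY0 j : primitive T (fun t => Y j t p) (fun t => Y' j t p).
Proof. by have := @solY 0; rewrite normr0 addr0; exact. Qed.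

Let solW i h j : `|h| < d -> primitive T (W i h j) (W' i h j).
Proof.
move=> hd; apply: primitiveZ; apply: primitiveB => //; apply: solY.
exact: le_lt_trans (e_norm i h) hd.
Qed.

Let estW i h j t : 0 < h < d -> 0 <= t <= T ->
  `|W' i h j t - \sum_l a j l t * W i h l t - b i j t| <= C * h.
Proof.
move=> /andP[h0 hd] tT; have hd' : `|h *: e_ i| < d.
  by apply: le_lt_trans (e_norm i h) _; rewrite gtr0_norm.
have := linY hd' j tT; rewrite e_sum => H.
have -> : W' i h j t - \sum_l a j l t * W i h l t - b i j t = h^-1 *
   (Y' j t (p + h *: e_ i) - Y' j t p -
   \sum_l a j l t * (Y l t (p + h *: e_ i) - Y l t p) - h * b i j t).
  rewrite mulrBr mulKf ?gt_eqF//; congr (_ - _); rewrite mulrBr; congr (_ - _).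
  by rewrite mulr_sumr; apply: eq_bigr => l _; rewrite mulrCA.
rewrite normrM gtr0_norm ?invr_gt0// ler_pdivrMl//; apply: le_trans H _.
rewrite [h * _]mulrCA -expr2 ler_wpM2l// lerXn2r ?nnegrE ?(ltW h0)//.
by apply: le_trans (e_norm i h) _; rewrite gtr0_norm.
Qed.

Let W0 i h j : 0 < h < d -> W i h j 0 = c i j.
Proof.
move=> /andP[h0 hd]; rewrite /W initY ?e_sum ?mulKf ?gt_eqF//.
by apply: le_lt_trans (e_norm i h) _; rewrite gtr0_norm.
Qed.

Let W_close i h h' j t : 0 < h < d -> 0 < h' < d -> 0 <= t <= T ->
  `|W i h j t - W i h' j t| <= K * (C * (h + h')).
Proof.
move=> hd hd'; have [h0 _] := andP hd; have [h0' _] := andP hd'.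
apply: (@gron (fun j t => W i h j t - W i h' j t) (fun j t => W' i h j t - W' i h' j t)).
- by rewrite mulr_ge0// addr_ge0// ltW.
- by move=> l; apply: primitiveB; apply: solW; rewrite gtr0_norm//; [case/andP: hd|case/andP: hd'].
- by move=> l; rewrite !W0// subrr.
move=> s sT l; rewrite mulrDr.
apply: le_trans (lerD (estW i l hd sT) (estW i l hd' sT)).
apply: le_trans (ler_normB _ _).
rewrite le_eqVlt; apply/orP; left; apply/eqP; congr `|_|.
under eq_bigr do rewrite mulrBr; rewrite sumrB; ring.
Qed.

Let h_ (m : nat) : R := d / m.+2%:R.

Let h_bound m : 0 < h_ m < d.
Proof.
by rewrite divr_gt0//= ltr_pdivrMr// ltr_pMr// ltr1n.
Qed.

Let h_small e : 0 < e -> exists m0 : nat, forall m, (m0 <= m)%N -> h_ m < e.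
Proof.
move=> e0; have de0 : 0 < e / d by rewrite divr_gt0.
have [m0 _ hm0] := near_infty_natSinv_lt (PosNum de0).
exists m0 => m mm; have := hm0 m.+1 (leq_trans mm (leqnSn m)).
by rewrite /= ltr_pdivlMr// mulrC.
Qed.

Let KC : 0 < K * C * 2 + 1. Proof. by rewrite ltr_wpDl// !mulr_ge0. Qed.

Let L i j t : R := lim (W i (h_ m) j t @[m --> \oo]).

Let cvgW i j t : 0 <= t <= T -> W i (h_ m) j t @[m --> \oo] --> L i j t.
Proof.
move=> tT; apply: real_cauchy_cvg => e e0.
have [m0 hm] := h_small (divr_gt0 e0 KC).
exists m0 => k l /hm hk /hm hl; apply: le_lt_trans (W_close _ _ (h_bound k) (h_bound l) tT) _.
rewrite ltr_pdivlMr// in hk; rewrite ltr_pdivlMr// in hl.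
have [k0 _] := andP (h_bound k); have [l0 _] := andP (h_bound l).
move: hk hl; rewrite mulrA; set x := K * C; move: (h_ k) (h_ l) k0 l0 => y z.
by nra.
Qed.

Let W_lim i m j t : 0 <= t <= T -> `|W i (h_ m) j t - L i j t| <= K * C * h_ m.
Proof.
move=> tT; have h : (fun k => `|W i (h_ m) j t - W i (h_ k) j t|) @ \oo -->
    `|W i (h_ m) j t - L i j t|.
  by apply: cvg_norm; apply: cvgB; [exact: cvg_cst|exact: cvgW].
apply/ler_addgt0Pl => e e0; rewrite -(cvg_lim _ h)//; apply: limr_le.
  by apply/cvg_ex; eexists; exact: h.
have [m0 hm] := h_small (divr_gt0 e0 KC).
exists m0 => // k /= /hm hk; apply: le_trans (W_close _ _ (h_bound m) (h_bound k) tT) _.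
rewrite ltr_pdivlMr// in hk; have [k0 _] := andP (h_bound k).
have x0 : 0 <= K * C by rewrite mulr_ge0.
move: hk x0; rewrite mulrA; set x := K * C; move: (h_ k) (h_ m) k0 => y z.
by nra.
Qed.

Let solL i j : primitive T (L i j) (fun t => \sum_l a j l t * L i l t + b i j t).
Proof.
apply: (@primitive_lim _ T (fun m => W i (h_ m) j) (fun m => W' i (h_ m) j)).
  by move=> m; apply: solW; have [h0 hd] := andP (h_bound m); rewrite gtr0_norm.
move=> e e0.
pose B := K * C + (C + \sum_(l : J) M * (K * C)) + 1.
have KC0 : 0 <= K * C by rewrite mulr_ge0.
have S0 : 0 <= \sum_(l : J) M * (K * C) by apply: sumr_ge0 => l _; rewrite mulr_ge0.
have B0 : 0 < B by rewrite ltr_wpDl// !addr_ge0.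
have [m hm] := h_small (divr_gt0 e0 B0); exists m => t tT.
have := hm m (leqnn m); rewrite ltr_pdivlMr// => hB.
have [h0 _] := andP (h_bound m).
have hC : 0 <= C * h_ m by rewrite mulr_ge0// ltW.
have hKC : 0 <= K * C * h_ m by rewrite mulr_ge0// ltW.
have hS : 0 <= (\sum_(l : J) M * (K * C)) * h_ m by rewrite mulr_ge0// ltW.
rewrite /B !mulrDr mulr1 in hB; split.
  apply: le_trans (W_lim i m j tT) _; rewrite mulrC; lra.
apply: (@le_trans _ _ (C * h_ m + (\sum_(l : J) M * (K * C)) * h_ m)); last first.
  by rewrite ![_ * h_ m]mulrC; lra.
have -> : W' i (h_ m) j t - (\sum_l a j l t * L i l t + b i j t) =
   (W' i (h_ m) j t - \sum_l a j l t * W i (h_ m) l t - b i j t) +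
   \sum_l a j l t * (W i (h_ m) l t - L i l t).
  under [X in _ = _ + X]eq_bigr do rewrite mulrBr; rewrite sumrB; ring.
apply: le_trans (ler_normD _ _) _; apply: lerD; first exact: estW (h_bound m) tT.
apply: le_trans (ler_norm_sum _ _ _) _; rewrite mulr_suml; apply: ler_sum => l _.
rewrite normrM -mulrA; apply: ler_pM => //; [exact: boundA|exact: W_lim].
Qed.

Let L0 i j : L i j 0 = c i j.
Proof.
have e : (fun m => W i (h_ m) j 0) = (fun=> c i j).
  by apply/funext => m; rewrite W0.
by rewrite /L e lim_cst.
Qed.

Let linL j u t : `|u| < d -> 0 <= t <= T ->
  `|Y j t (p + u) - Y j t p - \sum_i u 0 i * L i j t| <= K * (C * `|u| ^+ 2).
Proof.
move=> ud tT.
apply: (@gron (fun j t => Y j t (p + u) - Y j t p - \sum_i u 0 i * L i j t)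
   (fun j t => Y' j t (p + u) - Y' j t p -
      \sum_i u 0 i * (\sum_l a j l t * L i l t + b i j t))) => //.
- by rewrite mulr_ge0// sqr_ge0.
- move=> l; apply: primitiveB; first by apply: primitiveB => //; exact: solY.
  by apply: primitive_sum => i; exact: primitiveZ.
- by move=> l; rewrite initY//; under [X in _ - X]eq_bigr do rewrite L0; rewrite subrr.
move=> s sT l; apply: le_trans (linY ud l sT).
rewrite le_eqVlt; apply/orP; left; apply/eqP; congr `|_|.
have -> : \sum_i u 0 i * (\sum_l0 a l l0 s * L i l0 s + b i l s) =
  \sum_l0 a l l0 s * (\sum_i u 0 i * L i l0 s) + \sum_i u 0 i * b i l s.
  under eq_bigr do rewrite mulrDr; rewrite big_split /=; congr (_ + _).
  under eq_bigr do rewrite mulr_sumr.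
  rewrite exchange_big /=; apply: eq_bigr => k _; rewrite mulr_sumr.
  by apply: eq_bigr => i _; rewrite mulrCA.
under [X in _ - X]eq_bigr do rewrite mulrBr; rewrite sumrB; ring.
Qed.

(** The difference quotients of the solution solve the linearized equation up to
   an error of the order of their step, so they converge by Gronwall's inequality.
   Their limits L solve the linearized equation, and Gronwall's inequality for
   Y(p + u) - Y(p) - \sum_i u_i L_i shows that they are the partial derivatives. *)
Theorem linearization : exists L : 'I_n -> J -> R -> R,
  [/\ forall i j, primitive T (L i j) (fun t => \sum_l a j l t * L i l t + b i j t),
      forall i j, L i j 0 = c i j &
      forall j t, 0 <= t <= T -> differentiable (Y j t) p /\
        forall i, 'D_(delta_mx 0 i) (Y j t) p = L i j t].
Proof.
exists L; split => // j t tT.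
pose f (u : E) : R := \sum_i u 0 i * L i j t.
have lf : linear f.
  move=> x u v; rewrite /f /GRing.scale /= mulr_sumr -big_split /=.
  by apply: eq_bigr => i _; rewrite !mxE mulrDl mulrA.
pose fL := GRing.isLinear.Build _ _ _ _ f lf.
pose f' : {linear E -> R} := HB.pack f fL.
have hq u : `|u| < d -> `|Y j t (p + u) - Y j t p - f' u| <= K * C * `|u| ^+ 2.
  by move=> ud; rewrite -mulrA; exact: linL.
have [df dE] := differentiable_quad (@linear_rV_continuous _ _ _ f') d0 hq.
split => // i; rewrite deriveE// dE /= /f.
by have := e_sum i 1 (fun i => L i j t); rewrite scale1r mul1r.
Qed.
End Linearization.

(** * Linear differential equations with parameters *)

Section LinearODE.
Context {R : realType} {n : nat} (T : R) (N : set 'rV[R]_n).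
Local Notation E := 'rV[R]_n.
Hypotheses (T0 : 0 < T) (oN : open N).

Let X : set R := [set t | 0 <= t <= T].

(** Regularity in time is not included: it comes from the equations. *)
Definition locally_lipschitz (G : R -> E -> R) : Prop :=
  forall p0, N p0 -> exists d B, [/\ 0 < d, 0 <= B & forall t p q, 0 <= t <= T ->
     N p -> N q -> `|p - p0| < d -> `|q - p0| < d ->
     `|G t p| <= B /\ `|G t p - G t q| <= B * `|p - q|].

Lemma locally_lipschitz_adequate : adequate X N locally_lipschitz.
Proof.
split=> [G H GH lG|G H lG lH|G H lG lH|c] p0 Np0.
- have [d [B [d0 B0 h]]] := lG p0 Np0; exists d, B; split => // t p q tT Np Nq pd qd.
  by rewrite -!GH//; exact: h.
- have [d [B [d0 B0 h]]] := lG p0 Np0; have [d' [B' [d0' B0' h']]] := lH p0 Np0.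
  exists (Num.min d d'), (B + B'); split; [by rewrite lt_min d0|exact: addr_ge0|].
  move=> t p q tT Np Nq; rewrite !lt_min => /andP[p1 p2] /andP[q1 q2].
  have [h1 h2] := h t p q tT Np Nq p1 q1; have [h3 h4] := h' t p q tT Np Nq p2 q2.
  split; first by apply: le_trans (ler_normD _ _) _; exact: lerD.
  rewrite opprD addrACA [X in _ <= X]mulrDl; apply: le_trans (ler_normD _ _) _; exact: lerD.
- have [d [B [d0 B0 h]]] := lG p0 Np0; have [d' [B' [d0' B0' h']]] := lH p0 Np0.
  exists (Num.min d d'), (B * B' + B * B'); split; [by rewrite lt_min d0|by rewrite addr_ge0// mulr_ge0|].
  move=> t p q tT Np Nq; rewrite !lt_min => /andP[p1 p2] /andP[q1 q2].
  have [h1 h2] := h t p q tT Np Nq p1 q1; have [h3 h4] := h' t p q tT Np Nq p2 q2.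
  have [h5 _] := h' t q p tT Nq Np q2 p2.
  split.
    rewrite normrM; apply: le_trans (ler_pM _ _ h1 h3) _ => //.
    by rewrite lerDl mulr_ge0.
  have -> : G t p * H t p - G t q * H t q = G t p * (H t p - H t q) + (G t p - G t q) * H t q.
    by ring.
  apply: le_trans (ler_normD _ _) _; rewrite [X in _ <= X]mulrDl !normrM; apply: lerD.
    by rewrite -mulrA; apply: ler_pM.
  by rewrite mulrAC; apply: ler_pM.
- exists 1, `|c|; split => // t p q _ _ _ _ _; split => //.
  by rewrite subrr normr0 mulr_ge0.
Qed.

Let aq := locally_lipschitz_adequate.

Lemma locally_lipschitz_common (I : finType) (F : I -> R -> E -> R) (p0 : E) :
  (forall i, locally_lipschitz (F i)) -> N p0 ->
  exists d B, [/\ 0 < d, 0 <= B, forall p, `|p - p0| < d -> N p &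
  forall i t p q, 0 <= t <= T -> `|p - p0| < d -> `|q - p0| < d ->
     `|F i t p| <= B /\ `|F i t p - F i t q| <= B * `|p - q|].
Proof.
move=> lF Np0.
have [d1 d10 hd1] : exists2 d, 0 < d & forall p, `|p - p0| < d -> N p.
  have : nbhs p0 N by exact: open_nbhs_nbhs.
  move=> /nbhs_ballP[d /= d0 hd]; exists d => // p pd; apply: hd.
  by rewrite -ball_normE /= distrC.
suff [d [B [d0 B0 h]]] : exists d B, [/\ 0 < d, 0 <= B &
  forall i, i \in enum I -> forall t p q, 0 <= t <= T -> N p -> N q ->
     `|p - p0| < d -> `|q - p0| < d ->
     `|F i t p| <= B /\ `|F i t p - F i t q| <= B * `|p - q|].
  exists (Num.min d d1), B; split => //; first by rewrite lt_min d0.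
    by move=> p; rewrite lt_min => /andP[_]; exact: hd1.
  move=> i t p q tT; rewrite !lt_min => /andP[p1 p2] /andP[q1 q2].
  by apply: h => //; [rewrite mem_enum|exact: hd1|exact: hd1].
elim: (enum I) => [|i r [d [B [d0 B0 h]]]]; first by exists 1, 0.
have [d' [B' [d0' B0' h']]] := lF i p0 Np0.
exists (Num.min d d'), (B + B'); split; [by rewrite lt_min d0|exact: addr_ge0|].
move=> j; rewrite inE => /orP[/eqP ->|jr] t p q tT Np Nq; rewrite !lt_min => /andP[p1 p2] /andP[q1 q2].
  have [h1 h2] := h' t p q tT Np Nq p2 q2; split; first by apply: le_trans h1 _; rewrite lerDr.
  by apply: le_trans h2 _; rewrite ler_wpM2r// lerDr.
have [h1 h2] := h j jr t p q tT Np Nq p1 q1; split; first by apply: le_trans h1 _; rewrite lerDl.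
by apply: le_trans h2 _; rewrite ler_wpM2r// lerDl.
Qed.

Section System.
Variables (J : finType) (A : J -> J -> R -> E -> R) (B Y : J -> R -> E -> R).
Variable c : 'I_n -> J -> R.
Hypothesis solY : forall p, N p -> forall j,
  primitive T (fun t => Y j t p) (fun t => \sum_l A j l t p * Y l t p + B j t p).
Hypothesis initY : forall p q, N p -> N q -> forall j,
  Y j 0 q - Y j 0 p = \sum_i (q - p) 0 i * c i j.

Let csum : R := \sum_j \sum_i `|c i j|.

Let init_le p q j : N p -> N q -> `|Y j 0 q - Y j 0 p| <= (\sum_i `|c i j|) * `|q - p|.
Proof.
move=> Np Nq; rewrite initY// mulr_suml; apply: le_trans (ler_norm_sum _ _ _) _.
by apply: ler_sum => i _; rewrite normrM mulrC ler_wpM2l// coord_norm.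
Qed.

(** Gronwall's inequality for a solution, and then for the difference of two. *)
Lemma linear_ode_locally_lipschitz : (forall j l, locally_lipschitz (A j l)) -> (forall j, locally_lipschitz (B j)) ->
  forall j, locally_lipschitz (Y j).
Proof.
move=> lA lB j p0 Np0.
pose F (x : J * J + J) := match x with inl jl => A jl.1 jl.2 | inr j => B j end.
have [|d [M [d0 M0 dN hM]]] := @locally_lipschitz_common _ F p0 _ Np0; first by case=> [[j1 l1]|j1] /=.
have MA j1 l1 t p q := hM (inl (j1, l1)) t p q.
have MB j1 t p q := hM (inr j1) t p q.
have [K K0 gron] := @gronwall R J M T M0 T0.
pose Y0 := \sum_l (`|Y l 0 p0| + (\sum_i `|c i l|) * d).
have Y00 : 0 <= Y0.
  by apply: sumr_ge0 => l _; rewrite addr_ge0// mulr_ge0 ?(ltW d0)// sumr_ge0.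
pose B1 := K * (Y0 + M); have B10 : 0 <= B1 by rewrite mulr_ge0// addr_ge0.
have bY l t p : 0 <= t <= T -> `|p - p0| < d -> `|Y l t p| <= B1.
  move=> tT pd; have Np := dN p pd.
  apply: le_trans (gron (fun l t => Y l t p) _ t M tT M0 (solY Np) _ l) _.
    move=> s /andP[s0 st] k.
    have sT : 0 <= s <= T by rewrite ltW//= (le_trans (ltW st))//; case/andP: tT.
    apply: le_trans (ler_normD _ _) _; apply: lerD; last by have [] := MB k s p p sT pd pd.
    rewrite mulr_sumr; apply: le_trans (ler_norm_sum _ _ _) _; apply: ler_sum => m _.
    by rewrite normrM ler_wpM2r//; have [] := MA k m s p p sT pd pd.
  rewrite ler_wpM2l// lerD2r; apply: ler_sum => k _.
  rewrite -[Y k 0 p](subrKC (Y k 0 p0)); apply: le_trans (ler_normD _ _) _.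
  rewrite lerD2l; apply: le_trans (init_le _ Np0 Np) _.
  by rewrite ler_wpM2l ?(ltW pd)// sumr_ge0.
pose C := (\sum_(l : J) M * B1) + M.
have C0 : 0 <= C by rewrite addr_ge0//; apply: sumr_ge0 => l _; rewrite mulr_ge0.
have csum0 : 0 <= csum by apply: sumr_ge0 => l _; apply: sumr_ge0.
exists d, (B1 + K * (csum + C)); split => //; first by rewrite addr_ge0// mulr_ge0// addr_ge0.
move=> t q p tT Nq Np qd pd; split; first by apply: le_trans (bY j t q tT qd) _; rewrite lerDl mulr_ge0// addr_ge0.
have : `|Y j t q - Y j t p| <= K * (\sum_l `|Y l 0 q - Y l 0 p| + C * `|q - p|).
  apply: (gron (fun l t => Y l t q - Y l t p) _ t _ tT _ (fun l => primitiveB (solY Nq l) (solY Np l))).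
    by rewrite mulr_ge0.
  move=> s /andP[s0 st] k.
  have sT : 0 <= s <= T by rewrite ltW//= (le_trans (ltW st))//; case/andP: tT.
  have -> : \sum_l A k l s q * Y l s q + B k s q - (\sum_l A k l s p * Y l s p + B k s p) =
    \sum_l A k l s q * (Y l s q - Y l s p) + (\sum_l (A k l s q - A k l s p) * Y l s p +
      (B k s q - B k s p)).
    rewrite opprD addrACA -sumrB [RHS]addrA -big_split /=; congr (_ + _).
    by apply: eq_bigr => l _; ring.
  apply: le_trans (ler_normD _ _) _; apply: lerD.
    rewrite mulr_sumr; apply: le_trans (ler_norm_sum _ _ _) _; apply: ler_sum => m _.
    by rewrite normrM ler_wpM2r//; have [] := MA k m s q p sT qd pd.
  rewrite /C [X in _ <= X]mulrDl; apply: le_trans (ler_normD _ _) _; apply: lerD; last first.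
    by have [] := MB k s q p sT qd pd.
  rewrite mulr_suml; apply: le_trans (ler_norm_sum _ _ _) _; apply: ler_sum => m _.
  rewrite normrM mulrAC; apply: ler_pM => //; last exact: bY.
  by have [] := MA k m s q p sT qd pd.
move/le_trans; apply; rewrite [X in _ <= X]mulrDl; apply: (@le_trans _ _ (K * (csum + C) * `|q - p|)).
  rewrite -[K * _ * _]mulrA ler_wpM2l// [X in _ <= X]mulrDl lerD2r /csum mulr_suml; apply: ler_sum => l _.
  exact: init_le.
by rewrite lerDr mulr_ge0.
Qed.

(** The remainders in the linearization are products of two increments, or of
   the first-order Taylor remainder of a coefficient and a bounded factor; both are
   quadratic since the derivatives of the coefficients are Lipschitz. *)
Lemma linear_ode_diff : (forall j l, nice X N locally_lipschitz 1 (A j l)) ->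
  (forall j, nice X N locally_lipschitz 1 (B j)) -> (forall j, locally_lipschitz (Y j)) ->
  forall p, N p ->
  let b i j t := \sum_l 'D_(delta_mx 0 i) (A j l t) p * Y l t p + 'D_(delta_mx 0 i) (B j t) p in
  exists L : 'I_n -> J -> R -> R,
  [/\ forall i j, primitive T (L i j) (fun t => \sum_l A j l t p * L i l t + b i j t),
      forall i j, L i j 0 = c i j &
      forall j t, 0 <= t <= T -> differentiable (Y j t) p /\
        forall i, 'D_(delta_mx 0 i) (Y j t) p = L i j t].
Proof.
move=> nA nB lY p Np b.
pose F (x : (J * J + J) + (('I_n * (J * J)) + ('I_n * J)) + J) := match x with
  | inl (inl (inl jl)) => A jl.1 jl.2 | inl (inl (inr j)) => B j
  | inl (inr (inl ijl)) => fun t p => 'D_(delta_mx 0 ijl.1) (A ijl.2.1 ijl.2.2 t) p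
  | inl (inr (inr ij)) => fun t p => 'D_(delta_mx 0 ij.1) (B ij.2 t) p
  | inr j => Y j end.
have [|d [M [d0 M0 dN hM]]] := @locally_lipschitz_common _ F p _ Np.
  case=> [[[[j l]|j]|[[i [j l]]|[i j]]]|j] //=.
  - exact: nice_base (nA j l).
  - exact: nice_base (nB j).
  - by have [_ [_ /(_ i)[]]] := nA j l.
  - by have [_ [_ /(_ i)[]]] := nB j.
have ud u : `|u| < d -> `|p + u - p| < d by rewrite addrC addKr.
have ball u (s : R) : `|u| < d -> 0 <= s <= 1 -> `|p + s *: u - p| < d.
  move=> hu /andP[s0 s1]; apply: ud; rewrite normrZ ger0_norm//.
  by apply: le_lt_trans hu; rewrite ler_piMl.
have pp : `|p - p| < d by rewrite subrr normr0.
have taylor (G : R -> E -> R) (DG : 'I_n -> R -> E -> R) t u : 0 <= t <= T -> `|u| < d ->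
    (forall q, N q -> differentiable (G t) q) ->
    (forall i q, 'D_(delta_mx 0 i) (G t) q = DG i t q) ->
    (forall i p' q', `|p' - p| < d -> `|q' - p| < d ->
       `|DG i t p' - DG i t q'| <= M * `|p' - q'|) ->
    `|G t (p + u) - G t p - \sum_i u 0 i * DG i t p| <= M * n%:R * `|u| ^+ 2.
  move=> tT hu dG DGE hL; under eq_bigr do rewrite -DGE.
  apply: le_trans (mvt_taylor (M := M * `|u|) _ _) _ => [s s01|s s01 i|].
  - by apply/dG/dN; exact: ball.
  - rewrite !DGE; apply: le_trans (hL i _ _ (ball u s hu s01) pp) _.
    rewrite ler_wpM2l// addrC addKr normrZ; case/andP: s01 => s0 s1.
    by rewrite ger0_norm// ler_piMl.
  rewrite expr2 -!mulrA ler_wpM2l// [n%:R * _]mulrCA ler_wpM2l//; exact: sum_coord_norm.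
pose C := \sum_(l : J) (M * n%:R * M + M * M) + M * n%:R.
have C0 : 0 <= C.
  rewrite addr_ge0 ?mulr_ge0//; apply: sumr_ge0 => l _.
  by rewrite addr_ge0 ?mulr_ge0.
apply: (@linearization R n T J T0 p Y (fun j t q => \sum_l A j l t q * Y l t q + B j t q)
  (fun j l t => A j l t p) b c d C M) => //.
- by move=> u hu j; apply: solY; apply/dN/ud.
- move=> u hu j t tT.
  have -> : \sum_l A j l t (p + u) * Y l t (p + u) + B j t (p + u) -
      (\sum_l A j l t p * Y l t p + B j t p) -
      \sum_l A j l t p * (Y l t (p + u) - Y l t p) - \sum_i u 0 i * b i j t =
    \sum_l ((A j l t (p + u) - A j l t p - \sum_i u 0 i * 'D_(delta_mx 0 i) (A j l t) p) * Y l t p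
      + (A j l t (p + u) - A j l t p) * (Y l t (p + u) - Y l t p)) +
    (B j t (p + u) - B j t p - \sum_i u 0 i * 'D_(delta_mx 0 i) (B j t) p).
    have -> : \sum_i u 0 i * b i j t =
       \sum_l (\sum_i u 0 i * 'D_(delta_mx 0 i) (A j l t) p) * Y l t p +
       \sum_i u 0 i * 'D_(delta_mx 0 i) (B j t) p.
      under eq_bigr do rewrite mulrDr; rewrite big_split /=; congr (_ + _).
      under eq_bigr do rewrite mulr_sumr; rewrite exchange_big /=.
      by apply: eq_bigr => l _; rewrite mulr_suml; apply: eq_bigr => i _; rewrite mulrA.
    have -> : forall (a1 a2 a3 a4 b1 b2 b3 : R),
      a1 + b1 - (a2 + b2) - a3 - (a4 + b3) = (a1 - a2 - a3 - a4) + (b1 - b2 - b3).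
      by move=> *; ring.
    congr (_ + _); rewrite -!sumrB; apply: eq_bigr => l _; ring.
  rewrite /C [X in _ <= X]mulrDl; apply: le_trans (ler_normD _ _) _; apply: lerD.
    rewrite mulr_suml; apply: le_trans (ler_norm_sum _ _ _) _; apply: ler_sum => l _.
    apply: le_trans (ler_normD _ _) _; rewrite [X in _ <= X]mulrDl !normrM; apply: lerD.
      rewrite [M * n%:R * M * _]mulrAC; apply: ler_pM => //; last by have [] := hM (inr l) t p p tT pp pp.
      apply: (taylor (A j l) (fun i t q => 'D_(delta_mx 0 i) (A j l t) q)) => //.
        by move=> q Nq; have [_ [+ _]] := nA j l; apply.
      by move=> i p' q' p'd q'd; have [] := hM (inl (inr (inl (i, (j, l))))) t p' q' tT p'd q'd.
    have := (hM (inl (inl (inl (j, l)))) t (p + u) p tT (ud u hu) pp).2.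
    have := (hM (inr l) t (p + u) p tT (ud u hu) pp).2.
    rewrite /= [p + u - p]addrC addKr => h1 h2.
    by rewrite expr2 mulrACA; apply: ler_pM.
  apply: (taylor (B j) (fun i t q => 'D_(delta_mx 0 i) (B j t) q)) => //.
    by move=> q Nq; have [_ [+ _]] := nB j; apply.
  by move=> i p' q' p'd q'd; have [] := hM (inl (inr (inr (i, j)))) t p' q' tT p'd q'd.
- by move=> j l t tT; have [] := hM (inl (inl (inl (j, l)))) t p p tT pp pp.
- move=> u hu j; rewrite initY//; last by apply/dN/ud.
  by rewrite [p + u - p]addrC addKr.
Qed.
End System.

(** A partial derivative of the solution solves the equation with the same matrix
   and with an inhomogeneous term containing one derivative of the coefficients and
   no derivative of the solution. Induction on [k] applies to it. *)
Lemma linear_ode_nice k (J : finType) (A : J -> J -> R -> E -> R) (B Y : J -> R -> E -> R)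
    (c : 'I_n -> J -> R) :
  (forall j l, nice X N locally_lipschitz k (A j l)) -> (forall j, nice X N locally_lipschitz k (B j)) ->
  (forall p, N p -> forall j,
     primitive T (fun t => Y j t p) (fun t => \sum_l A j l t p * Y l t p + B j t p)) ->
  (forall p q, N p -> N q -> forall j, Y j 0 q - Y j 0 p = \sum_i (q - p) 0 i * c i j) ->
  forall j, nice X N locally_lipschitz k (Y j).
Proof.
elim: k B Y c => [|k IH] B Y c nA nB sY iY.
  have h := linear_ode_locally_lipschitz sY iY (fun j l => nice_base (nA j l)) (fun j => nice_base (nB j)).
  by move=> j; split.
have nA1 j l : nice X N locally_lipschitz k (A j l) by exact: nice_le (leqnSn k) (nA j l).
have nYk := IH B Y c nA1 (fun j => nice_le (leqnSn k) (nB j)) sY iY.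
have lY j : locally_lipschitz (Y j) by exact: nice_base (nYk j).
have nA2 j l : nice X N locally_lipschitz 1 (A j l) by exact: nice_le (nA j l).
have nB2 j : nice X N locally_lipschitz 1 (B j) by exact: nice_le (nB j).
have H p (Np : N p) := linear_ode_diff sY iY nA2 nB2 lY Np.
move=> j; split; first exact: lY.
split=> [t p tT Np|i].
  by have [L [_ _ /(_ j t tT)[]]] := H p Np.
pose B' j t p := \sum_l 'D_(delta_mx 0 i) (A j l t) p * Y l t p + 'D_(delta_mx 0 i) (B j t) p.
apply: (IH B' (fun j t p => 'D_(delta_mx 0 i) (Y j t) p) (fun _ _ => 0)) => //.
- move=> j1; apply: (niceD oN aq); last by have [_ [_]] := nB j1; apply.
  apply: (nice_sum oN aq) => l; apply: (niceM oN aq) => //.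
  by have [_ [_]] := nA j1 l; apply.
- move=> p Np j1; have [L [sL _ dL]] := H p Np.
  apply: primitive_eq (sL i j1) => t tT; first by rewrite (dL j1 t tT).2.
  by congr (_ + _); apply: eq_bigr => l _; rewrite (dL l t tT).2.
- move=> p q Np Nq j1; have T00 : 0 <= (0 : R) <= T by rewrite lexx ltW.
  have [L [_ L0 dL]] := H p Np; have [L' [_ L0' dL']] := H q Nq.
  rewrite (dL j1 0 T00).2 (dL' j1 0 T00).2 L0 L0' subrr.
  by rewrite big1// => l _; rewrite mulr0.
Qed.

End LinearODE.

(** * Smoothness of the flow *)

Section Flow.
Context {R : realType} {n : nat} (U : set 'rV[R]_n) (V : 'rV[R]_n -> 'rV[R]_n).
Context (N : set 'rV[R]_n) (t0 : R) (phi : R -> 'rV[R]_n -> 'rV[R]_n) (T : R).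
Local Notation E := 'rV[R]_n.
Hypotheses (oU : open U) (hV : bounded_smooth_field U V) (oN : open N).
Hypotheses (hphi : is_flow U V N t0 phi) (T0 : 0 < T) (Tt0 : T < t0).

Let X : set R := [set t | 0 <= t <= T].

Let dV s y : U y -> differentiable (pderivs s V) y. Proof. by case: hV => + _; apply. Qed.

(** As [U] is arbitrary, bounds on derivatives give Lipschitz estimates only along
   the segments contained in [U]. *)
Definition segment_lipschitz (f : R -> E -> R) : Prop := exists2 B, 0 <= B & forall t, 0 <= t <= T ->
  (forall y, U y -> `|f t y| <= B) /\
  forall y u, (forall s : R, 0 <= s <= 1 -> U (y + s *: u)) -> `|f t (y + u) - f t y| <= B * `|u|.

Let seg_ends y (u : E) : (forall s : R, 0 <= s <= 1 -> U (y + s *: u)) -> U y /\ U (y + u).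
Proof.
move=> h; split; first by have := h 0; rewrite scale0r addr0 lexx ler01; exact.
by have := h 1; rewrite scale1r lexx ler01; exact.
Qed.

Lemma segment_lipschitz_congr f g : (forall t y, X t -> U y -> f t y = g t y) -> segment_lipschitz f -> segment_lipschitz g.
Proof.
move=> fg [B B0 hB]; exists B => // t tT; have [h1 h2] := hB t tT.
split=> [y Uy|y u hu]; first by rewrite -fg ?h1.
by have [Uy Uyu] := seg_ends hu; rewrite -!fg ?h2.
Qed.

Lemma field_bound s : exists B, 0 <= B /\ forall y, U y -> `|pderivs s V y| <= B.
Proof.
have [_ /(_ s)[M hM]] := hV; exists `|M|; split => // y Uy.
exact: le_trans (hM y Uy) (ler_norm _).
Qed.

Lemma pderiv_coord s i j y : U y ->
  'D_(delta_mx 0 i) (fun y => pderivs s V y 0 j) y = pderivs (i :: s) V y 0 j.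
Proof. by move=> Uy; rewrite pd_coord//; exact: dV. Qed.

Lemma field_segment_lipschitz s j : segment_lipschitz (fun _ y => pderivs s V y 0 j).
Proof.
have [B [B0 hB]] := field_bound s.
have [b hb] := choice (fun i => field_bound (i :: s)).
pose M := \sum_i b i; have M0 : 0 <= M by apply: sumr_ge0 => i _; case: (hb i).
exists (B + M * n%:R); first by rewrite addr_ge0// mulr_ge0.
move=> t _; split=> [y Uy|y u hu].
  by apply: le_trans (coord_norm _ _) _; rewrite (le_trans (hB y Uy))// lerDl mulr_ge0.
apply: le_trans (@mvt_bound _ _ (fun y => pderivs s V y 0 j) y u M _ _) _ => [l l01|l l01 i|].
- by have [] := diff_coord j (dV s (hu l l01)).
- rewrite pderiv_coord; last exact: hu.
  apply: le_trans (coord_norm _ _) _; have [_ /(_ _ (hu l l01)) h] := hb i.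
  apply: le_trans h _; rewrite /M (bigD1 i)//= lerDl; apply: sumr_ge0 => i' _.
  by case: (hb i').
rewrite mulrDl -mulrA; apply: le_trans (ler_wpM2l M0 (sum_coord_norm u)) _.
by rewrite lerDr mulr_ge0.
Qed.

Lemma field_nice k s j : nice X U segment_lipschitz k (fun _ y => pderivs s V y 0 j).
Proof.
elim: k s => [|k IH] s; split => //; try exact: field_segment_lipschitz.
split=> [t y _ Uy|i]; first by have [] := diff_coord j (dV s Uy).
apply: (nice_congr oU segment_lipschitz_congr) (IH (i :: s)) => t y _ Uy.
by rewrite pderiv_coord.
Qed.

Lemma time_derivative_eps (f : R -> E) t l : time_derivative t0 f t l ->
  forall e, 0 < e -> exists2 d, 0 < d & forall s, 0 <= s < t0 -> `|s - t| < d ->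
    `|f s - f t - (s - t) *: l| <= e * `|s - t|.
Proof.
rewrite /time_derivative /time_filter => h e e0.
have /cvgrPdist_le/(_ e e0) [d /= d0 hd] := h.
exists d => // s st sd; have [->|nst] := eqVneq s t.
  by rewrite !subrr scale0r subrr !normr0 mulr0.
have st0 : s - t != 0 by rewrite subr_eq0.
have := hd (s - t); rewrite /= sub0r normrN subrKC => /(_ sd st0 st) {}hd.
rewrite -ler_pdivrMr ?normr_gt0// mulrC -normfV -normrZ.
by rewrite scalerBr scalerA mulVf// scale1r distrC.
Qed.

Let flowU p t : N p -> 0 <= t <= T -> U (phi t p).
Proof.
move=> Np /andP[t1 tT]; have [_ /(_ t)] := hphi Np.
by rewrite t1 (le_lt_trans tT)// => /(_ isT)[].
Qed.

Let flow_eps p t : N p -> 0 <= t <= T -> forall e, 0 < e -> exists2 d, 0 < d &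
  forall s, 0 <= s < t0 -> `|s - t| < d ->
    `|phi s p - phi t p - (s - t) *: V (phi t p)| <= e * `|s - t|.
Proof.
move=> Np /andP[t1 tT]; have [_ /(_ t)] := hphi Np.
by rewrite t1 (le_lt_trans tT)// => /(_ isT)[_]; exact: time_derivative_eps.
Qed.

Lemma flow0 p : N p -> phi 0 p = p. Proof. by case/hphi. Qed.

Lemma flow_continuous p : N p -> forall t, 0 <= t <= T -> forall e, 0 < e ->
  exists2 d, 0 < d & forall s, 0 <= s <= T -> `|s - t| < d -> `|phi s p - phi t p| < e.
Proof.
move=> Np t tT e e0; have [d d0 hd] := flow_eps Np tT ltr01.
pose c := 1 + `|V (phi t p)|; have c0 : 0 < c by rewrite ltr_wpDr.
exists (Num.min d (e / c)); first by rewrite lt_min d0 divr_gt0.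
move=> s /andP[s0 sT]; rewrite lt_min => /andP[sd se].
have := hd s; rewrite s0 (le_lt_trans sT)// => /(_ isT sd); rewrite mul1r => h.
rewrite ltr_pdivlMr// in se; apply: le_lt_trans se.
rewrite -[phi s p - phi t p](subrK ((s - t) *: V (phi t p))).
apply: le_trans (ler_normD _ _) _; rewrite /c mulrDr mulr1 normrZ; exact: lerD.
Qed.

Lemma flow_comp_continuous p (f : E -> R) : N p ->
  (forall y, U y -> differentiable f y) -> {within `[0, T], continuous (fun t => f (phi t p))}.
Proof.
move=> Np df; apply/within_continuousP => t tT e e0.
have /differentiable_continuous/cvgrPdist_lt/(_ e e0)/nbhs_ballP[r /= r0 hr] := df _ (flowU Np tT).
have [d d0 hd] := flow_continuous Np tT r0; exists d => // s sT sd.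
by rewrite distrC; apply: hr; rewrite -ball_normE /= distrC; exact: hd.
Qed.

Lemma flow_primitive p : N p -> forall j, primitive T (fun t => phi t p 0 j) (fun t => V (phi t p) 0 j).
Proof.
move=> Np j; split.
- apply: (@flow_comp_continuous p (fun y => y 0 j) Np) => y _; exact: differentiable_coord.
- apply: (@flow_comp_continuous p (fun y => V y 0 j) Np) => y Uy.
  by have [] := diff_coord j (dV [::] Uy).
move=> t /andP[t1 tT]; apply: is_derive_eps => e e0.
have tT' : 0 <= t <= T by rewrite !ltW.
have [d d0 hd] := flow_eps Np tT' e0.
exists (Num.min d (Num.min t (T - t))); first by rewrite !lt_min d0 t1 subr_gt0.
move=> h; rewrite !lt_min => /andP[hd1 /andP[ht hTt]].
have := hd (t + h); rewrite [t + h - t]addrC addKr => /(_ _ hd1) {}hd.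
have /hd : 0 <= t + h < t0.
  by move: ht hTt Tt0; rewrite !ltr_norml => /andP[? ?] /andP[? ?] ?; apply/andP; split; lra.
move=> {}hd; apply: le_trans hd; apply: le_trans (coord_norm _ j).
by rewrite !mxE.
Qed.

(** By compactness of the trajectory of [p0] up to time [T]. *)
Lemma flow_tube p0 : N p0 -> exists2 r, 0 < r & forall t y, 0 <= t <= T ->
  `|y - phi t p0| < r -> U y.
Proof.
move=> Np0.
have /compact_near_coveringP/near_covering_withinP := @segment_compact R 0 T.
move=> /(_ E (nbhs (0 : E)) (fun v t => U (phi t p0 + v)) (nbhs_filter _)) cov.
have /cov : forall t, `[0, T]%classic t ->
    \forall t' \near t & v \near (0 : E), `[0, T]%classic t' -> U (phi t' p0 + v).
  move=> t; rewrite /= in_itv/= => tT.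
  have : nbhs (phi t p0) U by apply: open_nbhs_nbhs; split => //; exact: flowU.
  move=> /nbhs_ballP[r /= r0 hr]; have r2 : 0 < r / 2 by rewrite divr_gt0.
  have [d d0 hd] := flow_continuous Np0 tT r2.
  exists ([set t' | `|t' - t| < d], [set v : E | `|v| < r / 2]).
    split; first by exists d => // t' /=; rewrite distrC.
    by apply/nbhs_ballP; exists (r / 2) => // v; rewrite -ball_normE /= sub0r normrN.
  move=> [t' v] /= [td vr]; rewrite in_itv/= => t'T; apply: hr; rewrite -ball_normE /=.
  rewrite distrC addrAC; apply: le_lt_trans (ler_normD _ _) _.
  by rewrite [r]splitr; apply: ltrD => //; exact: hd.
move=> /nbhs_ballP[r /= r0 hr]; exists r => // t y tT yr.
rewrite -(subrKC (phi t p0) y).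
by apply: (hr (y - phi t p0)); rewrite -?ball_normE /= ?sub0r ?normrN// in_itv.
Qed.

Lemma field_lipschitz : exists2 M, 0 <= M & forall j t y u, 0 <= t <= T ->
  (forall s : R, 0 <= s <= 1 -> U (y + s *: u)) -> `|V (y + u) 0 j - V y 0 j| <= M * `|u|.
Proof.
have [b hb] := choice (fun j => field_bound [:: j]).
have : forall j, exists B, 0 <= B /\ forall t, 0 <= t <= T -> forall y u,
    (forall s : R, 0 <= s <= 1 -> U (y + s *: u)) -> `|V (y + u) 0 j - V y 0 j| <= B * `|u|.
  by move=> j; have [B B0 h] := field_segment_lipschitz [::] j; exists B; split => // t /h[].
move=> /choice[B hB]; exists (\sum_j B j); first by apply: sumr_ge0 => j _; have [] := hB j.
move=> j t y u tT hu; have [_ /(_ t tT y u hu) h] := hB j; apply: le_trans h _.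
rewrite ler_wpM2r// (bigD1 j)//= lerDl; apply: sumr_ge0 => l _; by have [] := hB l.
Qed.

(** Within the tube of [flow_tube] the field is Lipschitz on the segments between
   trajectories, so Gronwall's inequality keeps a trajectory starting close to [p0]
   strictly inside the tube; at a first exit time this would be a contradiction. *)
Lemma flow_stable p0 : N p0 -> exists d C, [/\ 0 < d, 0 <= C,
  forall q, `|q - p0| < d -> N q &
  forall t p q, 0 <= t <= T -> `|p - p0| < d -> `|q - p0| < d ->
   (forall s : R, 0 <= s <= 1 -> U (phi t p + s *: (phi t q - phi t p))) /\
   `|phi t q - phi t p| <= C * `|q - p|].
Proof.
move=> Np0; have [r r0 tube] := flow_tube Np0.
have [M M0 hM] := field_lipschitz.
have [K K0 gron] := @gronwall R 'I_n M T M0 T0.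
pose C := K * n%:R; have C0 : 0 <= C by rewrite mulr_ge0.
have [d1 d10 dN] : exists2 d, 0 < d & forall q, `|q - p0| < d -> N q.
  have : nbhs p0 N by exact: open_nbhs_nbhs.
  move=> /nbhs_ballP[d /= d0 hd]; exists d => // q qd; apply: hd.
  by rewrite -ball_normE /= distrC.
have lip p q b : N p -> N q -> 0 <= b <= T -> (forall t, 0 < t < b -> forall s : R, 0 <= s <= 1 ->
    U (phi t p + s *: (phi t q - phi t p))) -> `|phi b q - phi b p| <= C * `|q - p|.
  move=> Np Nq bT hU.
  apply: norm_coord => [|j]; first by rewrite mulr_ge0.
  have := gron (fun l t => phi t q 0 l - phi t p 0 l) _ b 0 bT (lexx _)
    (fun l => primitiveB (flow_primitive Nq l) (flow_primitive Np l)).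
  move=> H; rewrite !mxE; apply: le_trans (H _ j) _.
    move=> t tb l; have tT : 0 <= t <= T.
      by case/andP: tb bT => t1 tb /andP[_ bT]; rewrite ltW//= ltW// (lt_le_trans tb).
    rewrite addr0; have := hM l t _ _ tT (hU t tb); rewrite subrKC => /le_trans; apply.
    rewrite ler_wpM2l//; apply: norm_coord => [|i]; first exact: sumr_ge0.
    rewrite !mxE (bigD1 i)//= lerDl; exact: sumr_ge0.
  rewrite addr0 /C -mulrA ler_wpM2l// !flow0//.
  by apply: le_trans (sum_coord_norm _); apply: ler_sum => l _; rewrite !mxE.
pose d := Num.min d1 (r / (C + 1)).
have C1 : 0 < C + 1 by rewrite ltr_wpDl.
have stay q t : `|q - p0| < d -> 0 <= t <= T -> `|phi t q - phi t p0| < r.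
  rewrite lt_min => /andP[/dN Nq qd] tT; rewrite ltNge; apply/negP => rt.
  pose A := [set t | 0 <= t <= T /\ r <= `|phi t q - phi t p0|].
  have hiA : has_inf A by split; [exists t|exists 0 => x [/andP[]]].
  (* the first exit time *)
  pose b := inf A.
  have bT : 0 <= b <= T.
    apply/andP; split; first by apply: lb_le_inf => [|x [/andP[]]//]; exists t.
    by apply: le_trans (_ : t <= T); [apply: ge_inf => //; case: hiA|case/andP: tT].
  have before s : 0 <= s <= T -> s < b -> `|phi s q - phi s p0| < r.
    move=> sT sb; rewrite ltNge; apply/negP => rs; move: sb; rewrite ltNge => /negP; apply.
    by apply: ge_inf; [case: hiA|].
  have br : `|phi b q - phi b p0| < r.
    apply: le_lt_trans (lip p0 q b Np0 Nq bT _) _.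
      move=> s /andP[s0 sb] l /andP[l0 l1].
      have sT : 0 <= s <= T by rewrite ltW//= (le_trans (ltW sb))//; case/andP: bT.
      apply: (tube s) => //; rewrite addrC addKr normrZ ger0_norm//.
      by apply: le_lt_trans (before s sT sb); rewrite ler_piMl.
    move: qd; rewrite ltr_pdivlMr// => qd; apply: le_lt_trans qd.
    by rewrite mulrDr mulr1 mulrC lerDl.
  pose e := (r - `|phi b q - phi b p0|) / 2.
  have e0 : 0 < e by rewrite divr_gt0// subr_gt0.
  have [a1 a10 ha1] := flow_continuous Nq bT e0.
  have [a2 a20 ha2] := flow_continuous Np0 bT e0.
  have m0 : 0 < Num.min a1 a2 by rewrite lt_min a10.
  have [s [sT rs]] := inf_adherent m0 hiA; rewrite -/b => sb.
  have bs : b <= s by apply: ge_inf; [case: hiA|].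
  have : `|s - b| < Num.min a1 a2 by rewrite ger0_norm ?subr_ge0// ltrBlDl.
  rewrite lt_min => /andP[s1 s2]; have h1 := ha1 s sT s1; have h2 := ha2 s sT s2.
  move: rs; rewrite leNgt => /negP; apply.
  have -> : phi s q - phi s p0 =
     (phi b q - phi b p0) + ((phi s q - phi b q) - (phi s p0 - phi b p0)).
    by rewrite !opprB addrA; apply/matrixP => x y; rewrite !mxE; ring.
  apply: le_lt_trans (ler_normD _ _) _.
  rewrite -ltrBrDl; apply: le_lt_trans (ler_normB _ _) _.
  by rewrite [X in _ < X]splitr; apply: ltrD.
exists d, C; split => //.
- by rewrite lt_min d10 divr_gt0.
- by move=> q; rewrite lt_min => /andP[/dN].
move=> t p q tT pd qd.
have Np : N p by move: pd; rewrite lt_min => /andP[/dN].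
have Nq : N q by move: qd; rewrite lt_min => /andP[/dN].
have seg t' : 0 <= t' <= T -> forall s : R, 0 <= s <= 1 -> U (phi t' p + s *: (phi t' q - phi t' p)).
  move=> t'T s /andP[s0 s1]; apply: (tube t') => //.
  have -> : phi t' p + s *: (phi t' q - phi t' p) - phi t' p0 =
      (1 - s) *: (phi t' p - phi t' p0) + s *: (phi t' q - phi t' p0).
    by apply/matrixP => x y; rewrite !mxE; ring.
  apply: le_lt_trans (ler_normD _ _) _; rewrite !normrZ !ger0_norm ?subr_ge0//.
  have h1 := stay p t' pd t'T; have h2 := stay q t' qd t'T.
  move: h1 h2; move: `|_ - _| => x; move: `|_ - _| => y hx hy.
  have : Num.max x y < r by rewrite gt_max hx.
  apply: le_lt_trans; apply: (@le_trans _ _ ((1 - s) * Num.max x y + s * Num.max x y)); last by lra.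
  by apply: lerD; rewrite ler_wpM2l ?subr_ge0// le_max lexx ?orbT.
split; first exact: seg.
apply: lip => // t' /andP[t0' tt'] s; apply: seg.
by rewrite ltW//= (le_trans (ltW tt'))//; case/andP: tT.
Qed.

Let aq := locally_lipschitz_adequate T N.

Lemma flow_comp_locally_lipschitz f : segment_lipschitz f -> locally_lipschitz T N (fun t p => f t (phi t p)).
Proof.
move=> [B B0 hB] p0 Np0; have [d [C [d0 C0 dN hC]]] := flow_stable Np0.
exists d, (B + B * C); split => //; first by rewrite addr_ge0// mulr_ge0.
move=> t p q tT Np Nq pd qd; have [h1 h2] := hB t tT; split.
  by apply: le_trans (h1 _ (flowU Np tT)) _; rewrite lerDl mulr_ge0.
have [hU hl] := hC t q p tT qd pd.
have := h2 _ _ hU; rewrite subrKC => /le_trans; apply.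
rewrite mulrDl -mulrA; apply: le_trans (ler_wpM2l B0 hl) _.
by rewrite lerDr mulr_ge0.
Qed.

Lemma flow_locally_lipschitz j : locally_lipschitz T N (fun t p => phi t p 0 j).
Proof.
have [B [B0 hB]] := field_bound [::].
move=> p0 Np0; have [d [C [d0 C0 dN hC]]] := flow_stable Np0.
exists d, (`|p0| + d + B * T + C); split => //; first by rewrite !addr_ge0// ?mulr_ge0// ltW.
move=> t p q tT Np Nq pd qd; have [_ hl] := hC t q p tT qd pd; split; last first.
  have := coord_norm (phi t p - phi t q) j; rewrite !mxE => /le_trans; apply.
  apply: le_trans hl _; rewrite ler_wpM2r// lerDr !addr_ge0// ?mulr_ge0// ltW//.
have := primitive_mvt (c := 0) (M := B) (flow_primitive Np j) (s := 0) (t := t).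
rewrite lexx (ltW T0) => /(_ isT tT) h.
have {}h : `|phi t p 0 j - phi 0 p 0 j| <= B * t.
  have := h _; rewrite mulr0 !subr0 (ger0_norm (proj1 (andP tT))); apply.
  move=> x xT _; rewrite subr0; apply: le_trans (coord_norm _ _) _.
  by apply: hB; exact: flowU.
rewrite flow0// in h.
have h2 : `|p 0 j| <= `|p0| + d.
  apply: le_trans (coord_norm _ _) _; rewrite -[p](subrKC p0).
  by apply: le_trans (ler_normD _ _) _; rewrite lerD2l ltW.
rewrite -[phi t p 0 j](subrKC (p 0 j)); apply: le_trans (ler_normD _ _) _.
rewrite -!addrA; rewrite addrA; apply: lerD => //; apply: le_trans h _.
by apply: (@le_trans _ _ (B * T)); [rewrite ler_wpM2l//; case/andP: tT|rewrite lerDl].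
Qed.

(** The first variation equation: the linearization of phi' = V(phi). *)
Lemma flow_variation p : N p -> exists Z : 'I_n -> 'I_n -> R -> R,
  [/\ forall i j, primitive T (Z i j)
        (fun t => \sum_l pderivs [:: l] V (phi t p) 0 j * Z i l t),
      forall i j, Z i j 0 = (i == j)%:R &
      forall j t, 0 <= t <= T -> differentiable (fun q => phi t q 0 j) p /\
        forall i, 'D_(delta_mx 0 i) (fun q => phi t q 0 j) p = Z i j t].
Proof.
move=> Np; have [d [C [d0 C0 dN hC]]] := flow_stable Np.
have [b hb] := choice (fun l => field_bound [:: l]).
pose M := \sum_l b l; have M0 : 0 <= M by apply: sumr_ge0 => i _; case: (hb i).
have : forall lj : 'I_n * 'I_n, exists B, 0 <= B /\ forall t, 0 <= t <= T -> forall y u,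
    (forall s : R, 0 <= s <= 1 -> U (y + s *: u)) ->
    `|pderivs [:: lj.1] V (y + u) 0 lj.2 - pderivs [:: lj.1] V y 0 lj.2| <= B * `|u|.
  by move=> [l j]; have [B B0 h] := field_segment_lipschitz [:: l] j; exists B; split => // t /h[].
move=> /choice[B hB]; pose B1 := \sum_lj B lj.
have B10 : 0 <= B1 by apply: sumr_ge0 => i _; case: (hB i).
pose c (i j : 'I_n) : R := (i == j)%:R.
have pp : `|p - p| < d by rewrite subrr normr0.
have ud u : `|u| < d -> `|p + u - p| < d by rewrite addrC addKr.
have [] := @linearization R n T 'I_n T0 p (fun j t q => phi t q 0 j)
  (fun j t q => V (phi t q) 0 j) (fun j l t => pderivs [:: l] V (phi t p) 0 j)
  (fun _ _ _ => 0) c d (B1 * n%:R * C ^+ 2) M d0 _ M0.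
- by rewrite mulr_ge0 ?sqr_ge0// mulr_ge0.
- by move=> u hu j; apply: flow_primitive; apply/dN/ud.
- move=> u hu j t tT; have [hU hl] := hC t p (p + u) tT pp (ud u hu).
  rewrite [p + u - p]addrC addKr in hl.
  rewrite [X in _ - _ - X]big1 ?subr0; last by move=> i _; rewrite mulr0.
  set v := phi t (p + u) - phi t p in hU hl.
  have -> : phi t (p + u) = phi t p + v by rewrite subrKC.
  under eq_bigr => l _.
    have -> : pderivs [:: l] V (phi t p) 0 j * ((phi t p + v) 0 l - phi t p 0 l) =
      v 0 l * 'D_(delta_mx 0 l) (fun y => V y 0 j) (phi t p).
      rewrite (@pderiv_coord [::]); last exact: flowU.
      by rewrite mxE addrC addKr mulrC.
    over.
  apply: le_trans (mvt_taylor (M := B1 * `|v|) _ _) _ => [s s01|s s01 i|].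
  - by have [] := diff_coord j (dV [::] (hU s s01)).
  - rewrite !(@pderiv_coord [::]); [|exact: flowU|exact: hU].
    have [Bij0 /(_ t tT (phi t p) (s *: v)) h] := hB (i, j).
    apply: le_trans (h _) _ => [x /andP[x0 x1]|].
      rewrite scalerA; apply: hU; case/andP: s01 => s0 s1.
      by rewrite mulr_ge0//= mulr_ile1.
    case/andP: s01 => s0 s1; rewrite normrZ (ger0_norm s0).
    apply: ler_pM => //; first by rewrite mulr_ge0.
      rewrite /B1 (bigD1 (i, j))//= lerDl; apply: sumr_ge0 => l _; by case: (hB l).
    by rewrite ler_piMl.
  rewrite -!mulrA ler_wpM2l//.
  apply: le_trans (ler_wpM2l (normr_ge0 _) (sum_coord_norm v)) _.
  rewrite mulrCA ler_wpM2l// (_ : C * (C * _) = (C * `|u|) * (C * `|u|)); last by ring.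
  by apply: ler_pM.
- move=> j l t tT; apply: le_trans (coord_norm _ _) _; have [_ h] := hb l.
  apply: le_trans (h _ (flowU Np tT)) _; rewrite /M (bigD1 l)//= lerDl.
  by apply: sumr_ge0 => i _; case: (hb i).
- move=> u hu j; rewrite !flow0//; last by apply/dN/ud.
  rewrite mxE [p 0 j + _]addrC addrK (bigD1 j)//= /c eqxx mulr1 big1 ?addr0// => i ij.
  by rewrite (negbTE ij) mulr0.
move=> Z [sZ Z0 dZ]; exists Z; split => // i j.
by apply: primitive_eq (sZ i j) => // t _; rewrite addr0.
Qed.

Lemma flow_jacobian_primitive p : N p -> forall i j,
  primitive T (fun t => 'D_(delta_mx 0 i) (fun q => phi t q 0 j) p)
    (fun t => \sum_l pderivs [:: l] V (phi t p) 0 j *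
       'D_(delta_mx 0 i) (fun q => phi t q 0 l) p).
Proof.
move=> Np i j; have [Z [sZ _ dZ]] := flow_variation Np.
apply: primitive_eq (sZ i j) => t tT; first by rewrite (dZ j t tT).2.
by apply: eq_bigr => l _; rewrite (dZ l t tT).2.
Qed.

Lemma flow_jacobian0 p : N p -> forall i j,
  'D_(delta_mx 0 i) (fun q => phi 0 q 0 j) p = (i == j)%:R.
Proof.
move=> Np i j; have [Z [_ Z0 dZ]] := flow_variation Np.
have T00 : 0 <= (0 : R) <= T by rewrite lexx ltW.
by rewrite (dZ j 0 T00).2 Z0.
Qed.

Lemma flow_differentiable p : N p -> forall t, 0 <= t <= T -> differentiable (phi t) p.
Proof.
move=> Np t tT; apply: differentiable_rV => j.
by have [Z [_ _ /(_ j t tT)[]]] := flow_variation Np.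
Qed.

(** If the flow is regular of order [k], then so are the coefficients DV(phi) of
   the variation equation, hence its solution, the derivative of the flow. *)
Lemma flow_nice k j : nice X N (locally_lipschitz T N) k (fun t p => phi t p 0 j).
Proof.
elim: k j => [|k IH] j; first by split => //; exact: flow_locally_lipschitz.
split; first exact: flow_locally_lipschitz.
split=> [t p tT Np|i]; first by have [Z [_ _ /(_ j t tT)[]]] := flow_variation Np.
apply: (@linear_ode_nice R n T N T0 oN k 'I_n
  (fun j l t p => pderivs [:: l] V (phi t p) 0 j) (fun _ _ _ => 0)
  (fun j t p => 'D_(delta_mx 0 i) (fun q => phi t q 0 j) p) (fun _ _ => 0)).
- move=> j1 l; apply: (@nice_comp _ _ _ _ X N U (locally_lipschitz T N) segment_lipschitz phi oN aq _ _ k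
    (fun _ y => pderivs [:: l] V y 0 j1)) => //.
  + by move=> t p tT Np; exact: flowU.
  + exact: flow_comp_locally_lipschitz.
  + exact: field_nice.
- by move=> _; exact: (nice_cst oN aq).
- move=> p Np j1; apply: primitive_eq (flow_jacobian_primitive Np i j1) => // t _.
  by rewrite addr0.
- move=> p q Np Nq j1; rewrite !flow_jacobian0// subrr big1// => l _.
  by rewrite mulr0.
Qed.

End Flow.

(** * Coordinates and mass of multivectors *)

Section LinearProp.
Context {R : realType} {V W : lmodType R} (L : V -> W) (linL : linear L).

Lemma lin0 : L 0 = 0.
Proof. by have := linL (-1) 0 0; rewrite scaler0 addr0 scaleN1r addNr. Qed.

Lemma linZ c x : L (c *: x) = c *: L x.
Proof. by have := linL c x 0; rewrite !addr0 lin0 addr0. Qed.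

Lemma linD x y : L (x + y) = L x + L y.
Proof. by have := linL 1 x y; rewrite !scale1r. Qed.

Lemma linB x y : L (x - y) = L x - L y.
Proof. by rewrite linD -[- y]scaleN1r linZ scaleN1r. Qed.

Lemma lin_sum I (r : seq I) (P : pred I) (F : I -> V) :
  L (\sum_(i <- r | P i) F i) = \sum_(i <- r | P i) L (F i).
Proof. exact: (big_morph L linD lin0). Qed.

End LinearProp.

Section Multivectors.
Context {R : realType} {n : nat}.
Local Notation E := 'rV[R]_n.

Lemma lextD k (W : lmodType R) (F : 'M[R]_(k, n) -> W) (a b : kvec R n k) :
  lext F (a + b) = lext F a + lext F b.
Proof.
by rewrite /lext -big_split /=; apply: eq_bigr => I _; rewrite ffunE scalerDl.
Qed.

Lemma lext_linear k (W : lmodType R) (F : 'M[R]_(k, n) -> W) : linear (lext F).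
Proof. by move=> c a b; rewrite lextD lextZ. Qed.

Lemma lext_delta k (W : lmodType R) (F : 'M[R]_(k, n) -> W) (a : kvec R n k) I :
  (forall J, a J = (J == I)%:R) -> lext F a = F (basis_rows I).
Proof.
move=> aE; rewrite /lext (bigD1 I) //= aE eqxx scale1r big1 ?addr0// => J JI.
by rewrite aE (negbTE JI) scale0r.
Qed.

Lemma mindex_mono k (I : mindex n k) (i j : 'I_k) :
  (i < j)%N -> (val I i < val I j)%N.
Proof. by move=> ij; have /forallP/(_ i)/forallP/(_ j)/implyP := valP I; apply. Qed.

Lemma mindex_inj k (I : mindex n k) : injective (val I).
Proof.
move=> i j ij; apply/val_inj; have [||//] := ltngtP i j.
- by move/(mindex_mono I); rewrite ij ltnn.
- by move/(mindex_mono I); rewrite ij ltnn.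
Qed.

Lemma sub_mindex k (I J : mindex n k) :
  {subset codom (val I) <= codom (val J)} -> I = J.
Proof.
have so (K : mindex n k) : sorted ltn (map val (codom (val K))).
  rewrite codomE -map_comp sorted_map.
  apply: (@sub_sorted _ (fun i j : 'I_k => (i < j)%N)).
    by move=> i j /(mindex_mono K).
  by rewrite -(@sorted_map _ _ val ltn) val_enum_ord iota_ltn_sorted.
move=> sub.
have s2 : (size (codom (val J)) <= size (codom (val I)))%N by rewrite !size_codom.
have uI (K : mindex n k) : uniq (codom (val K)) by apply/injectiveP/mindex_inj.
have [_ eqIJ] := uniq_min_size (uI I) sub s2.
have : map val (codom (val I)) = map val (codom (val J)).
  apply: (@irr_sorted_eq _ ltn) => //; [exact: ltn_trans|exact: ltnn|].
  by move=> x; apply/mapP/mapP => -[y yI ->]; exists y => //; rewrite ?eqIJ // -eqIJ.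
move/(inj_map val_inj); rewrite !codomE => /eq_in_map e.
by apply/val_inj/ffunP => i; apply: e; rewrite mem_enum.
Qed.

Lemma basis_rows_dot k (I J : mindex n k) :
  \det (basis_rows I *m (basis_rows J)^T) = (J == I)%:R :> R.
Proof.
have mE i j : (basis_rows I *m (basis_rows J)^T) i j = (val I i == val J j)%:R :> R.
  rewrite mxE (bigD1 (val I i)) //= !mxE eqxx mul1r big1 ?addr0 1?eq_sym// => l lI.
  by rewrite !mxE eq_sym (negbTE lI) mul0r.
have [->|JI] := eqVneq J I.
  rewrite (_ : _ *m _ = 1%:M) ?det1//; apply/matrixP => i j.
  rewrite [LHS]mxE (bigD1 (val I i)) //= !mxE eqxx mul1r big1 ?addr0.
    by rewrite eq_sym (inj_eq (@mindex_inj _ I)).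
  by move=> l lI; rewrite !mxE eq_sym (negbTE lI) mul0r.
have [i iJ] : exists i, val I i \notin codom (val J).
  apply/not_existsP => h; move/eqP: JI; apply; apply/esym/sub_mindex.
  move=> _ /codomP[i ->]; apply/negPn/negP => hi; exact: (h i).
rewrite (expand_det_row _ i) big1// => j _; rewrite mE.
by case: eqP => [e|]; [move: iJ; rewrite e codom_f|rewrite mul0r].
Qed.

Lemma wedge_basis_rows k (I J : mindex n k) :
  wedge (basis_rows I) J = (J == I)%:R :> R.
Proof.
rewrite ffunE -basis_rows_dot; congr (\det _); apply/matrixP => i j.
rewrite !mxE (bigD1 (val I i)) //= !mxE eqxx mul1r big1 ?addr0 1?eq_sym// => l lI.
by rewrite !mxE eq_sym (negbTE lI) mul0r.
Qed.

Lemma kvecZ k c (a : kvec R n k) J : (c *: a) J = c * a J.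
Proof. exact: ffunE. Qed.

Lemma kdotE k (a b : kvec R n k) : kdot a b = \sum_I a I * b I.
Proof.
rewrite /kdot /lext; apply: eq_bigr => I _; congr (_ * _).
rewrite (bigD1 I) //= basis_rows_dot eqxx /GRing.scale /= mulr1.
by rewrite big1 ?addr0// => J JI; rewrite basis_rows_dot (negbTE JI) mulr0.
Qed.

Lemma kvec_decomp k (a : kvec R n k) : a = \sum_I a I *: wedge (basis_rows I).
Proof.
apply/ffunP => J; rewrite sum_ffunE (bigD1 J) //= big1 ?addr0 => [|I IJ].
  by rewrite kvecZ wedge_basis_rows eqxx mulr1.
by rewrite kvecZ wedge_basis_rows eq_sym (negbTE IJ) mulr0.
Qed.

Lemma mass_set_ge0 k (a : kvec R n k) x : [set x | exists s : seq (kvec R n k),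
    [/\ forall b, b \in s -> simple b, a = \sum_(b <- s) b &
        x = \sum_(b <- s) Num.sqrt (kdot b b)]] x -> 0 <= x.
Proof. by move=> [s [_ _ ->]]; apply: sumr_ge0 => *; exact: sqrtr_ge0. Qed.

(** The standard basis decomposes [a] into simple k-vectors of mass [`|a I|]. *)
Lemma mass_le_coord k (a : kvec R n k) : mass a <= \sum_I `|a I|.
Proof.
apply: nonneg_inf_le; first exact: mass_set_ge0.
exists [seq a J *: wedge (basis_rows J) | J <- enum {: mindex n k}]; split.
- by move=> _ /mapP[J _ ->]; exists (a J), (basis_rows J).
- by rewrite big_map big_enum /=; exact: kvec_decomp.
- rewrite big_map big_enum /=; apply: eq_bigr => I _.
  rewrite kdotE (bigD1 I) //= !kvecZ wedge_basis_rows eqxx mulr1 -expr2.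
  rewrite big1 ?addr0 ?sqrtr_sqr// => J JI.
  by rewrite !kvecZ wedge_basis_rows (negbTE JI) !mulr0.
Qed.

(** A coordinate of a simple k-vector is at most its Euclidean norm, and coordinates
   are additive over the decompositions of [a]. *)
Lemma coord_le_mass k (a : kvec R n k) I : `|a I| <= mass a.
Proof.
apply: lb_le_inf.
  exists (\sum_(b <- [seq a J *: wedge (basis_rows J) | J <- enum {: mindex n k}])
    Num.sqrt (kdot b b)).
  exists [seq a J *: wedge (basis_rows J) | J <- enum {: mindex n k}]; split => //.
  - by move=> _ /mapP[J _ ->]; exists (a J), (basis_rows J).
  - by rewrite big_map big_enum /=; exact: kvec_decomp.
move=> x [s [_ -> ->]]; rewrite sum_ffunE.
apply: le_trans (ler_norm_sum _ _ _) _; apply: ler_sum => b _.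
rewrite -sqrtr_sqr kdotE ler_wsqrtr// (bigD1 I) //= -expr2 lerDl.
by apply: sumr_ge0 => J _; rewrite -expr2 sqr_ge0.
Qed.

Lemma mass_eq0 k (a : kvec R n k) : mass a = 0 -> a = 0.
Proof.
move=> a0; apply/ffunP => I; apply/eqP; rewrite [X in _ == X]ffunE -normr_le0 -a0.
exact: coord_le_mass.
Qed.

Lemma mass0 k : mass (0 : kvec R n k) = 0.
Proof.
apply/eqP; rewrite eq_le mass_ge0 andbT; apply: le_trans (mass_le_coord _) _.
by rewrite big1// => I _; rewrite ffunE normr0.
Qed.

Lemma linear_mass_le k k' (L : kvec R n k -> kvec R n k') : linear L ->
  exists2 C, 0 <= C & forall a, mass (L a) <= C * mass a.
Proof.
move=> linL.
exists (\sum_J \sum_I `|L (wedge (basis_rows I)) J|).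
  by apply: sumr_ge0 => J _; apply: sumr_ge0.
move=> a; apply: le_trans (mass_le_coord _) _; rewrite mulr_suml ler_sum// => J _.
have -> : L a = \sum_I a I *: L (wedge (basis_rows I)).
  by rewrite {1}(kvec_decomp a) lin_sum//; apply: eq_bigr => I _; rewrite linZ.
rewrite sum_ffunE mulr_suml; apply: le_trans (ler_norm_sum _ _ _) _.
apply: ler_sum => I _; rewrite kvecZ normrM mulrC ler_wpM2l//; exact: coord_le_mass.
Qed.

End Multivectors.

(** * Difference chains inside an open set *)

Section Zonotopes.
Context {R : realType} {n : nat}.
Local Notation E := 'rV[R]_n.

(** All points of the parallelotope p + \sum_i [0,1] u_i lie in [D]. Unlike the
   convex hull in the definition of [inside], this can be handled one direction at
   a time; see [zonotope_in_inside] and [inside_zonotope_in] for the equivalence. *)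
Fixpoint zonotope_in (D : set E) (s : seq E) : set E :=
  if s is u :: s' then [set p | forall t : R, 0 <= t <= 1 -> zonotope_in D s' (p + t *: u)]
  else D.

Lemma zonotope_in_open D s : open D -> open (zonotope_in D s).
Proof.
move=> oD; elim: s => //= u s IH; rewrite openE => p pz /=.
have /compact_near_coveringP/(_ E (nbhs p) (fun q t => zonotope_in D s (q + t *: u))) :=
  @segment_compact R 0 1.
move=> /(_ (nbhs_filter p)) cov; apply: filterS (cov _) => [q h t t01|t].
  by apply: h; rewrite /= in_itv.
rewrite /= in_itv/= => /pz zt.
have ct : continuous (fun z : R * E => z.2 + z.1 *: u).
  by move=> z; apply: cvgD; [exact: cvg_snd|apply: cvgZr_tmp; exact: cvg_fst].
by apply: (ct (t, p)); exact: open_nbhs_nbhs.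
Qed.

Lemma sub_zonotope_in (D D' : set E) s p : D `<=` D' -> zonotope_in D s p -> zonotope_in D' s p.
Proof. by move=> DD; elim: s p => [p /DD//|u s IH p h t /h/IH]. Qed.

Lemma convex_setP (C : set E) p q (t : R) : @convex_set R E C -> C p -> C q ->
  0 <= t <= 1 -> C (t *: p + (1 - t) *: q).
Proof.
move=> cC Cp Cq /andP[t0 t1].
by have /set_mem := cC p q (Itv01 t0 t1) (mem_set Cp) (mem_set Cq).
Qed.

Fixpoint zonotope (s : seq E) (p : E) : set E :=
  if s is u :: s' then [set q | exists2 t : R, 0 <= t <= 1 & zonotope s' (p + t *: u) q]
  else [set p].

Lemma zonotope_convex s p q p' q' (t : R) : 0 <= t <= 1 -> zonotope s p q -> zonotope s p' q' ->
  zonotope s (t *: p + (1 - t) *: p') (t *: q + (1 - t) *: q').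
Proof.
move=> t01; elim: s p p' => [p p' -> -> //|u s IH p p' /= [a a01 aq] [b b01 bq]].
exists (t * a + (1 - t) * b).
  by move: t01 a01 b01 => /andP[? ?] /andP[? ?] /andP[? ?]; apply/andP; split; nra.
have := IH _ _ aq bq; rewrite !scalerDr !scalerA addrACA -scalerDl.
by [].
Qed.

Lemma zonotope_sub D s p : zonotope_in D s p -> zonotope s p `<=` D.
Proof.
elim: s p => [p Dp _ -> //|u s IH p h q /= [t t01]].
by apply: IH; exact: h.
Qed.

Section Delta.
Context {k : nat}.
Implicit Types (A : E -> kvec R n k).

Lemma translateD u A B : translate u (A + B) = translate u A + translate u B.
Proof. by []. Qed.

Lemma translateZ u c A : translate u (c *: A) = c *: translate u A.
Proof. by []. Qed.

Lemma translateN u A : translate u (- A) = - translate u A.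
Proof. by []. Qed.

Lemma translate_kelt u p (a : kvec R n k) : translate u (kelt p a) = kelt (p + u) a.
Proof. by apply/funext => q; rewrite /translate /kelt subr_eq. Qed.

Lemma translate_translate u v A : translate u (translate v A) = translate (u + v) A.
Proof. by apply/funext => q; rewrite /translate opprD addrA. Qed.

Lemma translate_Delta u s p (a : kvec R n k) :
  translate u (Delta s p a) = Delta s (p + u) a.
Proof.
elim: s p => [p|v s IH p] /=; first exact: translate_kelt.
by rewrite translateD translateN translate_translate [u + v]addrC -translate_translate IH.
Qed.

Lemma Delta_cons u s p (a : kvec R n k) :
  Delta (u :: s) p a = Delta s (p + u) a - Delta s p a.
Proof. by rewrite /= translate_Delta. Qed.

Lemma keltD p (a b : kvec R n k) : kelt p (a + b) = kelt p a + kelt p b.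
Proof. by apply/funext => q; rewrite !fctE /kelt; case: ifP; rewrite ?addr0. Qed.

Lemma Delta0r s p : Delta s p (0 : kvec R n k) = 0.
Proof. by rewrite -[X in Delta _ _ X](scale0r 0) DeltaZ scale0r. Qed.

Lemma Delta0l s p (a : kvec R n k) : 0 \in s -> Delta s p a = 0.
Proof.
elim: s p => // u s IH p; rewrite inE Delta_cons => /orP[/eqP <-|s0].
  by rewrite addr0 subrr.
by rewrite !IH// subrr.
Qed.

Lemma csupp_kelt p (a : kvec R n k) : csupp (kelt p a) `<=` [set p].
Proof. by move=> q; rewrite /csupp /= /kelt; case: (q =P p) => // _; rewrite eqxx. Qed.

Lemma csuppB A B : csupp (A - B) `<=` csupp A `|` csupp B.
Proof.
move=> q; rewrite /csupp /= !fctE; have [->|] := eqVneq (A q) 0; last by left.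
by rewrite sub0r oppr_eq0; right.
Qed.

Lemma csupp_Delta_zonotope s p (a : kvec R n k) : csupp (Delta s p a) `<=` zonotope s p.
Proof.
elim: s p => [p|u s IH p]; first exact: csupp_kelt.
rewrite Delta_cons => q /csuppB[] /IH zq /=; [exists 1|exists 0] => //.
- by rewrite ler01 lexx.
- by rewrite scale1r.
- by rewrite ler01 lexx.
- by rewrite scale0r addr0.
Qed.

Lemma zonotope_in_inside (U : set E) s p (a : kvec R n k) : zonotope_in U s p -> inside U s p a.
Proof.
move=> /zonotope_sub zU q hq; apply: zU; apply: (hq (zonotope s p)); split; last exact: csupp_Delta_zonotope.
move=> x y l /set_mem zx /set_mem zy; apply/mem_set.
have l01 : 0 <= l%:num <= 1 by apply/andP; split.
by have := zonotope_convex l01 zx zy; rewrite -scalerDl subrKC scale1r.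
Qed.

Lemma finite_csupp_Delta s p (a : kvec R n k) : finite_set (csupp (Delta s p a)).
Proof.
elim: s p => [p|u s IH p]; first exact: sub_finite_set (@csupp_kelt _ _) _.
rewrite Delta_cons; apply: sub_finite_set (@csuppB _ _) _.
by rewrite finite_setU; split; exact: IH.
Qed.

(** Otherwise the support would contain the infinitely many points q + j v. *)
Lemma last_on_ray A q v : finite_set (csupp A) -> v != 0 -> A q != 0 ->
  exists j : nat, A (q + j%:R *: v) != 0 /\ A (q + j.+1%:R *: v) = 0.
Proof.
move=> fA v0 q0; apply: contrapT => h; apply: infinite_nat.
have nz j : A (q + j%:R *: v) != 0.
  elim: j => [|j IH]; first by rewrite scale0r addr0.
  by apply/eqP => e; apply: h; exists j.
have -> : [set: nat] = (fun j : nat => q + j%:R *: v) @^-1` csupp A.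
  by apply/seteqP; split => // j _; exact: nz.
apply: finite_preimage fA => i j _ _ /addrI/eqP.
rewrite -subr_eq0 -scalerBl scaler_eq0 (negbTE v0) orbF subr_eq0 eqr_nat.
by move/eqP.
Qed.

(** Cancellations in [translate u A - A] leave two points on the line through [q]
   in direction [u], one at or before [q] and one at or after [q + u]: go back and
   forth from [q] to the last point of the support of [A]. *)
Lemma csupp_difference_convex (C : set E) A u q (t : R) : @convex_set R E C ->
  finite_set (csupp A) -> u != 0 -> csupp (translate u A - A) `<=` C ->
  csupp A q -> 0 <= t <= 1 -> C (q + t *: u).
Proof.
move=> cC fA u0 sC Aq /andP[t0 t1].
have [i [Ai Ai1]] := last_on_ray fA u0 Aq.
have nu0 : - u != 0 by rewrite oppr_eq0.
have [j [Aj Aj1]] := last_on_ray fA nu0 Aq.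
have Ci : C (q + i.+1%:R *: u).
  apply: sC; rewrite /csupp /= !fctE /translate Ai1 subr0.
  by rewrite -natr1 scalerDl scale1r addrA addrK.
have Cj : C (q - j%:R *: u).
  apply: sC; rewrite /csupp /= !fctE /translate -addrA -opprD.
  have -> : j%:R *: u + u = j.+1%:R *: u by rewrite -natr1 scalerDl scale1r.
  by move: Aj1 Aj; rewrite !scalerN => -> ?; rewrite sub0r oppr_eq0.
(* the position of q + t u between the two points of the support *)
pose l : R := (t + j%:R) / (i.+1%:R + j%:R).
have d0 : 0 < i.+1%:R + j%:R :> R by rewrite ltr_wpDr.
have l01 : 0 <= l <= 1.
  rewrite /l divr_ge0 ?addr_ge0//= ?(ltW d0)// ler_pdivrMr// mul1r lerD2r.
  by apply: le_trans t1 _; rewrite ler1n.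
have := convex_setP cC Ci Cj l01; congr (C _).
rewrite !scalerDr addrACA -scalerDl subrKC scale1r; congr (_ + _).
rewrite scalerN !scalerA -scalerBl; congr (_ *: _).
rewrite mulrBl mul1r opprB addrA -mulrDr divfK ?gt_eqF//.
by rewrite addrK.
Qed.

Lemma convex_zonotope_in (C : set E) s p (a : kvec R n k) : @convex_set R E C ->
  a != 0 -> 0 \notin s -> csupp (Delta s p a) `<=` C -> zonotope_in C s p.
Proof.
move=> cC a0; elim: s p => [p _ sC|u s IH p].
  by apply: sC; rewrite /csupp /= /kelt eqxx.
rewrite inE negb_or eq_sym => /andP[u0 s0] sC t t01; apply: IH => //.
rewrite -translate_Delta => q; rewrite /csupp /= /translate => Aq.
rewrite -(subrK (t *: u) q).
exact: (csupp_difference_convex cC (finite_csupp_Delta s p a) u0 sC Aq t01).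
Qed.

Lemma smallest_convex (A : set E) : @convex_set R E (smallest (@convex_set R E) A).
Proof.
move=> x y l /set_mem Ax /set_mem Ay; apply/mem_set => C CA.
have [cC _] := CA.
by apply: set_mem; apply: cC; apply/mem_set; [exact: Ax|exact: Ay].
Qed.

(** False for null chains: if [a = 0] or some direction is 0, then the support is
   empty. By induction, the hull of the support of a difference chain contains
   the segments of direction [u] starting at the support of the inner difference. *)
Lemma inside_zonotope_in (U : set E) s p (a : kvec R n k) : a != 0 -> 0 \notin s ->
  inside U s p a -> zonotope_in U s p.
Proof.
move=> a0 s0 iU; apply: (sub_zonotope_in iU); apply: convex_zonotope_in a0 s0 _.
  exact: smallest_convex.
exact: sub_smallest.
Qed.

End Delta.
End Zonotopes.

(** * Costs and difference quotients of Dirac chains *)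

Section Costs.
Context {R : realType} {n k : nat}.
Local Notation E := 'rV[R]_n.
Implicit Types (U : set E) (A B : E -> kvec R n k).

Definition bcost_le U (r : nat) A (x : R) : Prop := exists2 y, bcost U r A y & y <= x.

Lemma bcost_le_le U r r' A x x' : (r <= r')%N -> x <= x' -> bcost_le U r A x -> bcost_le U r' A x'.
Proof.
move=> rr xx [y yA yx]; exists y; last exact: le_trans xx.
exact: bcost_mono yA.
Qed.

Lemma bcost_le0 U r x : 0 <= x -> bcost_le U r (0 : E -> kvec R n k) x.
Proof. by move=> x0; exists 0 => //; exists [::]; rewrite !big_nil; split. Qed.

Lemma bcost_leD U r A B x y : bcost_le U r A x -> bcost_le U r B y -> bcost_le U r (A + B) (x + y).
Proof.
move=> [x' [s [ss As xs]] xx] [y' [t [ts Bt yt]] yy].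
exists (x' + y'); last exact: lerD.
exists (s ++ t); split; last by rewrite big_cat /= -xs -yt.
- by move=> z; rewrite mem_cat => /orP[/ss|/ts].
- by rewrite big_cat /= -As -Bt.
Qed.

Lemma bcost_leZ U r c A x : bcost_le U r A x -> bcost_le U r (c *: A) (`|c| * x).
Proof.
move=> [y [s [ss As ys]] yx].
exists (\sum_(t <- s) snorm t.1.1 * mass (c *: t.2)); last first.
  apply: le_trans (ler_wpM2l (normr_ge0 c) yx); rewrite ys mulr_sumr.
  apply: ler_sum => t _; rewrite mulrCA.
  by rewrite ler_wpM2l ?snorm_ge0 ?mass_leZ.
exists [seq (t.1, c *: t.2) | t <- s]; split.
- by move=> _ /mapP[t /ss[tr ti] ->]; split => //; exact: insideZ.
- by rewrite big_map As scaler_sumr; apply: eq_bigr => t _; rewrite DeltaZ.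
- by rewrite big_map.
Qed.

Lemma bcost_leB U r A B x y : bcost_le U r A x -> bcost_le U r B y -> bcost_le U r (A - B) (x + y).
Proof.
move=> Ax By; apply: bcost_leD => //; rewrite -[y]mul1r -(normrN1 R) -scaleN1r.
exact: bcost_leZ.
Qed.

Lemma bcost_le_sym U r A B x : bcost_le U r (A - B) x -> bcost_le U r (B - A) x.
Proof. by move=> /(bcost_leZ (-1)); rewrite scaleN1r opprB normrN1 mul1r. Qed.

Lemma bcost_le_Delta U r s p (a : kvec R n k) : (size s <= r)%N -> inside U s p a ->
  bcost_le U r (Delta s p a) (snorm s * mass a).
Proof.
move=> sr iU; exists (snorm s * mass a) => //; exists [:: (s, p, a)].
by rewrite !big_seq1; split => // t; rewrite inE => /eqP ->.
Qed.

Lemma snorm_cons (u : E) s : snorm (u :: s) = enorm u * snorm s.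
Proof. by rewrite /snorm big_cons. Qed.

Lemma snorm_nil : snorm ([::] : seq E) = 1.
Proof. by rewrite /snorm big_nil. Qed.

(** An additive property of chains and upper bounds of their cost need only be
   checked on difference chains; the degenerate ones, for which [inside] says
   nothing about the base point, are null chains. *)
Lemma bcost_le_elim U r (Q : (E -> kvec R n k) -> R -> Prop) :
  Q 0 0 -> (forall A B x y, Q A x -> Q B y -> Q (A + B) (x + y)) ->
  (forall A x y, Q A x -> x <= y -> Q A y) ->
  (forall s p a, (size s <= r)%N -> zonotope_in U s p -> Q (Delta s p a) (snorm s * mass a)) ->
  forall A x, bcost_le U r A x -> Q A x.
Proof.
move=> Q0 QD Qle QE A x [y [s [ss -> ->]] yx]; refine (Qle _ _ _ _ yx).
elim: s ss {yx} => [_|[[s p] a] l IH ss]; first by rewrite !big_nil.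
rewrite !big_cons; apply: QD; last by apply: IH => t tl; apply: ss; rewrite inE tl orbT.
have [/= sr iU] := ss _ (mem_head _ _).
have c0 : 0 <= snorm s * mass a by rewrite mulr_ge0 ?snorm_ge0 ?mass_ge0.
have [->|a0] := eqVneq a 0; first by rewrite Delta0r; rewrite mass0 mulr0.
have [s0|s0] := boolP (0 \in s); first by rewrite Delta0l//; exact: Qle c0.
by apply: QE => //; exact: inside_zonotope_in iU.
Qed.

Lemma finite_csuppP U A : A \in @dirac_pred R n U k <->
  finite_set (csupp A) /\ csupp A `<=` U.
Proof. by split => [/asboolP//|h]; apply/asboolP. Qed.

Lemma Delta_dirac U s p (a : kvec R n k) : inside U s p a ->
  Delta s p a \in @dirac_pred R n U k.
Proof.
move=> iU; apply/finite_csuppP; split; first exact: finite_csupp_Delta.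
by move=> q qs; apply: iU; exact: sub_smallest qs.
Qed.

Lemma bcost_le_dirac U r A x : bcost_le U r A x -> A \in @dirac_pred R n U k.
Proof.
move: A x; apply: bcost_le_elim => //.
- exact: rpred0.
- by move=> A B x y; exact: rpredD.
- by move=> s p a _ /zonotope_in_inside-/(_ _ a); exact: Delta_dirac.
Qed.

Lemma bcost_le_bnorm U r A x : bcost_le U r A x -> bnorm U r A <= x.
Proof. by move=> [y Ay]; apply: le_trans; exact: bnorm_le. Qed.

Lemma bnorm_bcost_le U r (A : dchain U k) x : bnorm U r (dval A) < x -> bcost_le U r (dval A) x.
Proof.
move=> Ax.
have hl : has_inf (bcost U r (dval A)).
  by split; [exact: bcost_neq0|exists 0 => y; exact: bcost_ge0].
have d0 : 0 < x - bnorm U r (dval A) by rewrite subr_gt0.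
have [y yA yx] := inf_adherent d0 hl.
by exists y => //; apply: ltW; move: yx; rewrite subrKC.
Qed.

Lemma dchain_bcost_le U r (A : dchain U k) : exists x, bcost_le U r (dval A) x.
Proof. by exists (bnorm U r (dval A) + 1); apply: bnorm_bcost_le; rewrite ltrDl. Qed.

End Costs.

Section DifferenceQuotient.
Context {R : realType} {n : nat}.
Local Notation E := 'rV[R]_n.

Lemma enormZ t (u : E) : enorm (t *: u) = `|t| * enorm u.
Proof.
rewrite /enorm /edot linearZ /= -scalemxAl -scalemxAr !mxE mulrA -expr2.
by rewrite sqrtrM ?sqr_ge0// sqrtr_sqr.
Qed.

Lemma enorm_sqr (u : E) : edot u u = \sum_i u 0 i ^+ 2.
Proof. by rewrite /edot mxE; apply: eq_bigr => i _; rewrite mxE expr2. Qed.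

Lemma norm_le_enorm (u : E) i : `|u 0 i| <= enorm u.
Proof.
rewrite -sqrtr_sqr ler_wsqrtr// enorm_sqr (bigD1 i)//= lerDl.
by apply: sumr_ge0 => j _; rewrite sqr_ge0.
Qed.

Context {k : nat} (U : set E) (oU : open U).
Implicit Types (A B : E -> kvec R n k).

(** The operator P_v is the limit of this one as t tends to 0. *)
Definition dquot (v : E) (t : R) A : E -> kvec R n k :=
  t^-1 *: (translate (t *: v) A - A).

Lemma dquotD v t A B : dquot v t (A + B) = dquot v t A + dquot v t B.
Proof. by rewrite /dquot -scalerDr translateD opprD addrACA. Qed.

Lemma dquotZ v t c A : dquot v t (c *: A) = c *: dquot v t A.
Proof. by rewrite /dquot translateZ -scalerBr !scalerA mulrC. Qed.

Lemma dquot_linear v t : linear (dquot v t).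
Proof. by move=> c A B; rewrite dquotD dquotZ. Qed.

Lemma zonotope_in_ray s p v : zonotope_in U s p -> exists2 d : R, 0 < d &
  forall t, `|t| < d -> zonotope_in U s (p + t *: v).
Proof.
move=> zp; have ct : continuous (fun t : R => p + t *: v).
  by move=> t; apply: cvgD; [exact: cvg_cst|apply: cvgZr_tmp; exact: cvg_id].
have := ct 0; rewrite /continuous_at scale0r addr0 => /(_ (zonotope_in U s)) [].
  by apply: open_nbhs_nbhs; split => //; exact: zonotope_in_open.
move=> d /= d0 dz; exists d => // t td; apply: dz => /=.
by rewrite sub0r normrN.
Qed.

(** The step has to be small with respect to the chain, since its base points can
   be arbitrarily close to the boundary of [U]. *)
Lemma bcost_le_dquot r v A x : bcost_le U r A x ->
  \forall t \near (0 : R)^', bcost_le U r.+1 (dquot v t A) (enorm v * x).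
Proof.
move: A x; apply: bcost_le_elim.
- near=> t; rewrite (_ : dquot v t 0 = 0) ?mulr0; last exact: lin0 (dquot_linear v t).
  exact: bcost_le0.
- move=> A B x y HA HB; near=> t; rewrite dquotD mulrDr; apply: bcost_leD.
    by near: t.
  by near: t.
- move=> A x y HA xy; near=> t; apply: (bcost_le_le (leqnn _)); last by near: t; exact: HA.
  by rewrite ler_wpM2l ?enorm_ge0.
move=> s p a sr zp; have [d d0 dz] := zonotope_in_ray v zp.
near=> t.
have t0 : t != 0 by near: t; exact: nbhs_dnbhs_neq.
have td : `|t| < d by near: t; apply: dnbhs0_lt.
have : bcost_le U r.+1 (Delta (t *: v :: s) p a) (snorm (t *: v :: s) * mass a).
  apply: bcost_le_Delta => //; apply: zonotope_in_inside => /= l /andP[l0 l1].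
  rewrite scalerA; apply: dz; apply: le_lt_trans td.
  by rewrite normrM ger0_norm// ler_piMl.
move/(bcost_leZ t^-1); rewrite snorm_cons enormZ !mulrA normfV mulVf ?normr_eq0// mul1r.
by [].
Unshelve. all: by end_near.
Qed.

Section Slope.
Variables (p v : E) (a : kvec R n k).
Let X (t : R) := kelt (p + t *: v) a.
Let c := enorm v ^+ 2 * mass a.
Let c1 := enorm v * mass a.

Let c_ge0 : 0 <= c. Proof. by rewrite mulr_ge0 ?sqr_ge0 ?mass_ge0. Qed.

Let c1_ge0 : 0 <= c1. Proof. by rewrite mulr_ge0 ?enorm_ge0 ?mass_ge0. Qed.

Lemma bcost_le_diff1 (t u : R) : 0 <= u -> (forall l, 0 <= l <= u -> U (p + (t + l) *: v)) ->
  bcost_le U 2 (X (t + u) - X t) (c1 * u).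
Proof.
move=> u0 hU.
have : bcost_le U 2 (Delta [:: u *: v] (p + t *: v) a) (snorm [:: u *: v] * mass a).
  apply: bcost_le_Delta => //; apply: zonotope_in_inside => /= l /andP[l0 l1].
  rewrite scalerA -addrA -scalerDl; apply: hU.
  by rewrite mulr_ge0//= ler_piMl.
rewrite Delta_cons /= -addrA -scalerDl snorm_cons snorm_nil mulr1 enormZ ger0_norm//.
by rewrite /c1 [_ * u]mulrC mulrA.
Qed.

Lemma bcost_le_diff2 (t u : R) : 0 <= u ->
  (forall l, 0 <= l <= u *+ 2 -> U (p + (t + l) *: v)) ->
  bcost_le U 2 (X (t + u *+ 2) - X (t + u) *+ 2 + X t) (c * u ^+ 2).
Proof.
move=> u0 hU.
have : bcost_le U 2 (Delta [:: u *: v; u *: v] (p + t *: v) a)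
    (snorm [:: u *: v; u *: v] * mass a).
  apply: bcost_le_Delta => //; apply: zonotope_in_inside => /= l /andP[l0 l1] m /andP[m0 m1].
  rewrite !scalerA -!addrA -!scalerDl; apply: hU.
  by rewrite /GRing.scale /= mulr_ge0 ?addr_ge0//= mulr2n mulrDl lerD// ler_piMl.
rewrite !Delta_cons /= -!addrA -!scalerDl !snorm_cons snorm_nil mulr1 enormZ ger0_norm//.
rewrite !opprB; congr (bcost_le U 2 _ _); last by rewrite /c; ring.
by rewrite /X !mulr2n opprD -[in RHS]addrA; congr (_ + (_ + _)); exact: addrC.
Qed.

(** Deviation of X from its chord on [0,u]. The deviation at t is half the one at
   2t or at 2t - u, whichever lies in [0,u], up to half a second difference, of cost
   c times the square of its step. After j such steps the trivial bound used at the
   start is divided by 2^j, and the other errors add up to at most c t (u - t) / 2. *)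
Lemma bcost_le_midpoint (u : R) (j : nat) : 0 < u -> (forall l, 0 <= l <= u -> U (p + l *: v)) ->
  forall t, 0 <= t <= u ->
  bcost_le U 2 ((X t - X 0) - (t / u) *: (X u - X 0))
    (c * (t * (u - t) / 2) + 2 * c1 * u / 2 ^+ j).
Proof.
move=> u0 hU; elim: j => [|j IH] t /andP[t0 tu].
  have h0 l : 0 <= l <= u -> bcost_le U 2 (X l - X 0) (c1 * l).
    move=> /andP[l0 lu]; have := @bcost_le_diff1 0 l l0; rewrite add0r; apply=> m /andP[m0 ml].
    by rewrite add0r; apply: hU; rewrite m0 (le_trans ml).
  have h1 : bcost_le U 2 (X t - X 0) (c1 * t) by apply: h0; rewrite t0.
  have h2 : bcost_le U 2 (X u - X 0) (c1 * u) by apply: h0; rewrite lexx ltW.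
  have := bcost_leB h1 (bcost_leZ (t / u) h2); apply: bcost_le_le => //.
  rewrite ger0_norm ?divr_ge0 ?(ltW u0)// expr0 divr1 mulrCA divfK ?gt_eqF//.
  have : 0 <= c * (t * (u - t) / 2) by rewrite mulr_ge0// divr_ge0// mulr_ge0// subr_ge0.
  have : c1 * t <= c1 * u by rewrite ler_wpM2l.
  lra.
have [tu2|tu2] := leP (t * 2) u.
  have h1 := IH (t *+ 2).
  rewrite mulrn_wge0//= -[t *+ 2]mulr_natr in h1.
  have h2 : bcost_le U 2 (X (t * 2) - X t *+ 2 + X 0) (c * t ^+ 2).
    have := @bcost_le_diff2 0 t t0; rewrite !add0r -[t *+ 2]mulr_natr; apply.
    by move=> l /andP[l0 lt]; rewrite add0r; apply: hU; rewrite l0 (le_trans lt).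
  have := bcost_leB (bcost_leZ 2^-1 (h1 tu2)) (bcost_leZ 2^-1 h2).
  rewrite ger0_norm ?invr_ge0//; congr (bcost_le U 2 _ _).
    apply/funext => q; apply/ffunP => I; rewrite !(fctE, ffunE) /=.
    move: (X t q I) (X u q I) (X 0 q I) (X (t * 2) q I).
    by rewrite /GRing.scale /= => xt xu x0 x2; field; rewrite gt_eqF.
  by rewrite [2 ^+ j.+1]exprS invfM; move: (2 ^+ j)^-1 => y; field.
have s0 : 0 <= u - t by rewrite subr_ge0.
have h1 := IH (u - (u - t) * 2).
have h2 : bcost_le U 2 (X u - X t *+ 2 + X (u - (u - t) * 2)) (c * (u - t) ^+ 2).
  have := @bcost_le_diff2 (u - (u - t) * 2) (u - t) s0.
  rewrite -[(u - t) *+ 2]mulr_natr subrK (_ : _ + (u - t) = t); last by ring.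
  by apply=> l /andP[l0 lt]; apply: hU; apply/andP; split; lra.
have := bcost_leB (bcost_leZ 2^-1 (h1 _)) (bcost_leZ 2^-1 h2).
rewrite ger0_norm ?invr_ge0// => h.
have /h : 0 <= u - (u - t) * 2 <= u by apply/andP; split; lra.
congr (bcost_le U 2 _ _).
  apply/funext => q; apply/ffunP => I; rewrite !(fctE, ffunE) /=.
  move: (X t q I) (X u q I) (X 0 q I) (X (u - (u - t) * 2) q I).
  by rewrite /GRing.scale /= => xt xu x0 x2; field; rewrite gt_eqF.
by rewrite [2 ^+ j.+1]exprS invfM; move: (2 ^+ j)^-1 => y; field.
Qed.

(** From [bcost_le_midpoint], divided by t; the term in 2^-j, for j large, is absorbed
   by the summand 1. *)
Lemma bcost_le_dquot_segment (u t : R) : (forall l, 0 <= l <= u -> U (p + l *: v)) ->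
  0 < t -> t <= u ->
  bcost_le U 2 (dquot v t (kelt p a) - dquot v u (kelt p a)) ((c + 1) * u).
Proof.
move=> hU t0 tu; have u0 := lt_le_trans t0 tu.
pose e := 2 * c1 * u / (t * u).
have [j hj] : exists j, e <= 2 ^+ j.
  by exists (Num.bound e); apply: ltW; exact: upper_nthrootP.
have := bcost_leZ t^-1 (bcost_le_midpoint j u0 hU (t := t) _); rewrite (ltW t0) tu => /(_ isT).
rewrite gtr0_norm ?invr_gt0// => h.
apply: (bcost_le_le (leqnn 2)); last first.
  move: h; congr (bcost_le U 2 _ _).
  rewrite /dquot !translate_kelt.
  apply/funext => q; apply/ffunP => I; rewrite /X scale0r addr0 !(fctE, ffunE) /=.
  move: (kelt (p + t *: v) a q I) (kelt (p + u *: v) a q I) (kelt p a q I) => xt xu x0.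
  by rewrite /GRing.scale /=; field; rewrite !gt_eqF.
have p0 : 0 < 2 ^+ j :> R by rewrite exprn_gt0.
have -> : t^-1 * (c * (t * (u - t) / 2) + 2 * c1 * u / 2 ^+ j) =
  c * (u - t) / 2 + u * (e / 2 ^+ j).
  by rewrite /e; field; rewrite !gt_eqF.
have : e / 2 ^+ j <= 1 by rewrite ler_pdivrMr// mul1r.
have : 0 <= c * t by rewrite mulr_ge0// ltW.
have : 0 <= c * u by rewrite mulr_ge0// ltW.
nra.
Qed.

Lemma bcost_le_dquot_pos (d t u : R) : (forall l, `|l| < d -> U (p + l *: v)) ->
  0 < t < d -> 0 < u < d ->
  bcost_le U 2 (dquot v t (kelt p a) - dquot v u (kelt p a)) ((c + 1) * (t + u)).
Proof.
move=> hU /andP[t0 td] /andP[u0 ud]; have c10 : 0 <= c + 1 by rewrite addr_ge0.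
have [tu|/ltW ut] := leP t u.
  apply: (@bcost_le_le _ _ _ _ 2 2 _ ((c + 1) * u)) => //.
    by rewrite ler_wpM2l// lerDr ltW.
  apply: bcost_le_dquot_segment => // l /andP[l0 lu]; apply: hU.
  by rewrite ger0_norm// (le_lt_trans lu).
apply: bcost_le_sym.
apply: (@bcost_le_le _ _ _ _ 2 2 _ ((c + 1) * t)) => //.
  by rewrite ler_wpM2l// lerDl ltW.
apply: bcost_le_dquot_segment => // l /andP[l0 lu]; apply: hU.
by rewrite ger0_norm// (le_lt_trans lu).
Qed.

(** Forward and backward difference quotients differ by a second difference. *)
Lemma bcost_le_dquot_abs (d t : R) : (forall l, `|l| < d -> U (p + l *: v)) ->
  t != 0 -> `|t| < d ->
  bcost_le U 2 (dquot v t (kelt p a) - dquot v `|t| (kelt p a)) (c * `|t|).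
Proof.
move=> hU t0 td; have nt0 : 0 < `|t| by rewrite normr_gt0.
have [tp|tn] := ler0P t; last by rewrite subrr; apply/bcost_le0/mulr_ge0 => //; exact: ltW.
rewrite ler0_norm// in nt0 td.
have := @bcost_le_diff2 t (- t) (ltW nt0) => h.
have := bcost_leZ (- (- t)^-1) (h _).
rewrite normrN gtr0_norm ?invr_gt0// => {}h.
have : bcost_le U 2 (dquot v t (kelt p a) - dquot v (- t) (kelt p a)) ((- t)^-1 * (c * (- t) ^+ 2)).
  have /h : forall l, 0 <= l <= - t *+ 2 -> U (p + (t + l) *: v).
    move=> l; rewrite mulr2n => /andP[l0 lt2]; apply: hU; rewrite ltr_norml.
    by apply/andP; split; lra.
  congr (bcost_le U 2 _ _); rewrite (_ : t + - t *+ 2 = - t); last by ring.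
  rewrite subrr /dquot !translate_kelt.
  apply/funext => q; apply/ffunP => I; rewrite /X scale0r addr0 !(fctE, ffunE) /=.
  move: (kelt (p + t *: v) a q I) (kelt (p + (- t) *: v) a q I) (kelt p a q I).
  by rewrite /GRing.scale /= => xt xu x0; field.
by congr (bcost_le U 2 _ _); field.
Qed.

End Slope.

Lemma dquot_kelt_cauchy p v (a : kvec R n k) : U p -> exists C d : R, [/\ 0 <= C, 0 < d &
  forall t u, 0 < `|t| < d -> 0 < `|u| < d ->
  bcost_le U 2 (dquot v t (kelt p a) - dquot v u (kelt p a)) (C * (`|t| + `|u|))].
Proof.
move=> Up; have [d d0 hU] := @zonotope_in_ray [::] p v Up.
pose c := enorm v ^+ 2 * mass a.
have c0 : 0 <= c by rewrite mulr_ge0 ?sqr_ge0 ?mass_ge0.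
exists (c + (c + 1)), d; split => // [|t u /andP[t0 td] /andP[u0 ud]].
  by rewrite !addr_ge0.
have tn0 : t != 0 by rewrite -normr_gt0.
have un0 : u != 0 by rewrite -normr_gt0.
have ht := bcost_le_dquot_abs a hU tn0 td.
have hu := bcost_le_dquot_abs a hU un0 ud.
have htu := @bcost_le_dquot_pos p v a d `|t| `|u| hU; rewrite t0 td u0 ud in htu.
have := bcost_leB (bcost_leD ht (htu isT isT)) hu.
congr (bcost_le U 2 _ _); last by rewrite -/c; ring.
by rewrite addrA subrK opprB addrA subrK.
Qed.

Lemma dquot_cauchy v A x : bcost_le U 0 A x -> exists C d : R, [/\ 0 <= C, 0 < d &
  forall t u, 0 < `|t| < d -> 0 < `|u| < d ->
  bcost_le U 2 (dquot v t A - dquot v u A) (C * (`|t| + `|u|))].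
Proof.
move: A x; apply: bcost_le_elim.
- exists 0, 1; split; [exact: lexx|exact: ltr01|move=> t u _ _].
  by rewrite 2!(lin0 (dquot_linear v _)) subrr mul0r; exact: bcost_le0.
- move=> A B _ _ [C [d [C0 d0 H]]] [C' [d' [C0' d0' H']]].
  exists (C + C'), (Num.min d d'); split; rewrite ?addr_ge0 ?lt_min ?d0// => t u.
  rewrite !lt_min => /andP[t0 /andP[td td']] /andP[u0 /andP[ud ud']].
  have := bcost_leD (H t u _ _) (H' t u _ _); rewrite t0 td td' u0 ud ud' => /(_ isT isT isT isT).
  rewrite !dquotD opprD addrACA; congr (bcost_le U 2 _ _); last by rewrite mulrDl.
- by [].
move=> [|//] p a _ Up; exact: dquot_kelt_cauchy.
Qed.

End DifferenceQuotient.

(** * Continuous extension of operators to chains *)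

Lemma cval_lin {R : realType} {n k : nat} {U : set 'rV[R]_n} c (A B : cseq U k) i :
  cval (c *: A + B) i = c *: cval A i + cval B i.
Proof. by []. Qed.

Section ChainTopology.
Context {R : realType} {n : nat} (U : set 'rV[R]_n).
Local Notation E := 'rV[R]_n.

Lemma chain_eqP k (A B : cseq U k) :
  (exists r, bnull r (fun i => cval A i - cval B i)) <->
  \pi_(chain U k)%qT A = \pi_(chain U k)%qT B.
Proof.
split => [h|/eqP]; first by apply/eqP; rewrite -Quotient.idealrBE; apply/asboolP.
by rewrite -Quotient.idealrBE => /asboolP.
Qed.

Lemma lin_continuous k k' (T : chain U k -> chain U k') : linear T ->
  (forall r, exists r' C, 0 < C /\ forall e, 0 < e -> forall J, step_ball r e J ->
     step_ball r' (C * e) (T J)) ->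
  continuous T.
Proof.
move=> linT hT J W [B [cB sB] BW]; exists [set K | B (T K)].
  split=> [a b x y ab Bx By /=|r].
    by rewrite (linD linT) !(linZ linT); exact: cB.
  have [r' [C [C0 h]]] := hT r; have [e e0 He] := sB r'.
  exists (C^-1 * e); first by rewrite mulr_gt0// invr_gt0.
  move=> K /h; rewrite mulVKf ?gt_eqF// => hK; apply/He/hK.
  by rewrite mulr_gt0// invr_gt0.
by move=> K BK /=; rewrite (linD linT); exact: BW.
Qed.

(** Boundedness on every step implies continuity for the inductive limit topology,
   because preimages of intervals are absolutely convex. *)
Lemma functional_continuous k (L : chain U k -> R) : scalar L ->
  (forall r, exists2 C, 0 < C & forall e, 0 < e -> forall J, step_ball r e J ->
     `|L J| <= C * e) ->
  continuous L.
Proof.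
move=> linL hL J W [e /= e0 eW].
exists [set K | `|L K| < e].
  split=> [a b x y ab Bx By /=|r].
    have -> : L (a *: x + b *: y) = a * L x + b * L y.
      by rewrite (linL a x) -[b *: y]addr0 (linL b y) (lin0 linL) addr0.
    apply: le_lt_trans (ler_normD _ _) _; rewrite !normrM.
    have h : `|a| * `|L x| + `|b| * `|L y| <= (`|a| + `|b|) * Num.max `|L x| `|L y|.
      by rewrite mulrDl lerD// ler_wpM2l// le_max lexx ?orbT.
    apply: le_lt_trans h _; apply: (@le_lt_trans _ _ (1 * Num.max `|L x| `|L y|)).
      by rewrite ler_wpM2r// le_max normr_ge0.
    by rewrite mul1r gt_max; apply/andP.
  have [C C0 hC] := hL r; have d0 : 0 < e / (C * 2) by rewrite divr_gt0// mulr_gt0.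
  exists (e / (C * 2)) => // K /(hC _ d0) /le_lt_trans; apply.
  have -> : C * (e / (C * 2)) = e / 2 by field; rewrite gt_eqF.
  lra.
move=> K /= LK; apply: eW => /=.
have -> : L (J + K) = L J + L K by have := linL 1 J K; rewrite scale1r mul1r.
by rewrite opprD addNKr normrN.
Qed.

Section Extension.
Variables (k k' : nat) (P : nat -> (E -> kvec R n k) -> (E -> kvec R n k')).
Hypothesis linP : forall j, linear (P j).
Hypothesis boundP : forall r, exists r' C, 0 <= C /\ forall A x, bcost_le U r A x ->
  \forall j \near \oo, bcost_le U r' (P j A) (C * x).
Variable q : nat.
Hypothesis cauchyP : forall (A : dchain U k) e, 0 < e -> exists m, forall i j,
  (m <= i)%N -> (m <= j)%N -> bcost_le U q (P i (dval A) - P j (dval A)) e.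

(** [P j] need not map a chain in [U] to a chain in [U]: the difference quotient
   does so only for steps that are small with respect to the chain. Hence the
   limit operator is defined through approximations of the limit of the [P j A]. *)
Lemma approx_exists (A : dchain U k) (i : nat) : exists B : dchain U k',
  \forall j \near \oo, bcost_le U q (P j (dval A) - dval B) i.+1%:R^-1.
Proof.
have i0 : 0 < i.+1%:R^-1 :> R by rewrite invr_gt0.
have [m hm] := cauchyP A i0.
have [r' [C [_ hC]]] := boundP 0; have [x /hC hx] := dchain_bcost_le 0 A.
have [j [mj /bcost_le_dirac Pj]] : exists j, (m <= j)%N /\ bcost_le U r' (P j (dval A)) (C * x).
  near \oo => j; exists j; split; near: j => //.
  exact: nbhs_infty_ge.
exists (DChain Pj); near=> l; apply: hm => //.
by near: l; exact: nbhs_infty_ge.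
Unshelve. all: by end_near. Qed.

Let F (A : dchain U k) (i : nat) : dchain U k' := projT1 (cid (approx_exists A i)).

Let FP A i : \forall j \near \oo, bcost_le U q (P j (dval A) - dval (F A i)) i.+1%:R^-1.
Proof. exact: projT2 (cid (approx_exists A i)). Qed.

Lemma approx_bound r : exists r' C, 0 <= C /\ forall A i x, bcost_le U r (dval A) x ->
  bcost_le U (maxn r' q) (dval (F A i)) (C * x + i.+1%:R^-1).
Proof.
have [r' [C [C0 hC]]] := boundP r; exists r', C; split => // A i x /hC hx.
near \oo => j.
have h1 : bcost_le U r' (P j (dval A)) (C * x) by near: j.
have h2 : bcost_le U q (P j (dval A) - dval (F A i)) i.+1%:R^-1 by near: j; exact: FP.
have := bcost_leB (bcost_le_le (leq_maxl r' q) (lexx _) h1) (bcost_le_le (leq_maxr r' q) (lexx _) h2).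
by rewrite opprB addrC subrK.
Unshelve. all: by end_near. Qed.

Lemma approx_combine r : exists r' C, 0 <= C /\ forall c A B D i j l x,
  bcost_le U r (dval D - (c *: dval A + dval B)) x ->
  bcost_le U (maxn r' q) (dval (F D i) - (c *: dval (F A j) + dval (F B l)))
    (C * x + (i.+1%:R^-1 + (`|c| * j.+1%:R^-1 + l.+1%:R^-1))).
Proof.
have [r' [C [C0 hC]]] := boundP r; exists r', C; split => // c A B D i j l x /hC hx.
near \oo => z.
have h : bcost_le U r' (P z (dval D - (c *: dval A + dval B))) (C * x) by near: z.
have hD : bcost_le U q (P z (dval D) - dval (F D i)) i.+1%:R^-1 by near: z; exact: FP.
have hA : bcost_le U q (P z (dval A) - dval (F A j)) j.+1%:R^-1 by near: z; exact: FP.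
have hB : bcost_le U q (P z (dval B) - dval (F B l)) l.+1%:R^-1 by near: z; exact: FP.
have := bcost_leB (bcost_le_le (leq_maxl r' q) (lexx _) h)
  (bcost_le_le (leq_maxr r' q) (lexx _) (bcost_leB hD (bcost_leD (bcost_leZ c hA) hB))).
rewrite (linB (linP z)) (linD (linP z)) (linZ (linP z)); congr (bcost_le U _ _ _).
move: (P z (dval A)) (P z (dval B)) (P z (dval D)) => f1 f2 f3.
apply/funext => y; apply/ffunP => I; rewrite !(fctE, ffunE) /=.
by rewrite /GRing.scale /=; ring.
Unshelve. all: by end_near. Qed.

Lemma inv_small (e : R) : 0 < e -> \forall i \near \oo, i.+1%:R^-1 < e.
Proof.
by move=> e0; near=> i; near: i; exact: (near_infty_natSinv_lt (PosNum e0)).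
Unshelve. all: by end_near. Qed.

Lemma null_combine r c (A B D : nat -> dchain U k) :
  bnull r (fun i => D i - (c *: A i + B i)) ->
  exists s, bnull s (fun i => F (D i) i - (c *: F (A i) i + F (B i) i)).
Proof.
have [r' [C [C0 hC]]] := approx_combine r => nD; exists (maxn r' q) => e e0.
have d0 : 0 < e / (C + `|c| + 3) by rewrite divr_gt0// ltr_wpDl// addr_ge0.
have [m1 h1] := nD _ d0; have [m2 _ h2] := inv_small d0.
exists (maxn m1 m2) => i; rewrite geq_max => /andP[/h1 /bnorm_bcost_le hi /h2 /= di].
have /bcost_le_bnorm h := hC c _ _ _ i i i _ hi; apply: le_lt_trans h _.
have {2}-> : e = (e / (C + `|c| + 3)) * (C + `|c| + 3) by rewrite divfK// gt_eqF// ltr_wpDl// addr_ge0.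
move: di d0; set d := e / _; set y := _^-1 => yd d0.
by have cy := ler_wpM2l (normr_ge0 c) (ltW yd); rewrite mulrDr mulrDr [d * C]mulrC [d * `|c|]mulrC; lra.
Qed.

Lemma approx_cauchy r : exists s, forall A : nat -> dchain U k,
  bcauchy r A -> bcauchy s (fun i => F (A i) i).
Proof.
have [r' [C [C0 hC]]] := approx_combine r; exists (maxn r' q) => A cA e e0.
have d0 : 0 < e / (C + 3) by rewrite divr_gt0// ltr_wpDl.
have [m1 h1] := cA _ d0; have [m2 _ h2] := inv_small d0.
exists (maxn m1 m2) => i j; rewrite !geq_max => /andP[i1 /h2 /= di] /andP[j1 /h2 /= dj].
have /bnorm_bcost_le := h1 _ _ i1 j1.
have -> : dval (A i - A j) = dval (A i) - (0 *: dval (0 : dchain U k) + dval (A j)).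
  by rewrite scale0r add0r.
move/(hC 0 _ _ _ i i j) => /bcost_le_bnorm; rewrite scale0r add0r normr0 mul0r add0r.
move/le_lt_trans; apply.
have {2}-> : e = (e / (C + 3)) * (C + 3) by rewrite divfK// gt_eqF// ltr_wpDl.
move: di dj d0; set d := e / _; set y := _^-1; set z := _^-1 => yd zd d0.
by rewrite mulrDr mulrC; lra.
Qed.

Lemma approx_cauchy_subproof (A : cseq U k) :
  (fun i => F (cval A i) i) \in @cauchy_pred R n U k'.
Proof.
have /asboolP[r cA] := cvalP A; apply/asboolP.
by have [s hs] := approx_cauchy r; exists s; exact: hs.
Qed.

Let op (A : cseq U k) : cseq U k' := CSeq (approx_cauchy_subproof A).

Let T (J : chain U k) : chain U k' := \pi_(chain U k')%qT (op (repr J)).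

Let T_combine c (A B D : cseq U k) :
  \pi_(chain U k)%qT D = c *: \pi_(chain U k)%qT A + \pi_(chain U k)%qT B ->
  \pi_(chain U k')%qT (op D) = c *: \pi_(chain U k')%qT (op A) + \pi_(chain U k')%qT (op B).
Proof.
rewrite -piZ -piD => /chain_eqP[r nD]; rewrite -piZ -piD; apply/chain_eqP.
have {}nD : bnull r (fun i => cval D i - (c *: cval A i + cval B i)).
  by move=> e /nD[m h]; exists m => i /h; rewrite cval_lin.
have [s hs] := null_combine nD; exists s => e /hs[m h]; exists m => i /h.
by rewrite cval_lin.
Qed.

Let T_pi A : T (\pi_(chain U k)%qT A) = \pi_(chain U k')%qT (op A).
Proof.
have := @T_combine 0 A A (repr (\pi_(chain U k)%qT A)).
by rewrite !scale0r !add0r reprK; exact.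
Qed.

(** A pointwise Cauchy sequence of operators, each bounded from the norm of order r
   to another one, has a limit on chains: the approximations [F] of the limit are
   additive and homogeneous up to null sequences. *)
Theorem extension : exists T : chain U k -> chain U k', [/\ linear T, continuous T &
  forall A : dchain U k, exists2 S : cseq U k', T (dirac_chain A) = \pi_(chain U k')%qT S &
    exists2 r, bcauchy r (cval S) & forall i, \forall j \near \oo,
      bcost_le U q (P j (dval A) - dval (cval S i)) i.+1%:R^-1].
Proof.
exists T; have linT : linear T.
  by move=> c J K; rewrite -[c *: J + K]reprK T_pi; apply: T_combine; rewrite !reprK.
split => //.
  apply: lin_continuous => // r; have [r' [C [C0 hC]]] := approx_bound r.
  have [r2 hr2] := approx_cauchy r.
  exists (maxn (maxn r' q) r2), (C + 1); split; first by rewrite ltr_wpDl.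
  move=> e e0 _ [A [cA -> [m Am]]]; rewrite T_pi; exists (op A); split => //.
    move=> d /(hr2 _ cA)[m1 h1]; exists m1 => i j mi mj.
    exact: le_lt_trans (bnorm_mono _ (leq_maxr _ _)) (h1 _ _ mi mj).
  have [m2 _ h2] := inv_small e0.
  exists (maxn m m2) => i; rewrite geq_max => /andP[/Am /bnorm_bcost_le /(hC _ i) h /h2 /= ie].
  apply: le_lt_trans (bnorm_mono _ (leq_maxl _ _)) _.
  apply: le_lt_trans (bcost_le_bnorm h) _.
  by rewrite mulrDl mul1r ltrD2l.
move=> A; exists (op (CSeq (cst_cauchy_subproof A))); first exact: T_pi.
have /asboolP[r cS] := cvalP (op (CSeq (cst_cauchy_subproof A))).
by exists r => // i; exact: FP.
Qed.

End Extension.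
End ChainTopology.

(** * Integration *)

Section Integration.
Context {R : realType} {n : nat} (U : set 'rV[R]_n).
Local Notation E := 'rV[R]_n.

Section Forms.
Context {k : nat}.
Implicit Types (w : dchain U k -> R).

Lemma to_dchainK (A : E -> kvec R n k) : A \in @dirac_pred R n U k ->
  dval (to_dchain U A) = A.
Proof. by move=> hA; rewrite /to_dchain insubdK. Qed.

Lemma to_dchain_val (A : dchain U k) : to_dchain U (dval A) = A.
Proof. by apply: val_inj; rewrite /= to_dchainK// dvalP. Qed.

Lemma to_dchain0 : to_dchain U (0 : E -> kvec R n k) = 0.
Proof. by rewrite -[RHS]to_dchain_val. Qed.

Lemma to_dchainD (A B : E -> kvec R n k) : A \in @dirac_pred R n U k ->
  B \in @dirac_pred R n U k -> to_dchain U (A + B) = to_dchain U A + to_dchain U B.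
Proof.
move=> hA hB; apply: val_inj; rewrite /= to_dchainK ?rpredD//.
by rewrite !to_dchainK.
Qed.

Lemma to_dchainZ c (A : E -> kvec R n k) : A \in @dirac_pred R n U k ->
  to_dchain U (c *: A) = c *: to_dchain U A.
Proof.
by move=> hA; apply: val_inj; rewrite /= to_dchainK ?rpredZ//= to_dchainK.
Qed.

Lemma to_dchainB (A B : E -> kvec R n k) : A \in @dirac_pred R n U k ->
  B \in @dirac_pred R n U k -> to_dchain U (A - B) = to_dchain U A - to_dchain U B.
Proof.
move=> hA hB; rewrite -scaleN1r to_dchainD ?rpredZ ?rpredN//.
by rewrite to_dchainZ ?scaleN1r.
Qed.

Lemma scalar0 w : scalar w -> w 0 = 0.
Proof. by move=> lw; exact: (lin0 lw). Qed.

Lemma scalarD w A B : scalar w -> w (A + B) = w A + w B.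
Proof. by move=> lw; exact: (linD lw). Qed.

Lemma scalarB w A B : scalar w -> w (A - B) = w A - w B.
Proof. by move=> lw; exact: (linB lw). Qed.

Lemma scalarZ w c A : scalar w -> w (c *: A) = c * w A.
Proof. by move=> lw; exact: (linZ lw). Qed.

(** By [fnorm_bnd] this says that [fnorm r w <= M], except that difference chains
   of cost 0, which are null, are not left out. *)
Definition bnd r (M : R) w := forall s p (a : kvec R n k), (size s <= r)%N ->
  inside U s p a -> `|w (to_dchain U (Delta s p a))| <= M * (snorm s * mass a).

Lemma bnd_zonotope_in r M w : scalar w -> 0 <= M ->
  (forall s p (a : kvec R n k), (size s <= r)%N -> zonotope_in U s p ->
    `|w (to_dchain U (Delta s p a))| <= M * (snorm s * mass a)) -> bnd r M w.
Proof.
move=> lw M0 h s p a sr iU.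
have c0 : 0 <= M * (snorm s * mass a) by rewrite !mulr_ge0 ?snorm_ge0 ?mass_ge0.
have [a0|a0] := eqVneq a 0; first by rewrite a0 Delta0r to_dchain0 (scalar0 lw) normr0 -a0.
have [s0|s0] := boolP (0 \in s); first by rewrite Delta0l// to_dchain0 (scalar0 lw) normr0.
by apply: h => //; exact: inside_zonotope_in iU.
Qed.

(** It suffices to consider difference chains, by [bcost_le_elim]. *)
Lemma bnd_bcost_le r M w (A : dchain U k) x : scalar w -> 0 <= M -> bnd r M w ->
  bcost_le U r (dval A) x -> `|w A| <= M * x.
Proof.
move=> lw M0 bw; rewrite -[in w A](to_dchain_val A).
suff : forall B y, bcost_le U r B y ->
    B \in @dirac_pred R n U k /\ `|w (to_dchain U B)| <= M * y.
  by move=> h /h[].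
apply: bcost_le_elim.
- by split; [exact: rpred0|rewrite to_dchain0 (scalar0 lw) normr0 mulr0].
- move=> B C y z [hB wB] [hC wC]; split; first exact: rpredD.
  rewrite to_dchainD// (scalarD _ _ lw) mulrDr.
  by apply: le_trans (ler_normD _ _) _; exact: lerD.
- move=> B y z [hB wB] yz; split => //; apply: le_trans wB _.
  by rewrite ler_wpM2l.
- move=> s p a sr zp; have iU : inside U s p a by exact: zonotope_in_inside.
  by split; [exact: Delta_dirac|exact: bw].
Qed.

(** By homogeneity in [a]; a difference chain of cost 0 is null. *)
Lemma fnorm_bnd r M w : scalar w -> 0 <= M -> (fnorm r w <= M%:E)%E <-> bnd r M w.
Proof.
move=> lw M0; split=> [|bw].
  move=> /bigmax_leP[_ h] s p a sr iU.
  have [c0|c0] := eqVneq (snorm s * mass a) 0.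
    rewrite c0 mulr0; have : Delta s p a = 0.
      move/eqP: c0; rewrite mulf_eq0 => /orP[s0|/eqP/mass_eq0 ->]; last exact: Delta0r.
      apply: Delta0l; move: s0; rewrite /snorm prodf_seq_eq0 => /hasP[u us /= u0].
      suff -> : 0 = u by [].
      apply/rowP => i; rewrite mxE; apply/esym/eqP.
      by rewrite -normr_le0 -(eqP u0) norm_le_enorm.
    by move=> ->; rewrite to_dchain0 (scalar0 lw) normr0.
  have cp : 0 < snorm s * mass a by rewrite lt0r c0 mulr_ge0 ?snorm_ge0 ?mass_ge0.
  have := h (inord (size s)) isT; rewrite inordK ?ltnS// => hs.
  have : (`|w (to_dchain U (Delta s p ((snorm s * mass a)^-1 *: a)))|%:E <= M%:E)%E.
    apply: le_trans hs; apply: ereal_sup_ubound.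
    exists s, p, ((snorm s * mass a)^-1 *: a); split => //.
      exact: insideZ.
    apply/eqP; rewrite eq_le; apply/andP; split.
      apply: le_trans (ler_wpM2l (snorm_ge0 _) (mass_leZ _ _)) _.
      by rewrite gtr0_norm ?invr_gt0// mulrCA mulVf.
    have := mass_leZ (snorm s * mass a) ((snorm s * mass a)^-1 *: a).
    rewrite scalerA mulfV// scale1r gtr0_norm// => hm.
    have sp : 0 < snorm s.
      by rewrite lt0r snorm_ge0 andbT; apply: contraNneq c0 => ->; rewrite mul0r.
    have mp : 0 < mass a.
      by rewrite lt0r mass_ge0 andbT; apply: contraNneq c0 => ->; rewrite mulr0.
    by rewrite -(ler_pM2l mp) mulr1 mulrA [mass a * _]mulrC.
  rewrite DeltaZ to_dchainZ ?Delta_dirac// (scalarZ _ _ lw) lee_fin normrM.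
  by rewrite gtr0_norm ?invr_gt0// ler_pdivrMl// mulrC.
apply/bigmax_leP; split; first by rewrite lee_fin.
move=> j _; apply: ge_ereal_sup => _ [s [p [a [sj iU c1 ->]]]].
rewrite lee_fin; have := bw s p a _ iU; rewrite c1 mulr1; apply.
by rewrite sj -ltnS.
Qed.

Lemma fnorm_ge0 r w : (0 <= fnorm r w)%E.
Proof. exact: bigmax_ge_id. Qed.

Lemma bounded_formP w : bounded_form w <->
  scalar w /\ forall r, exists2 M, 0 <= M & bnd r M w.
Proof.
split=> [[lw bw]|[lw bw]]; split => // r.
  have fw : fnorm r w \is a fin_num by rewrite ge0_fin_numE ?fnorm_ge0.
  exists (fine (fnorm r w)); first by rewrite fine_ge0 ?fnorm_ge0.
  by apply/fnorm_bnd; rewrite ?fine_ge0 ?fnorm_ge0// fineK.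
by have [M M0 /(fnorm_bnd _ lw M0) h] := bw r; apply: le_lt_trans h _; rewrite ltry.
Qed.

Lemma bounded_scalar w : bounded_form w -> scalar w.
Proof. by case. Qed.

Lemma bounded_formD c w w' : bounded_form w -> bounded_form w' ->
  bounded_form (fun A => c * w A + w' A).
Proof.
move=> /bounded_formP[lw bw] /bounded_formP[lw' bw']; apply/bounded_formP; split.
  by move=> d A B /=; rewrite lw lw' /=; ring.
move=> r; have [M M0 hM] := bw r; have [M' M0' hM'] := bw' r.
exists (`|c| * M + M'); first by rewrite addr_ge0// mulr_ge0.
move=> s p a sr iU; apply: le_trans (ler_normD _ _) _; rewrite mulrDl.
by rewrite lerD ?hM'// normrM -mulrA ler_wpM2l// hM.
Qed.

Variable w : dchain U k -> R.
Hypothesis bw : bounded_form w.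
Let lw : scalar w := bounded_scalar bw.

Lemma cvg_form_seq (A : cseq U k) : cvg (w (cval A i) @[i --> \oo]).
Proof.
have /asboolP[r cA] := cvalP A; apply: real_cauchy_cvg => e e0.
have [_ /(_ r)[M M0 bM]] := (bounded_formP w).1 bw.
have d0 : 0 < e / (M + 1) by rewrite divr_gt0// ltr_wpDl.
have [m hm] := cA _ d0; exists m => i j mi mj.
rewrite -scalarB//; have /bnorm_bcost_le := hm _ _ mi mj.
move=> /(bnd_bcost_le lw M0 bM) h; apply: le_lt_trans h _.
by rewrite mulrCA gtr_pMr// ltr_pdivrMr ?mul1r ?ltrDl// ltr_wpDl.
Qed.

(** Two representatives differ by a null sequence for some B^r norm, on which the
   form tends to 0. *)
Lemma cvg_chain_integral (A : cseq U k) :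
  w (cval A i) @[i --> \oo] --> chain_integral (\pi_(chain U k)%qT A) w.
Proof.
rewrite /chain_integral; set B := repr _.
have [r nAB] : exists r, bnull r (fun i => cval A i - cval B i).
  by apply/chain_eqP; rewrite /B reprK.
have cB : cvg (w (cval B i) @[i --> \oo]) := @cvg_form_seq B.
have : (fun i => w (cval A i) - w (cval B i)) @ \oo --> 0.
  have [_ /(_ r)[M M0 bM]] := (bounded_formP w).1 bw.
  apply/cvgr0Pnorm_lt => e e0.
  have d0 : 0 < e / (M + 1) by rewrite divr_gt0// ltr_wpDl.
  have [m hm] := nAB _ d0; exists m => // i /= mi.
  rewrite -scalarB//; have /bnorm_bcost_le := hm _ mi.
  move=> /(bnd_bcost_le lw M0 bM) h; apply: le_lt_trans h _.
  by rewrite mulrCA gtr_pMr// ltr_pdivrMr ?mul1r ?ltrDl// ltr_wpDl.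
move=> /cvgD /(_ cB); rewrite add0r; congr (cvg_to _ _).
by congr (nbhs (_ @ \oo)); apply/funext => i; rewrite !fctE subrK.
Qed.

Lemma chain_integral_pi (A : cseq U k) :
  chain_integral (\pi_(chain U k)%qT A) w = lim (w (cval A i) @[i --> \oo]).
Proof. by apply/esym/cvg_lim => //; exact: cvg_chain_integral. Qed.

Lemma chain_integral_dirac (A : dchain U k) : chain_integral (dirac_chain A) w = w A.
Proof. by rewrite chain_integral_pi /= lim_cst. Qed.

Lemma chain_integral_linear : scalar (fun J => chain_integral J w).
Proof.
move=> c J K; rewrite -[J]reprK -[K]reprK -piZ -piD.
have e : (fun i => w (cval (c *: repr J + repr K) i)) =
  (fun i => c * w (cval (repr J) i) + w (cval (repr K) i)).
  by apply/funext => i; rewrite cval_lin lw.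
have := @cvg_chain_integral (c *: repr J + repr K); rewrite e => h.
apply: cvg_unique h _ => //=.
by apply: cvgD; [apply: cvgMl_tmp|]; exact: cvg_chain_integral.
Qed.

Lemma chain_integral_bound r M e J : 0 <= M -> bnd r M w -> step_ball r e J ->
  `|chain_integral J w| <= M * e.
Proof.
move=> M0 bM [A [cA -> [m Am]]].
have /(cvg_norm (FF := _)) h := @cvg_chain_integral A.
have cvgn : (fun i => `|w (cval A i)|) @ \oo --> `|chain_integral (\pi_(chain U k)%qT A) w|.
  exact: h.
rewrite -(cvg_lim _ cvgn)//; apply: limr_le; first by apply/cvg_ex; eexists; exact: cvgn.
exists m => // i /= /Am /bnorm_bcost_le hi; exact: bnd_bcost_le hi.
Qed.

Lemma chain_integral_continuous : continuous (fun J => chain_integral J w).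
Proof.
apply: functional_continuous chain_integral_linear _ => r.
have [_ /(_ r)[M M0 bM]] := (bounded_formP w).1 bw.
exists (M + 1); first by rewrite ltr_wpDl.
move=> e e0 J Je; apply: le_trans (chain_integral_bound M0 bM Je) _.
by rewrite ler_wpM2r ?(ltW e0)// lerDl.
Qed.
End Forms.

Lemma chain_integral_formD k c (w w' : dchain U k -> R) J :
  bounded_form w -> bounded_form w' ->
  chain_integral J (fun A => c * w A + w' A) = c * chain_integral J w + chain_integral J w'.
Proof.
move=> bw bw'; rewrite -[J]reprK.
have h := @cvg_chain_integral k _ (bounded_formD c bw bw') (repr J).
apply: cvg_unique h _ => //=.
by apply: cvgD; [apply: cvgMl_tmp|]; exact: cvg_chain_integral.
Qed.

Lemma dirac_dense k (A : cseq U k) :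
  dirac_chain (cval A i) @[i --> \oo] --> \pi_(chain U k)%qT A.
Proof.
have /asboolP[r cA] := cvalP A.
move=> W [B [cB sB] BW]; have [e e0 eB] := sB r.
have [m hm] := cA _ e0; exists m => // i /= mi.
rewrite -[dirac_chain _](subrKC (\pi_(chain U k)%qT A)); apply/BW/eB.
exists (CSeq (cst_cauchy_subproof (cval A i)) - A); split.
- move=> d d0; have [m' hm'] := cA _ d0; exists m' => a b ma mb.
  have -> : cval (CSeq (cst_cauchy_subproof (cval A i)) - A) a -
      cval (CSeq (cst_cauchy_subproof (cval A i)) - A) b = cval A b - cval A a.
    by rewrite -[LHS]/((cval A i - cval A a) - (cval A i - cval A b)) opprD opprK addrACA subrr add0r addrC.
  exact: hm'.
- by rewrite raddfB.
- by exists m => j mj; exact: hm.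
Qed.

Lemma dirac_chain_linear k : linear (@dirac_chain R n U k).
Proof.
move=> c A B; rewrite /dirac_chain -piZ -piD; apply/chain_eqP; exists 0%N => e e0.
by exists 0%N => i _; rewrite cval_lin subrr bnorm0.
Qed.

End Integration.

(** * Retraction and prederivative *)

Section Operators.
Context {R : realType} {n : nat} (U : set 'rV[R]_n).
Local Notation E := 'rV[R]_n.

Lemma kelt_dirac k p (a : kvec R n k) : U p -> kelt p a \in @dirac_pred R n U k.
Proof.
by move=> Up; exact: (@Delta_dirac R n k U [::] p a (@inside_nil R n U k p a Up)).
Qed.

Lemma pelemK k p (a : kvec R n k) : U p -> dval (pelem U p a) = kelt p a.
Proof. by move=> Up; rewrite /pelem to_dchainK// kelt_dirac. Qed.

Lemma pelem_linear k p : linear (@pelem R n U k p).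
Proof.
move=> c a b; have [Up|nUp] := pselect (U p).
  apply: val_inj; rewrite /= pelemK// keltD keltZ.
  by rewrite -(pelemK a Up) -(pelemK b Up).
suff h (d : kvec R n k) : pelem U p d = 0 by rewrite !h scaler0 addr0.
have [->|d0] := eqVneq d 0.
  by rewrite /pelem (_ : kelt p 0 = 0) ?to_dchain0//; apply/funext => q; rewrite /kelt; case: ifP.
rewrite /pelem /to_dchain /insubd insubN//; apply/negP => /finite_csuppP[_].
by move=> /(_ p) sU; apply/nUp/sU; rewrite /csupp /= /kelt eqxx.
Qed.

Section Map.
Context {k k' : nat} (L : kvec R n k -> kvec R n k').
Hypothesis linL : linear L.

Definition map_section (A : E -> kvec R n k) : E -> kvec R n k' := fun q => L (A q).

Lemma map_section_linear : linear map_section.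
Proof. by move=> c A B; apply/funext => q; exact: linL. Qed.

Lemma map_Delta s p a : map_section (Delta s p a) = Delta s p (L a).
Proof.
elim: s p => [p|u s IH p].
  apply/funext => q; rewrite /map_section /= /kelt; case: ifP => // _.
  exact: lin0 linL.
by rewrite !Delta_cons (linB map_section_linear) !IH.
Qed.

Lemma bcost_le_map r : exists2 C, 0 <= C & forall A x, bcost_le U r A x ->
  bcost_le U r (map_section A) (C * x).
Proof.
have [C C0 hC] := linear_mass_le linL; exists C => // A x.
move: A x; apply: bcost_le_elim.
- by rewrite (lin0 map_section_linear) mulr0; exact: bcost_le0.
- by move=> A B x y hA hB; rewrite (linD map_section_linear) mulrDr; exact: bcost_leD.
- by move=> A x y hA xy; apply: bcost_le_le hA; rewrite ?ler_wpM2l.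
- move=> s p a sr zp; rewrite map_Delta.
  have iU : inside U s p (L a) by exact: zonotope_in_inside.
  have := bcost_le_Delta sr iU; apply: bcost_le_le => //.
  by rewrite mulrCA ler_wpM2l ?snorm_ge0.
Qed.

Lemma map_chain : exists T : chain U k -> chain U k', [/\ linear T, continuous T &
  forall p a, U p -> T (dirac_chain (pelem U p a)) = dirac_chain (pelem U p (L a))].
Proof.
have [|r|A e e0|T [lT cT hT]] := @extension R n U k k' (fun=> map_section) _ _ 0.
- by move=> _; exact: map_section_linear.
- by have [C C0 hC] := bcost_le_map r; exists r, C; split => // A x /hC h; near=> j.
- by exists 0%N => i j _ _; rewrite subrr; apply/bcost_le0/ltW.
exists T; split => // p a Up; have [S -> [r cS hS]] := hT (pelem U p a).
apply/chain_eqP; exists 0%N => e e0.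
have [m _ hm] := inv_small e0; exists m => i /hm /= ie.
near \oo => j.
have : bcost_le U 0 (map_section (dval (pelem U p a)) - dval (cval S i)) i.+1%:R^-1.
  by near: j; exact: hS.
rewrite pelemK// (map_Delta [::]) /= -pelemK// => /bcost_le_sym /bcost_le_bnorm h.
exact: le_lt_trans h ie.
Unshelve. all: by end_near. Qed.

End Map.

Lemma kcontract_linear v k : linear (@kcontract R n v k).
Proof. exact: lext_linear. Qed.

Lemma retractionP v k : @is_retraction R n U v k (@retraction R n U v k).
Proof.
have [T hT] := map_chain (@kcontract_linear v k).
rewrite /retraction; case: xgetP => [T' -> //|].
by move=> /(_ T).
Qed.

(** The operator is obtained along the steps 1/(j+1); the Cauchy estimate
   [dquot_cauchy] extends the convergence to all steps. *)
Lemma dquot_dirac_chain (oU : open U) v k : exists T : chain U k -> chain U k,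
  [/\ linear T, continuous T & forall A : dchain U k,
  dirac_chain (to_dchain U (dquot v t (dval A))) @[t --> (0 : R)^'] --> T (dirac_chain A)].
Proof.
have linP (j : nat) : linear (@dquot R n k v j.+1%:R^-1) by exact: dquot_linear.
have [|r|A e e0|T [lT cT hT]] :=
    @extension R n U k k (fun j => @dquot R n k v j.+1%:R^-1) _ _ 2.
- exact: linP.
- exists r.+1, (enorm v); split; first exact: enorm_ge0.
  move=> A x /(bcost_le_dquot oU v) [d /= d0 dA].
  have [m _ hm] := inv_small d0; exists m => // j /hm /= jd; apply: dA => //=.
  by rewrite sub0r normrN gtr0_norm.
- have [x Ax] := dchain_bcost_le 0 A; have [C [d [C0 d0 hC]]] := dquot_cauchy oU v Ax.
  have f0 : 0 < Num.min d (e / (C * 2 + 1)).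
    by rewrite lt_min d0 divr_gt0// ltr_wpDl// mulr_ge0.
  have [m _ hm] := inv_small f0; exists m => i j /hm /= + /hm /=.
  rewrite !lt_min => /andP[id ie] /andP[jd je].
  have i0 : 0 < i.+1%:R^-1 :> R by rewrite invr_gt0.
  have j0 : 0 < j.+1%:R^-1 :> R by rewrite invr_gt0.
  have := hC i.+1%:R^-1 j.+1%:R^-1; rewrite (gtr0_norm i0) (gtr0_norm j0) i0 j0.
  rewrite id jd => /(_ isT isT); apply: bcost_le_le => //.
  rewrite ltr_pdivlMr ?ltr_wpDl ?mulr_ge0// in ie.
  rewrite ltr_pdivlMr ?ltr_wpDl ?mulr_ge0// in je.
  move: ie je i0 j0; move: (_^-1) (_^-1) => y z; lra.
exists T; split => // A; have [S TA [r cS hS]] := hT A.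
have [x Ax] := dchain_bcost_le 0 A; have [C [d [C0 d0 hC]]] := dquot_cauchy oU v Ax.
move=> W [B [cB sB] BW]; have [e e0 eB] := sB (maxn r 2).
have f0 : 0 < Num.min d (e / (C * 2 + 1)).
  by rewrite lt_min d0 divr_gt0// ltr_wpDl// mulr_ge0.
have [d1 /= d10 dA] := bcost_le_dquot oU v Ax.
exists (Num.min d1 (Num.min d (e / (C * 2 + 1)))); first by rewrite /= lt_min d10.
move=> t /=; rewrite sub0r normrN lt_min => /andP[td1]; rewrite lt_min => /andP[td te] t0.
have Xt : dquot v t (dval A) \in @dirac_pred R n U k.
  by apply: (@bcost_le_dirac _ _ _ _ 1 _ (enorm v * x)); apply: dA => //=; rewrite sub0r normrN.
set X := to_dchain U _.
have XE : dval X = dquot v t (dval A) by rewrite to_dchainK.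
rewrite -[dirac_chain X](subrKC (T (dirac_chain A))); apply/BW/eB.
rewrite TA; exists (CSeq (cst_cauchy_subproof X) - S); split.
- move=> f /cS[m hm]; exists m => a b ma mb.
  apply: le_lt_trans (bnorm_mono _ (leq_maxl _ _)) _.
  have -> : cval (CSeq (cst_cauchy_subproof X) - S) a -
      cval (CSeq (cst_cauchy_subproof X) - S) b = cval S b - cval S a.
    by rewrite -[LHS]/((X - cval S a) - (X - cval S b)) opprD opprK addrACA subrr add0r addrC.
  exact: hm.
- by rewrite raddfB.
have [m _ hm] := inv_small f0; exists m => i /hm /=.
rewrite lt_min => /andP[id ie].
near \oo => j.
have mj : (m <= j)%N by near: j; exact: nbhs_infty_ge.
have := hm _ mj; rewrite /= lt_min => /andP[jd je].
have hj : bcost_le U 2 (dquot v j.+1%:R^-1 (dval A) - dval (cval S i)) i.+1%:R^-1.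
  by near: j; exact: hS.
have j0 : 0 < j.+1%:R^-1 :> R by rewrite invr_gt0.
have htj := hC t j.+1%:R^-1; rewrite normr_gt0 t0 td (gtr0_norm j0) j0 jd in htj.
have := bcost_leD (htj isT isT) hj; rewrite addrA subrK -XE => /bcost_le_bnorm h.
apply: le_lt_trans (bnorm_mono (X - cval S i) (leq_maxr r 2)) _; apply: le_lt_trans h _.
have -> : e = (e / (C * 2 + 1)) * (C * 2 + 1) by rewrite divfK// gt_eqF// ltr_wpDl// mulr_ge0.
have h1 : C * (`|t| + j.+1%:R^-1) <= C * (e / (C * 2 + 1) * 2).
  by apply: ler_wpM2l => //; rewrite mulr_natr mulr2n lerD// ltW.
move: h1 ie; set f := e / _ => h1 ie.
have -> : f * (C * 2 + 1) = C * (f * 2) + f by ring.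
exact: ler_ltD.
Unshelve. all: by end_near. Qed.

Lemma near_ray (oU : open U) p v : U p -> \forall t \near (0 : R)^', U (p + t *: v).
Proof.
move=> Up; have [d d0 dU] := @zonotope_in_ray R n U oU [::] p v Up.
by exists d => // t /=; rewrite sub0r normrN => td _; exact: dU.
Qed.

Lemma dirac_dquot_pelem k p v t (a : kvec R n k) : U p -> U (p + t *: v) ->
  dirac_chain (pelem U (p + t *: v) (t^-1 *: a)) - dirac_chain (pelem U p (t^-1 *: a)) =
  dirac_chain (to_dchain U (dquot v t (dval (pelem U p a)))).
Proof.
move=> Up Upt; rewrite -(linB (@dirac_chain_linear R n U k)); congr dirac_chain.
have h1 := kelt_dirac a Up; have h2 := kelt_dirac a Upt.
rewrite (pelemK a Up) /dquot translate_kelt (to_dchainZ _ (rpredB h2 h1)).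
rewrite (to_dchainB h2 h1) scalerBr (linZ (@pelem_linear k _)).
by rewrite (linZ (@pelem_linear k _)).
Qed.

Lemma prederivativeP (oU : open U) v k :
  @is_prederivative R n U v k (@prederivative R n U v k).
Proof.
have [T [lT cT hT]] := @dquot_dirac_chain oU v k.
rewrite /prederivative; case: xgetP => [T' -> //|].
move=> /(_ T) []; split => // p a Up.
apply: cvg_trans (hT (pelem U p a)); apply: near_eq_cvg.
have := near_ray oU v Up; apply: filterS => t Upt.
by rewrite dirac_dquot_pelem.
Qed.

(** For k-elements this is the continuity of the integral; both sides are additive. *)
Lemma cvg_prederivative (oU : open U) v k (w : dchain U k -> R) (A : dchain U k) :
  bounded_form w ->
  w (to_dchain U (dquot v t (dval A))) @[t --> (0 : R)^'] -->
  chain_integral (prederivative v (dirac_chain A)) w.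
Proof.
move=> bw; have [lT cT hT] := @prederivativeP oU v k.
have lw := bounded_scalar bw.
have [x Ax] := dchain_bcost_le 0 A; rewrite -[dirac_chain A](congr1 _ (to_dchain_val A)).
suff : forall B y, bcost_le U 0 B y -> B \in @dirac_pred R n U k /\
    w (to_dchain U (dquot v t B)) @[t --> (0 : R)^'] -->
    chain_integral (prederivative v (dirac_chain (to_dchain U B))) w.
  by move=> /(_ _ _ Ax)[].
have lin := chain_integral_linear bw.
apply: bcost_le_elim.
- split; first exact: rpred0.
  rewrite to_dchain0 (lin0 (@dirac_chain_linear R n U k)) (lin0 lT) (lin0 lin).
  under eq_fun do rewrite (lin0 (dquot_linear v _)) to_dchain0 (scalar0 lw).
  exact: cvg_cst.
- move=> B C y z [hB cB] [hC cC]; split; first exact: rpredD.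
  rewrite to_dchainD// (linD (@dirac_chain_linear R n U k)) (linD lT) (linD lin).
  apply: cvg_trans (cvgD cB cC); apply: near_eq_cvg.
  have [yB By] := dchain_bcost_le 0 (DChain hB); have [yC Cy] := dchain_bcost_le 0 (DChain hC).
  near=> t; rewrite !fctE dquotD to_dchainD ?(scalarD _ _ lw)//.
    by apply: (@bcost_le_dirac _ _ _ _ 1 _ (enorm v * yB)); near: t; exact: bcost_le_dquot By.
  by apply: (@bcost_le_dirac _ _ _ _ 1 _ (enorm v * yC)); near: t; exact: bcost_le_dquot Cy.
- by [].
move=> [|//] p a _ Up; split; first exact: kelt_dirac.
rewrite -[to_dchain U (Delta [::] p a)]/(pelem U p a).
have ci := @chain_integral_continuous R n U k w bw.
have := cvg_comp _ _ (hT p a Up) (ci _).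
apply: cvg_trans; apply: near_eq_cvg.
have := near_ray oU v Up; apply: filterS => t Upt.
by rewrite [LHS]/= dirac_dquot_pelem// (chain_integral_dirac bw) pelemK.
Unshelve. all: by end_near. Qed.

End Operators.

(** * Algebra in top degree *)

Section TopDegree.
Context {R : realType} {n : nat}.
Local Notation m := n.+1.
Local Notation E := 'rV[R]_m.

Fact full_index_proof : [forall i : 'I_m, forall j : 'I_m, (i < j)%N ==>
  ([ffun i : 'I_m => i] i < [ffun i : 'I_m => i] j)%N].
Proof. by apply/'forall_forallP => i j; rewrite !ffunE; apply/implyP. Qed.

Definition full_index : mindex m m := Sub [ffun i => i] full_index_proof.

Lemma full_index_unique (I : mindex m m) : I = full_index.
Proof.
apply: sub_mindex => i _; apply/codomP; exists i; by rewrite /= ffunE.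
Qed.

Definition top_coord (a : kvec R m m) : R := a full_index.

Lemma top_coord0 : top_coord 0 = 0.
Proof. by rewrite /top_coord ffunE. Qed.

Lemma top_coord_scalar (x : R) : scalar (fun a => top_coord a * x).
Proof. by move=> c a b; rewrite /top_coord !ffunE mulrDl -mulrA. Qed.

Lemma top_coordE (a : kvec R m m) (F : mindex m m -> R) : \sum_I a I * F I = top_coord a * F full_index.
Proof.
rewrite (bigD1 full_index)//= big1 ?addr0// => I; by rewrite (full_index_unique I) eqxx.
Qed.

Lemma basis_rows_full : basis_rows full_index = 1%:M :> 'M[R]_m.
Proof. by apply/matrixP => i j; rewrite !mxE /= ffunE. Qed.

Lemma lext_top (W : lmodType R) (F : 'M[R]_m -> W) (a : kvec R m m) :
  lext F a = top_coord a *: F 1%:M.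
Proof.
rewrite /lext (bigD1 full_index)//= big1 ?addr0 ?basis_rows_full// => I.
by rewrite (full_index_unique I) eqxx.
Qed.

Definition etop : kvec R m m := wedge 1%:M.

Lemma wedge_top (u : 'M[R]_m) : top_coord (wedge u) = \det u.
Proof. by rewrite /top_coord ffunE; congr (\det _); apply/matrixP => i j; rewrite !mxE /= ffunE. Qed.

Lemma kvec_top (a : kvec R m m) : a = top_coord a *: etop.
Proof.
apply/ffunP => I; rewrite (full_index_unique I) kvecZ -[etop _]/(top_coord etop).
by rewrite wedge_top det1 mulr1.
Qed.

Lemma kpush_top (L : E -> E) (a : kvec R m m) :
  top_coord (kpush L a) = top_coord a * \det (\matrix_i L (delta_mx 0 i)).
Proof.
rewrite /kpush lext_top {1}/top_coord kvecZ -/(top_coord _) wedge_top; congr (_ * \det _).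
by apply/matrixP => i j; rewrite !mxE row1.
Qed.

Fact omit_index_proof (i : 'I_m) : [forall k : 'I_n, forall l : 'I_n, (k < l)%N ==>
  ([ffun j : 'I_n => lift i j] k < [ffun j : 'I_n => lift i j] l)%N].
Proof.
apply/'forall_forallP => k l; rewrite !ffunE; apply/implyP => kl /=.
by rewrite /bump; case: (leqP i k); case: (leqP i l) => /=; lia.
Qed.

Definition omit_index i : mindex m n := Sub [ffun j => lift i j] (omit_index_proof i).

Lemma basis_rows_omit i : basis_rows (omit_index i) = row' i 1%:M :> 'M[R]_(n, m).
Proof. by apply/matrixP => k j; rewrite !mxE /= ffunE. Qed.

(** Expansion along the first row; only the column [i] has a nonzero cofactor. *)
Lemma det_omit (v : E) (i : 'I_m) :
  \det (col_mx v (row' i 1%:M) : 'M[R]_m) = (-1) ^+ i * v 0 i.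
Proof.
pose A : 'M[R]_m := col_mx v (row' i 1%:M).
have A0 j : A ord0 j = v 0 j.
  by rewrite /A mxE; case: splitP => // k _; rewrite ord1.
have AS (k : 'I_n) j : A (lift ord0 k) j = (lift i k == j)%:R.
  rewrite /A mxE; case: splitP => [k' kk|k' kk]; first by rewrite ord1 in kk.
  have -> : k' = k by apply/val_inj/eqP; rewrite -(eqn_add2l 1) -kk.
  by rewrite !mxE.
rewrite -/A (expand_det_row _ ord0) (bigD1 i)//= big1 ?addr0 => [|j ji].
  rewrite A0 /cofactor add0n mulrC; congr (_ * _).
  rewrite (_ : row' _ _ = 1%:M) ?det1 ?mulr1//; apply/matrixP => k l.
  rewrite [LHS]mxE [LHS]mxE AS (inj_eq lift_inj) mxE //.
rewrite /cofactor (_ : \det _ = 0) ?mulr0//.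
have [k kE] : exists k, lift i k = j.
  by case: (unliftP i j) ji => [k ->|->]; [exists k|rewrite eqxx].
rewrite (expand_det_row _ k) big1// => l _; rewrite [X in X * _]mxE [X in X * _]mxE AS kE.
by rewrite (negbTE (neq_lift j l)) mul0r.
Qed.

(** The signs (-1)^i of the contraction and of the determinant cancel. *)
Lemma lwedge_kcontract (v : E) (i : 'I_m) (a : kvec R m m) :
  top_coord (lwedge v (kcontract (delta_mx 0 i) a)) = top_coord a * v 0 i.
Proof.
have dE j : edot (delta_mx 0 i) (row j (1%:M : 'M[R]_m)) = (j == i)%:R.
  rewrite row1 /edot mxE (bigD1 i)//= !mxE !eqxx /= mul1r big1 ?addr0 1?eq_sym//.
  by move=> l li; rewrite !mxE (negbTE li) andbF mul0r.
have -> : kcontract (delta_mx 0 i) a = (top_coord a * (-1) ^+ i) *: wedge (row' i 1%:M).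
  rewrite /kcontract lext_top -scalerA; congr (_ *: _).
  rewrite (bigD1 i)//= dE eqxx mulr1 big1 ?addr0// => j ji.
  by rewrite dE (negbTE ji) mulr0 scale0r.
rewrite /lwedge lextZ {1}/top_coord kvecZ -/(top_coord _) -basis_rows_omit.
rewrite (@lext_delta _ _ _ _ _ _ (omit_index i)); last first.
  by move=> J; rewrite wedge_basis_rows.
by rewrite basis_rows_omit wedge_top det_omit mulrA -[_ * _ * (-1) ^+ i]mulrA -expr2 sqrr_sign mulr1.
Qed.

End TopDegree.

(** * Forms defined by functions *)

Section PointwiseForms.
Context {R : realType} {n : nat} (U : set 'rV[R]_n) (k : nat).
Local Notation E := 'rV[R]_n.
Implicit Types (h : E -> kvec R n k -> R).

Lemma pointwise_form_seq h (A : dchain U k) (s : seq E) : uniq s ->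
  (forall p, h p 0 = 0) -> csupp (dval A) `<=` [set` s] ->
  pointwise_form h A = \sum_(p <- s) h p (dval A p).
Proof.
move=> us h0 As; rewrite /pointwise_form [RHS]fsbig_seq//.
rewrite (@fsbig_widen _ _ _ _ [set` s] [set: E]) // => p [_ /= ps].
have : ~ csupp (dval A) p by move=> /As.
by rewrite /csupp /= => /negP; rewrite negbK => /eqP ->.
Qed.

Lemma csupp_seq (A : dchain U k) : exists2 s : seq E, uniq s &
  csupp (dval A) = [set` s].
Proof.
have /finite_csuppP[/finite_seqP[s sE] _] := dvalP A.
exists (undup s); first exact: undup_uniq.
by rewrite sE; apply/seteqP; split => x /=; rewrite mem_undup.
Qed.

Lemma pointwise_form_scalar h : (forall p, scalar (h p)) -> scalar (@pointwise_form R n U k h).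
Proof.
move=> lh c A B; have h0 p : h p 0 = 0 by exact: lin0 (lh p).
have [s us sA] := csupp_seq A; have [s' us' sB] := csupp_seq B.
pose l := undup (s ++ s').
have As : csupp (dval A) `<=` [set` l].
  by rewrite sA => p /= ps; rewrite mem_undup mem_cat ps.
have Bs : csupp (dval B) `<=` [set` l].
  by rewrite sB => p /= ps; rewrite mem_undup mem_cat ps orbT.
have Cs : csupp (dval (c *: A + B)) `<=` [set` l].
  move=> p; rewrite /csupp /= => hp.
  have [Ap|Ap] := eqVneq (dval A p) 0; last exact: As.
  have [Bp|Bp] := eqVneq (dval B p) 0; last exact: Bs.
  by move: hp; rewrite !fctE Ap Bp scaler0 addr0 eqxx.
rewrite !(pointwise_form_seq _ h0 (s := l)) ?undup_uniq//.
rewrite /GRing.scale /= mulr_sumr -big_split /=; apply: eq_bigr => p _.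
exact: lh.
Qed.

Lemma pointwise_form_pelem h p a : (forall p, h p 0 = 0) -> U p ->
  pointwise_form h (pelem U p a) = h p a.
Proof.
move=> h0 Up; rewrite (@pointwise_form_seq h _ [:: p])//.
  by rewrite big_seq1 pelemK// /kelt eqxx.
by rewrite pelemK// => q /csupp_kelt -> /=; rewrite inE.
Qed.

Fixpoint fdiff (s : seq E) (f : E -> R) (p : E) : R :=
  if s is u :: s' then fdiff s' f (p + u) - fdiff s' f p else f p.

Lemma zonotope_in_ends (D : set E) u s p : zonotope_in D (u :: s) p -> zonotope_in D s p /\ zonotope_in D s (p + u).
Proof.
move=> /= h; split; first by have := h 0; rewrite scale0r addr0 lexx ler01; exact.
by have := h 1; rewrite scale1r lexx ler01; exact.
Qed.

Lemma scalar_Delta (w : dchain U k -> R) s p a : scalar w -> zonotope_in U s p ->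
  w (to_dchain U (Delta s p a)) = fdiff s (fun q => w (pelem U q a)) p.
Proof.
move=> lw; elim: s p => [//|u s IH] p zp; have [z1 z2] := zonotope_in_ends zp.
have D1 := Delta_dirac (zonotope_in_inside (a := a) z1); have D2 := Delta_dirac (zonotope_in_inside (a := a) z2).
rewrite Delta_cons (to_dchainB D2 D1) /= -(IH _ z1) -(IH _ z2).
exact: scalarB.
Qed.

Lemma eq_fdiff (D : set E) s f g p : (forall q, D q -> f q = g q) -> zonotope_in D s p ->
  fdiff s f p = fdiff s g p.
Proof.
move=> fg; elim: s p => [|u s IH] p; first exact: fg.
by move=> /zonotope_in_ends[z1 z2] /=; rewrite !IH.
Qed.

End PointwiseForms.

Section BoundedFunctions.
Context {R : realType} {n : nat} {P : Type} (X : set P) (D : set 'rV[R]_n).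
Local Notation E := 'rV[R]_n.

Definition uniformly_bounded (G : P -> E -> R) : Prop :=
  exists2 B, 0 <= B & forall x p, X x -> D p -> `|G x p| <= B.

Lemma uniformly_bounded_adequate : adequate X D uniformly_bounded.
Proof.
split=> [G H GH [B B0 h]|G H [B B0 h] [B' B'0 h']|G H [B B0 h] [B' B'0 h']|c].
- by exists B => // x p Xx Dp; rewrite -GH//; exact: h.
- exists (B + B'); first exact: addr_ge0.
  by move=> x p Xx Dp; apply: le_trans (ler_normD _ _) _; apply: lerD; [exact: h|exact: h'].
- exists (B * B'); first exact: mulr_ge0.
  by move=> x p Xx Dp; rewrite normrM ler_pM//; [exact: h|exact: h'].
- by exists `|c|.
Qed.

Lemma differentiable_shift (f : E -> R) u p : differentiable f (p + u) ->
  differentiable (fun q => f (q + u)) p /\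
  forall v, 'D_v (fun q => f (q + u)) p = 'D_v f (p + u).
Proof.
move=> df; split.
  exact: (@differentiable_comp _ _ _ _ (fun q => q + u) f).
move=> v.
have e : (fun h : R => h^-1 *: (((fun q => f (q + u)) \o shift p) (h *: v) - f (p + u))) =
    (fun h : R => h^-1 *: ((f \o shift (p + u)) (h *: v) - f (p + u))).
  by apply/funext => h /=; rewrite addrA.
exact: (congr1 (fun F : R -> R => lim (F h @[h --> (0 : R)^'])) e).
Qed.

Lemma fdiff_differentiable s (f : E -> R) p : (forall q, D q -> differentiable f q) ->
  zonotope_in D s p -> differentiable (fdiff s f) p /\
  forall v, 'D_v (fdiff s f) p = fdiff s (fun q => 'D_v f q) p.
Proof.
move=> df; elim: s p => [|u s IH] p; first by split => //; exact: df.
move=> /zonotope_in_ends[z1 z2]; have [d1 e1] := IH p z1; have [d2 e2] := IH _ z2.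
have [d3 e3] := differentiable_shift d2.
split; first exact: differentiableB.
move=> v; rewrite [LHS]deriveB; [|exact: diff_derivable..].
by rewrite e3 e2 e1.
Qed.

(** The mean value theorem in each of the directions of the difference. *)
Lemma nice_fdiff r G : nice X D uniformly_bounded r G -> exists2 B, 0 <= B &
  forall x s p, X x -> (size s <= r)%N -> zonotope_in D s p -> `|fdiff s (G x) p| <= B * snorm s.
Proof.
elim: r G => [|r IH] G nG.
  have [B B0 h] := nice_base nG; exists B => // x [|//] p Xx _ Dp.
  by rewrite snorm_nil mulr1; exact: h.
have [B0 B00 h0] := nice_base nG; have [_ [dG nG1]] := nG.
have := fun i => IH _ (nG1 i); move=> /(_ _)/cid2 hB.
pose b i := projT1 (hB i).
have b0 i : 0 <= b i by rewrite /b; case: (hB i).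
have bP i x s p : X x -> (size s <= r)%N -> zonotope_in D s p ->
    `|fdiff s (fun q => 'D_(delta_mx 0 i) (G x) q) p| <= b i * snorm s.
  by rewrite /b; case: (hB i) => B ? /=; apply.
pose M := \sum_i b i; have M0 : 0 <= M by apply: sumr_ge0.
exists (B0 + M * n%:R); first by rewrite addr_ge0// mulr_ge0.
move=> x [|u s] p Xx; first by rewrite snorm_nil mulr1 => _ /(h0 x _ Xx)/le_trans; apply; rewrite lerDl mulr_ge0.
move=> /= sr zp.
apply: le_trans (mvt_bound (M := M * snorm s) _ _) _ => [t t01|t t01 i|].
- by have [] := fdiff_differentiable (fun q Dq => dG x q Xx Dq) (zp t t01).
- have [_ ->] := fdiff_differentiable (fun q Dq => dG x q Xx Dq) (zp t t01).
  apply: le_trans (bP i x s _ Xx sr (zp t t01)) _; rewrite ler_wpM2r ?snorm_ge0//.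
  by rewrite /M (bigD1 i)//= lerDl; apply: sumr_ge0.
rewrite snorm_cons [X in _ <= X]mulrDl -mulrA.
apply: (@le_trans _ _ (M * (snorm s * (n%:R * enorm u)))).
  rewrite !ler_wpM2l ?snorm_ge0//.
  apply: le_trans (ler_sum _ (fun i _ => norm_le_enorm u i)) _.
  by rewrite sumr_const card_ord mulr_natl.
rewrite (_ : M * (_ * _) = M * n%:R * (enorm u * snorm s)); last by ring.
by rewrite lerDr !mulr_ge0 ?enorm_ge0 ?snorm_ge0.
Qed.

End BoundedFunctions.

Lemma pointwise_form_bnd {R : realType} {n : nat} (U : set 'rV[R]_n) k {P : Type} (X : set P)
    (F : mindex n k -> P -> 'rV[R]_n -> R) r : (forall I, nice X U (uniformly_bounded X U) r (F I)) ->
  exists2 B, 0 <= B & forall x, X x ->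
    bnd r B (@pointwise_form R n U k (fun p a => \sum_I a I * F I x p)).
Proof.
move=> /(_ _)/nice_fdiff/cid2 hB.
pose b i := projT1 (hB i).
have b0 i : 0 <= b i by rewrite /b; case: (hB i).
have bP I x s p : X x -> (size s <= r)%N -> zonotope_in U s p -> `|fdiff s (F I x) p| <= b I * snorm s.
  by rewrite /b; case: (hB I) => B ? /=; apply.
have M0 : 0 <= \sum_I b I by apply: sumr_ge0.
exists (\sum_I b I) => // x Xx.
have lh p : scalar (fun a : kvec R n k => \sum_I a I * F I x p).
  move=> c a b'; rewrite /GRing.scale /= mulr_sumr -big_split /=; apply: eq_bigr => I _.
  by rewrite !ffunE mulrDl mulrA.
have lw := pointwise_form_scalar (U := U) lh.
apply: bnd_zonotope_in => // s p a sr zp; rewrite (scalar_Delta _ lw zp).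
have -> : fdiff s (fun q => pointwise_form (fun p a => \sum_I a I * F I x p) (pelem U q a)) p =
    \sum_I a I * fdiff s (F I x) p.
  rewrite (@eq_fdiff _ _ U s _ (fun q => \sum_I a I * F I x q) p)//; last first.
    by move=> q Uq; rewrite pointwise_form_pelem// => ?; exact: lin0 (lh _).
  elim: (s) p {zp} => [//|u s' IH] p /=; rewrite !IH -sumrB.
  by apply: eq_bigr => I _; rewrite mulrBr.
apply: le_trans (ler_norm_sum _ _ _) _; rewrite mulr_suml; apply: ler_sum => I _.
rewrite normrM mulrA [X in _ <= X]mulrC; apply: ler_pM => //; [exact: coord_le_mass|exact: bP].
Qed.

(** * Functions defined by forms *)

Lemma norm_additive {R : realType} (e s0 s1 s2 x y z u : R) :
  `|s0 - (u - z)| <= e / 4 -> `|s1 - (y - z)| <= e / 4 -> `|s2 - (x - z)| <= e / 4 ->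
  `|u - y - (x - z)| <= e / 4 -> `|s0 - (s1 + s2)| <= e.
Proof.
rewrite !ler_norml => /andP[? ?] /andP[? ?] /andP[? ?] /andP[? ?].
by apply/andP; split; lra.
Qed.

Section FormFunctions.
Context {R : realType} {n : nat} (U : set 'rV[R]_n) (k : nat).
Local Notation E := 'rV[R]_n.
Hypothesis oU : open U.
Implicit Types (w : dchain U k -> R).

(** The form w o P_v, where P_v is the prederivative. *)
Definition form_slope (v : E) w (A : dchain U k) : R :=
  chain_integral (prederivative v (dirac_chain A)) w.

Lemma form_slope_scalar v w : bounded_form w -> scalar (form_slope v w).
Proof.
move=> bw c A B; have [lT _ _] := @prederivativeP R n U oU v k.
by rewrite /form_slope dirac_chain_linear lT chain_integral_linear.
Qed.

(** A difference quotient of a difference chain of order r is one of order r+1. *)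
Lemma form_slope_bnd v w r M : bounded_form w -> 0 <= M -> bnd r.+1 M w ->
  bnd r (enorm v * M) (form_slope v w).
Proof.
move=> bw M0 hM; apply: bnd_zonotope_in; [exact: form_slope_scalar|by rewrite mulr_ge0 ?enorm_ge0|].
move=> s p a sr zp; have ip := zonotope_in_inside (a := a) zp; have Dp := Delta_dirac ip.
have cv := @cvg_prederivative R n U oU v k w (to_dchain U (Delta s p a)) bw.
have := bcost_le_dquot oU v (bcost_le_Delta sr ip); rewrite to_dchainK// in cv => hb.
have cn : `|w (to_dchain U (dquot v t (Delta s p a)))| @[t --> (0 : R)^'] -->
  `|chain_integral (prederivative v (dirac_chain (to_dchain U (Delta s p a)))) w|.
  exact: cvg_norm cv.
apply: (cvgr_to_le cn); apply: filterS hb => t hb.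
have lw := bounded_scalar bw.
have Dt := bcost_le_dirac hb.
have := @bnd_bcost_le _ _ _ _ _ _ _ (to_dchain U (dquot v t (Delta s p a))) _ lw M0 hM.
rewrite to_dchainK// => /(_ _ hb) /le_trans; apply.
by rewrite mulrCA mulrA.
Qed.

Lemma form_slope_bounded v w : bounded_form w -> bounded_form (form_slope v w).
Proof.
move=> bw; apply/bounded_formP; split; first exact: form_slope_scalar.
move=> r; have [_ /(_ r.+1)[M M0 hM]] := (bounded_formP w).1 bw.
exists (enorm v * M); [by rewrite mulr_ge0 ?enorm_ge0|exact: form_slope_bnd].
Qed.

Lemma enorm_le (u : E) : enorm u <= n%:R * `|u|.
Proof.
rewrite -[X in _ <= X]ger0_norm ?mulr_ge0// -sqrtr_sqr ler_wsqrtr// enorm_sqr.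
rewrite exprMn; apply: (@le_trans _ _ (n%:R * `|u| ^+ 2)).
  have -> : n%:R * `|u| ^+ 2 = \sum_(i < n) `|u| ^+ 2 by rewrite sumr_const card_ord mulr_natl.
  apply: ler_sum => i _.
  by rewrite -real_normK ?num_real// lerXn2r ?nnegrE// coord_norm.
by rewrite ler_wpM2r ?sqr_ge0// -natrX ler_nat; case: (n) => // l; rewrite -mulnn leq_pmulr.
Qed.

Section AtPoint.
Variables (w : dchain U k -> R) (p : E) (a : kvec R n k).
Hypotheses (bw : bounded_form w) (Up : U p).
Let lw : scalar w := bounded_scalar bw.
Let f q := w (pelem U q a).
Let S v := form_slope v w (pelem U p a).

Let slope_lim v e : 0 < e -> exists2 d, 0 < d & forall t, t != 0 -> `|t| < d ->
  U (p + t *: v) /\ `|S v - t^-1 * (f (p + t *: v) - f p)| <= e.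
Proof.
move=> e0; have [d1 d10 hU] := @zonotope_in_ray R n U oU [::] p v Up.
have /cvgrPdist_le/(_ e e0)[d2 /= d20 h2] := @cvg_prederivative R n U oU v k w (pelem U p a) bw.
exists (Num.min d1 d2); first by rewrite lt_min d10.
move=> t t0; rewrite lt_min => /andP[td1 td2]; have Upt : U (p + t *: v) := hU t td1; split => //.
have := h2 t; rewrite /= sub0r normrN => /(_ td2 t0); congr (`| _ - _ | <= _).
have h3 := kelt_dirac a Up; have h4 := kelt_dirac a Upt.
rewrite pelemK// /dquot translate_kelt (to_dchainZ _ (rpredB h4 h3)).
by rewrite (to_dchainB h4 h3) (scalarZ _ _ lw) (scalarB _ _ lw).
Qed.

Let slope0 : S 0 = 0.
Proof.
apply/eqP; rewrite -normr_le0; apply/ler_addgt0Pl => e e0; rewrite addr0.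
have [d d0 h] := slope_lim 0 e0; have d2 : 0 < d / 2 by rewrite divr_gt0.
have [||_] := h (d / 2); rewrite ?gt_eqF//.
  by rewrite gtr0_norm// gtr_pMr// invf_lt1// ltr1n.
by rewrite scaler0 addr0 subrr mulr0 subr0.
Qed.

Let slopeZ c v : S (c *: v) = c * S v.
Proof.
have [->|c0] := eqVneq c 0; first by rewrite scale0r mul0r slope0.
have nc : 0 < `|c| by rewrite normr_gt0.
apply/eqP; rewrite -subr_eq0 -normr_le0; apply/ler_addgt0Pl => e e0; rewrite addr0.
have e2 : 0 < e / 2 by rewrite divr_gt0.
have [d d0 h] := slope_lim (c *: v) e2.
have e3 : 0 < e / 2 / `|c| by rewrite divr_gt0.
have [d' d'0 h'] := slope_lim v e3.
pose t := Num.min (d / 2) (d' / 2 / `|c|).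
have t0 : 0 < t by rewrite lt_min !divr_gt0.
have td : `|t| < d.
  rewrite gtr0_norm//; apply: (@le_lt_trans _ _ (d / 2)); first by rewrite /t ge_min lexx.
  by rewrite gtr_pMr// invf_lt1// ltr1n.
have td' : `|t * c| < d'.
  rewrite normrM (gtr0_norm t0) -ltr_pdivlMr//.
  apply: (@le_lt_trans _ _ (d' / 2 / `|c|)); first by rewrite /t ge_min lexx orbT.
  by rewrite ltr_pM2r ?invr_gt0// gtr_pMr// invf_lt1// ltr1n.
have [|_ h1] := h t _ td; first by rewrite gt_eqF.
have [|_ h2] := h' (t * c) _ td'; first by rewrite mulf_neq0// gt_eqF.
rewrite -(@ler_pM2l _ `|c|)// mulrCA divff ?gt_eqF// mulr1 distrC -normrM in h2.
rewrite scalerA in h1.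
have -> : S (c *: v) - c * S v = (S (c *: v) - t^-1 * (f (p + (t * c) *: v) - f p)) +
   c * ((t * c)^-1 * (f (p + (t * c) *: v) - f p) - S v).
  have tn0 : t != 0 by rewrite gt_eqF.
  move: (S _) (S v) (f _ - f p) => x y z.
  by field; rewrite c0 tn0.
by rewrite [e]splitr; apply: le_trans (ler_normD _ _) _; exact: lerD.
Qed.

Let ballU : exists2 d, 0 < d & forall v, `|v| < d -> U (p + v).
Proof.
have : nbhs p U by exact: open_nbhs_nbhs.
move=> /nbhs_ballP[d /= d0 hd]; exists d => // v vd; apply: hd.
by rewrite -ball_normE /= opprD addrA subrr sub0r normrN.
Qed.

Let slopeD v v' : S (v + v') = S v + S v'.
Proof.
apply/eqP; rewrite -subr_eq0 -normr_le0; apply/ler_addgt0Pl => e e0; rewrite addr0.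
have e4 : 0 < e / 4 by rewrite divr_gt0.
have [d1 d10 h1] := slope_lim (v + v') e4.
have [d2 d20 h2] := slope_lim v e4.
have [d3 d30 h3] := slope_lim v' e4.
have [d4 d40 hU] := ballU.
have [_ /(_ 2%N)[M M0 hM]] := (bounded_formP w).1 bw.
pose B := M * (enorm v * enorm v' * mass a) + 1.
have B0 : 0 < B by rewrite ltr_wpDl// !mulr_ge0 ?enorm_ge0 ?mass_ge0.
pose V := `|v| + `|v'| + 1; have V0 : 0 < V by rewrite ltr_wpDl// addr_ge0.
pose m := Num.min (Num.min d1 d2) (Num.min d3 (Num.min (d4 / V) (e / 4 / B))).
have m0 : 0 < m by rewrite !lt_min d10 d20 d30 !divr_gt0.
have [t t0] : exists2 t, 0 < t & `|t| < m.
  exists (m / 2); first by rewrite divr_gt0.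
  by rewrite gtr0_norm ?divr_gt0// gtr_pMr// invf_lt1// ltr1n.
rewrite !lt_min => /andP[/andP[td1 td2] /andP[td3 /andP[td4 td5]]].
have tn0 : t != 0 by rewrite gt_eqF.
have [_ {}h1] := h1 t tn0 td1; have [_ {}h2] := h2 t tn0 td2; have [_ {}h3] := h3 t tn0 td3.
have zp : zonotope_in U [:: t *: v; t *: v'] p.
  move=> l /= l01 l' l01'; rewrite -addrA; apply: hU.
  apply: le_lt_trans (ler_normD _ _) _; rewrite !normrZ.
  case/andP: l01 => l0 l1; case/andP: l01' => l0' l1'.
  rewrite (ger0_norm l0) (ger0_norm l0'); apply: (@le_lt_trans _ _ (`|t| * `|v| + `|t| * `|v'|)).
    by apply: lerD; apply: ler_piMl => //; rewrite mulr_ge0.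
  rewrite -mulrDr; rewrite ltr_pdivlMr// in td4; apply: le_lt_trans td4.
  by rewrite ler_wpM2l// lerDl.
have := hM [:: t *: v; t *: v'] p a isT (zonotope_in_inside zp).
rewrite (scalar_Delta _ lw zp) /= -/(f _) !snorm_cons snorm_nil !enormZ => h4.
have {}h4 : `|t^-1 * (f (p + t *: v + t *: v') - f (p + t *: v) - (f (p + t *: v') - f p))| <= e / 4.
  rewrite normrM gtr0_norm ?invr_gt0// ler_pdivrMl//; apply: le_trans h4 _.
  rewrite ltr_pdivlMr// (gtr0_norm t0) in td5.
  rewrite (gtr0_norm t0); move: td5; rewrite /B.
  have := ltW t0; have : 0 <= M * (enorm v * enorm v' * mass a).
    by rewrite !mulr_ge0 ?enorm_ge0 ?mass_ge0.
  rewrite (_ : M * (t * enorm v * (t * enorm v' * 1) * mass a) =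
     t * (t * (M * (enorm v * enorm v' * mass a)))); last by ring.
  move=> x0 y0 h; apply: ler_wpM2l => //; lra.
rewrite scalerDr addrA in h1.
rewrite !mulrBr in h1 h2 h3 h4; exact: norm_additive h1 h2 h3 h4.
Qed.

Let slope_quad : exists C d, 0 < d /\ forall v, `|v| < d ->
  `|f (p + v) - f p - S v| <= C * `|v| ^+ 2.
Proof.
have [d d0 hU] := ballU; have [_ /(_ 2%N)[M M0 hM]] := (bounded_formP w).1 bw.
exists (M * (n%:R ^+ 2 * mass a + 1)), d; split => // v vd.
have [->|v0] := eqVneq v 0; first by rewrite slope0 addr0 !subrr !normr0 expr0n mulr0.
pose N := `|v|; have N0 : 0 < N by rewrite normr_gt0.
pose v' := N^-1 *: v; have v'1 : `|v'| = 1.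
  by rewrite normrZ gtr0_norm ?invr_gt0// mulVf// gt_eqF.
have vE : v = N *: v' by rewrite scalerA divff ?scale1r// gt_eqF.
have hl l : 0 <= l <= N -> U (p + l *: v').
  case/andP=> l0 lN; apply: hU; rewrite normrZ v'1 mulr1 ger0_norm//.
  exact: le_lt_trans vd.
set C := M * _; have h : `|S v' - N^-1 * (f (p + v) - f p)| <= C * N.
  apply/ler_addgt0Pl => e e0; have [d1 d10 h1] := slope_lim v' e0.
  pose t := Num.min (d1 / 2) N; have t0 : 0 < t by rewrite lt_min divr_gt0.
  have tN : t <= N by rewrite /t ge_min lexx orbT.
  have td : `|t| < d1.
    rewrite gtr0_norm//; apply: (@le_lt_trans _ _ (d1 / 2)); first by rewrite /t ge_min lexx.
    by rewrite gtr_pMr// invf_lt1// ltr1n.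
  have [|Ut {}h1] := h1 t _ td; first by rewrite gt_eqF.
  have h2 := bcost_le_dquot_segment a hl t0 tN.
  have h2' := bcost_le_dirac h2.
  have := @bnd_bcost_le _ _ _ _ _ _ _ (to_dchain U (dquot v' t (kelt p a) - dquot v' N (kelt p a))) _ lw M0 hM.
  rewrite to_dchainK// => /(_ _ h2).
  have k1 := kelt_dirac a Up; have k2 := kelt_dirac a Ut.
  have UN : U (p + N *: v') by apply: hl; rewrite lexx ltW.
  have k3 := kelt_dirac a UN.
  have D1 : dquot v' t (kelt p a) \in @dirac_pred R n U k.
    by rewrite /dquot translate_kelt; apply: rpredZ; apply: rpredB.
  have D2 : dquot v' N (kelt p a) \in @dirac_pred R n U k.
    by rewrite /dquot translate_kelt; apply: rpredZ; apply: rpredB.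
  rewrite (to_dchainB D1 D2) (scalarB _ _ lw) /dquot !translate_kelt.
  rewrite (to_dchainZ _ (rpredB k2 k1)) (to_dchainZ _ (rpredB k3 k1)).
  rewrite (to_dchainB k2 k1) (to_dchainB k3 k1) !(scalarZ _ _ lw) !(scalarB _ _ lw).
  rewrite -![w (to_dchain U (kelt _ _))]/(f _) -vE => h3.
  rewrite -[S v' - _](subrKA (t^-1 * (f (p + t *: v') - f p))).
  apply: le_trans (ler_normD _ _) _; apply: lerD => //; apply: le_trans h3 _.
  rewrite /C mulrA ler_wpM2r ?(ltW N0)// ler_wpM2l// lerD2r ler_wpM2r ?mass_ge0//.
  by rewrite lerXn2r ?nnegrE ?enorm_ge0//; have := enorm_le v'; rewrite v'1 mulr1.
have -> : f (p + v) - f p - S v = - N * (S v' - N^-1 * (f (p + v) - f p)).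
  have -> : S v = N * S v' by rewrite {1}vE slopeZ.
  by rewrite mulrBr mulrA !mulNr divff ?gt_eqF// mul1r opprK [RHS]addrC.
have nN : `|- N| = N by rewrite normrN /N normr_id.
by rewrite normrM nN -/N expr2 mulrCA ler_wpM2l// ltW.
Qed.

(** The slope is linear in [v]: additivity holds since second differences are
   quadratic. The remainder is quadratic by [bcost_le_dquot_segment], applied to the
   unit vector in direction [v] with the norm of [v] as length of the segment. *)
Lemma form_differentiable : differentiable f p /\ forall v, 'D_v f p = S v.
Proof.
have lS : linear S by move=> c u v; rewrite slopeD slopeZ.
pose sL := GRing.isLinear.Build _ _ _ _ S lS.
pose S' : {linear E -> R} := HB.pack S sL.
have [C [d [d0 h]]] := slope_quad.
have [df dE] := @differentiable_quad R _ _ f S' p C d (@linear_rV_continuous _ _ _ S') d0 h.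
by split => // v; rewrite deriveE// dE.
Qed.

End AtPoint.

(** The partial derivatives are again functions of this kind, for the forms w o
   P_(e_i), whose bounds of order r come from those of w of order r+1. *)
Lemma form_nice r a (X : set (dchain U k -> R)) B : (forall w, X w -> bounded_form w) ->
  0 <= B -> (forall w, X w -> bnd r B w) ->
  nice X U (uniformly_bounded X U) r (fun w p => w (pelem U p a)).
Proof.
have base s B' (X' : set (dchain U k -> R)) : 0 <= B' -> (forall w, X' w -> bnd s B' w) ->
    uniformly_bounded X' U (fun w p => w (pelem U p a)).
  move=> B0 hB; exists (B' * mass a); first by rewrite mulr_ge0 ?mass_ge0.
  move=> w p Xw Up; have := hB w Xw [::] p a isT (@inside_nil R n U k p a Up).
  by rewrite snorm_nil mul1r.
elim: r X B => [|r IH] X B bX B0 hB; first by split => //; exact: base hB.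
split; first exact: base hB.
split=> [w p Xw Up|i]; first by have [] := form_differentiable a (bX w Xw) Up.
pose Y := [set form_slope (delta_mx 0 i) w | w in X].
have nY : nice Y U (uniformly_bounded Y U) r (fun w p => w (pelem U p a)).
  apply: (IH Y (enorm (delta_mx 0 i : E) * B)) => [_ [w Xw <-]||_ [w Xw <-]].
  - by apply: form_slope_bounded; exact: bX.
  - by rewrite mulr_ge0 ?enorm_ge0.
  - by apply: form_slope_bnd => //; [exact: bX|exact: hB].
apply: nice_congr (@nice_reparam _ _ _ _ Y X U U (uniformly_bounded Y U) (uniformly_bounded X U)
  (form_slope (delta_mx 0 i)) _ _ _ _ _ nY) => //.
- by move=> G H GH; have [h _ _ _] := uniformly_bounded_adequate X U; exact: h.
- by move=> w p Xw Up; have [_ ->] := form_differentiable a (bX w Xw) Up.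
- by move=> w Xw; exists w.
- move=> G [B' B'0 h]; exists B' => // w p Xw Up; apply: h => //; by exists w.
Qed.

End FormFunctions.

(** * The boundary formula *)

Lemma real_cvg_unique {R : realType} {T : Type} (F : set_system T) {FF : ProperFilter F}
    (f : T -> R) (a b : R) : f x @[x --> F] --> a -> f x @[x --> F] --> b -> a = b.
Proof. by move=> fa fb; rewrite -(cvg_lim (@Rhausdorff R) fa); exact: cvg_lim fb. Qed.

Section BoundaryFormula.
Context {R : realType} {n : nat} (U : set 'rV[R]_n.+1) (V : 'rV[R]_n.+1 -> 'rV[R]_n.+1).
Local Notation m := n.+1.
Local Notation E := 'rV[R]_m.
Hypotheses (oU : open U) (hV : bounded_smooth_field U V).
Implicit Types (w : dchain U m -> R).

Definition density w (p : E) : R := w (pelem U p etop).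

Lemma form_top w p a : scalar w -> w (pelem U p a) = top_coord a * density w p.
Proof.
move=> lw; rewrite {1}[a]kvec_top (linZ (@pelem_linear R m U m p)).
exact: scalarZ.
Qed.

Lemma field_uniformly_bounded {P : Type} (X : set P) k s j :
  nice X U (uniformly_bounded X U) k (fun _ y => pderivs s V y 0 j).
Proof.
have b s' : uniformly_bounded X U (fun _ y => pderivs s' V y 0 j).
  have [B [B0 hB]] := field_bound hV s'; exists B => // x y _ Uy.
  exact: le_trans (coord_norm _ _) (hB y Uy).
elim: k s => [|k IH] s; split => //.
split=> [t y _ Uy|i]; first by have [hs _] := hV; have [] := diff_coord j (hs s y Uy).
apply: nice_congr (IH (i :: s)) => //.
  by move=> G H GH; have [h _ _ _] := uniformly_bounded_adequate X U; exact: h.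
by move=> t y _ Uy; rewrite (pderiv_coord hV).
Qed.

Lemma density_nice w k : bounded_form w ->
  nice [set w] U (uniformly_bounded [set w] U) k (fun w p => density w p).
Proof.
move=> bw; have [_ /(_ k)[B B0 hB]] := (bounded_formP w).1 bw.
by apply: (form_nice oU etop (B := B)) => // _ ->.
Qed.

Definition flux w i (p : E) : R := density w p * V p 0 i.

Definition divergence w (p : E) : R := \sum_i 'D_(delta_mx 0 i) (flux w i) p.

(** The exterior derivative of i_V w. *)
Definition div_form w : dchain U m -> R := pointwise_form (fun p a => top_coord a * divergence w p).

Lemma flux_nice w k i : bounded_form w ->
  nice [set w] U (uniformly_bounded [set w] U) k (fun w p => flux w i p).
Proof.
move=> bw; apply: niceM => //; [exact: uniformly_bounded_adequate|exact: density_nice|].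
exact: (field_uniformly_bounded [set w] k [::] i).
Qed.

Lemma flux_differentiable w i p : bounded_form w -> U p -> differentiable (flux w i) p.
Proof. by move=> bw Up; have [_ [h _]] := flux_nice 1 i bw; apply: h. Qed.

Lemma top_bounded (F : E -> R) {P : Type} (x : P) (G : P -> E -> R) :
  (forall k, nice [set x] U (uniformly_bounded [set x] U) k G) -> G x = F ->
  bounded_form (@pointwise_form R m U m (fun p a => top_coord a * F p)).
Proof.
move=> nG GF; apply/bounded_formP; split.
  by apply: pointwise_form_scalar => p; exact: top_coord_scalar.
move=> r; have [B B0 hB] := @pointwise_form_bnd R m U m P [set x] (fun _ => G) r (fun _ => nG r).
exists B => //; have := hB x erefl; congr (bnd _ _ _).
congr pointwise_form; apply/funext => p; apply/funext => a.
by rewrite top_coordE GF.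
Qed.

Lemma div_form_bounded w : bounded_form w -> bounded_form (div_form w).
Proof.
move=> bw; apply: (@top_bounded (divergence w) _ w (fun w p => divergence w p)) => // k.
apply: nice_sum => //; first exact: uniformly_bounded_adequate.
by move=> i; have [_ [_]] := flux_nice k.+1 i bw; apply.
Qed.

Lemma density_div w p : U p -> density (div_form w) p = divergence w p.
Proof.
move=> Up; rewrite /density /div_form pointwise_form_pelem// ?wedge_top ?det1 ?mul1r//.
by move=> q; rewrite top_coord0 mul0r.
Qed.

(** The cofactors of the first row of the determinant do not involve [v], so that
   the densities of i_V w are linear in the components of [V]. *)
Lemma top_coord_lwedge v (b : kvec R m n) :
  top_coord (lwedge v b) = \sum_I b I * \sum_j v 0 j *
    cofactor (col_mx (0 : E) (basis_rows I) : 'M[R]_m) ord0 j.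
Proof.
rewrite /lwedge /lext {1}/top_coord sum_ffunE; apply: eq_bigr => I _.
rewrite kvecZ -/(top_coord _) wedge_top; congr (_ * _).
rewrite (expand_det_row _ ord0); apply: eq_bigr => j _; congr (_ * _).
  by rewrite mxE; case: splitP => // l _; rewrite ord1.
rewrite /cofactor; congr (_ * \det _); apply/matrixP => x y; rewrite 4!mxE [RHS]mxE [RHS]mxE.
by case: splitP => // l /= lx; rewrite ord1 in lx.
Qed.

Lemma interior_productE w : scalar w -> interior_product V w =
  @pointwise_form R m U n (fun p b => \sum_I b I *
    (density w p * \sum_j V p 0 j * cofactor (col_mx (0 : E) (basis_rows I) : 'M[R]_m) ord0 j)).
Proof.
move=> lw; rewrite /interior_product; congr pointwise_form.
apply/funext => p; apply/funext => b; rewrite (form_top _ _ lw) top_coord_lwedge mulr_suml.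
by apply: eq_bigr => I _; rewrite -mulrA [X in _ * X]mulrC.
Qed.

Lemma interior_product_bounded w : bounded_form w -> bounded_form (interior_product V w).
Proof.
move=> bw; have lw := bounded_scalar bw.
rewrite (interior_productE lw); apply/bounded_formP; split.
  apply: pointwise_form_scalar => p c a b; rewrite /GRing.scale /= mulr_sumr -big_split /=.
  by apply: eq_bigr => I _; rewrite !ffunE mulrDl -mulrA.
move=> r; have aq := uniformly_bounded_adequate [set w] U.
have [|B B0 hB] := @pointwise_form_bnd R m U n _ [set w] (fun I w p => density w p *
    \sum_j V p 0 j * cofactor (col_mx (0 : E) (basis_rows I) : 'M[R]_m) ord0 j) r.
  move=> I; apply: (niceM oU aq); first exact: density_nice.
  apply: (nice_sum oU aq) => j; apply: (niceM oU aq); last exact: nice_cst.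
  exact: (field_uniformly_bounded [set w] r [::] j).
by exists B => //; exact: hB.
Qed.

Lemma interior_product_pelem w p b : scalar w -> U p ->
  interior_product V w (pelem U p b) = top_coord (lwedge (V p) b) * density w p.
Proof.
move=> lw Up; rewrite /interior_product pointwise_form_pelem//; first exact: form_top.
move=> q; rewrite /lwedge (lin0 (lext_linear _)) (lin0 (@pelem_linear R m U m q)).
exact: scalar0.
Qed.

(** On a k-element the i-th summand of the boundary is the derivative of the i-th
   component of f V, by [lwedge_kcontract]. *)
Lemma boundary_pelem w p a : bounded_form w -> U p ->
  chain_integral (boundary (dirac_chain (pelem U p a))) (interior_product V w) =
  top_coord a * divergence w p.
Proof.
move=> bw Up; have lw := bounded_scalar bw; have bi := interior_product_bounded bw.
have li := bounded_scalar bi; have lc := chain_integral_linear bi.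
rewrite /boundary (lin_sum lc) mulr_sumr; apply: eq_bigr => i _.
have [_ _ hR] := retractionP U (delta_mx 0 i : E) n; rewrite hR//.
set b := kcontract _ a.
have cv := @cvg_prederivative R m U oU (delta_mx 0 i) n _ (pelem U p b) bi.
pose q t := t^-1 * (flux w i (p + t *: delta_mx 0 i) - flux w i p).
have cq : q t @[t --> (0 : R)^'] --> 'D_(delta_mx 0 i) (flux w i) p.
  have hd : derivable (flux w i) p (delta_mx 0 i).
    exact: diff_derivable (flux_differentiable i bw Up).
  apply: cvg_trans hd; apply: near_eq_cvg; near=> t.
  by rewrite /q /= [p + _]addrC.
have cq' : top_coord a * q t @[t --> (0 : R)^'] --> top_coord a * 'D_(delta_mx 0 i) (flux w i) p.
  by apply: cvgM => //; exact: cvg_cst.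
apply: (real_cvg_unique cv); apply: cvg_trans cq'; apply: near_eq_cvg.
have := near_ray oU (delta_mx 0 i : E) Up; apply: filterS => t Upt.
have h3 := kelt_dirac b Up; have h4 := kelt_dirac b Upt.
rewrite pelemK// /dquot translate_kelt (to_dchainZ _ (rpredB h4 h3)).
rewrite (to_dchainB h4 h3) (scalarZ _ _ li) (scalarB _ _ li).
rewrite -![to_dchain U (kelt _ _)]/(pelem U _ _) !interior_product_pelem// !lwedge_kcontract.
rewrite /q /flux; ring.
Unshelve. all: by end_near. Qed.

(** Stokes' theorem for i_V w. Both sides are linear and continuous in [J], agree on
   k-elements by [boundary_pelem], and Dirac chains are dense. *)
Lemma boundary_formula w (J : chain U m) : bounded_form w ->
  chain_integral (boundary J) (interior_product V w) = chain_integral J (div_form w).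
Proof.
move=> bw; have bi := interior_product_bounded bw; have bd := div_form_bounded bw.
have li := chain_integral_linear bi; have ld := chain_integral_linear bd.
have lb : linear (@boundary R m U n).
  move=> c A B; rewrite /boundary scaler_sumr -big_split /=; apply: eq_bigr => i _.
  have [lP _ _] := @prederivativeP R m U oU (delta_mx 0 i) n.
  have [lR _ _] := retractionP U (delta_mx 0 i : E) n.
  by rewrite lR lP.
have cb : continuous (fun J : chain U m => chain_integral (boundary J) (interior_product V w)).
  move=> K; rewrite /boundary.
  have -> : (fun J : chain U m => chain_integral (\sum_i prederivative (delta_mx 0 i) (retraction (delta_mx 0 i) J))
      (interior_product V w)) = (fun J => \sum_i chain_integral (prederivative (delta_mx 0 i)
      (retraction (delta_mx 0 i) J)) (interior_product V w)).
    by apply/funext => J'; rewrite (lin_sum li).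
  rewrite /continuous_at; apply: (@cvg_sumf _ _ _ _ _ (nbhs_filter K)) => i.
  have [_ cP _] := @prederivativeP R m U oU (delta_mx 0 i) n.
  have [_ cR _] := retractionP U (delta_mx 0 i : E) n.
  have h := @continuous_comp _ _ _ (@retraction R m U (delta_mx 0 i) n)
    (@prederivative R m U (delta_mx 0 i) n) K (cR K) (cP _).
  exact: (@continuous_comp _ _ _ _ (fun J => chain_integral J (interior_product V w))
    K h (@chain_integral_continuous R m U n _ bi _)).
have dirac (A : dchain U m) : chain_integral (boundary (dirac_chain A)) (interior_product V w) =
    chain_integral (dirac_chain A) (div_form w).
  have [x Ax] := dchain_bcost_le 0 A.
  rewrite -(to_dchain_val A).
  suff : forall B y, bcost_le U 0 B y -> B \in @dirac_pred R m U m /\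
      chain_integral (boundary (dirac_chain (to_dchain U B))) (interior_product V w) =
      chain_integral (dirac_chain (to_dchain U B)) (div_form w).
    by move=> /(_ _ _ Ax)[].
  apply: bcost_le_elim.
  - split; first exact: rpred0.
    by rewrite to_dchain0 (lin0 (@dirac_chain_linear R m U m)) (lin0 lb) (lin0 li) (lin0 ld).
  - move=> B C y z [hB eB] [hC eC]; split; first exact: rpredD.
    rewrite to_dchainD// (linD (@dirac_chain_linear R m U m)) (linD lb) (linD li) (linD ld).
    by rewrite eB eC.
  - by [].
  move=> [|//] p a _ Up; split; first exact: kelt_dirac.
  rewrite -[to_dchain U (Delta [::] p a)]/(pelem U p a) boundary_pelem// (chain_integral_dirac bd).
  rewrite (form_top _ _ (bounded_scalar bd)) density_div//.
elim/quotW: J => A.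
have d := @dirac_dense R m U m A.
have c1 := cvg_comp _ _ d (cb _); have c2 := cvg_comp _ _ d (@chain_integral_continuous R m U m _ bd _).
apply: (real_cvg_unique c1); apply: cvg_trans c2; apply: near_eq_cvg; near=> i.
by rewrite /= dirac.
Unshelve. all: by end_near. Qed.

End BoundaryFormula.

(** * Cutoff functions and supports *)

Section Cutoff.
Context {R : realType} {n : nat} {P : Type} (X : set P) (N : set 'rV[R]_n).
Local Notation E := 'rV[R]_n.
Hypothesis oN : open N.

Definition locally_bounded (G : P -> E -> R) : Prop := forall p0, N p0 -> exists d B, [/\ 0 < d, 0 <= B &
  forall x p, X x -> N p -> `|p - p0| < d -> `|G x p| <= B].

Lemma locally_bounded_adequate : adequate X N locally_bounded.
Proof.
split=> [G H GH lG|G H lG lH|G H lG lH|c] p0 Np0.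
- have [d [B [d0 B0 h]]] := lG p0 Np0; exists d, B; split => // x p Xx Np pd.
  by rewrite -GH//; exact: h.
- have [d [B [d0 B0 h]]] := lG p0 Np0; have [d' [B' [d0' B0' h']]] := lH p0 Np0.
  exists (Num.min d d'), (B + B'); split; [by rewrite lt_min d0|exact: addr_ge0|].
  move=> x p Xx Np; rewrite lt_min => /andP[p1 p2]; apply: le_trans (ler_normD _ _) _.
  by apply: lerD; [exact: h|exact: h'].
- have [d [B [d0 B0 h]]] := lG p0 Np0; have [d' [B' [d0' B0' h']]] := lH p0 Np0.
  exists (Num.min d d'), (B * B'); split; [by rewrite lt_min d0|exact: mulr_ge0|].
  move=> x p Xx Np; rewrite lt_min => /andP[p1 p2]; rewrite normrM.
  by apply: ler_pM => //; [exact: h|exact: h'].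
- by exists 1, `|c|.
Qed.

Variable S : set E.
Hypotheses (cS : closed S) (kS : compact S) (SN : S `<=` N).

Lemma smooth_pd (D : set E) (g : E -> R) i : smooth_on D g ->
  smooth_on D (fun x => 'D_(delta_mx 0 i) g x).
Proof.
move=> sg s x Dx; have := sg (s ++ [:: i]) x Dx.
by rewrite /pderivs foldr_cat.
Qed.

(** The local bounds are uniform on the compact set [S]. *)
Lemma cutoff_uniformly_bounded (g : E -> R) F : continuous g -> (forall x, ~ S x -> g x = 0) ->
  locally_bounded F -> uniformly_bounded X [set: E] (fun x p => g p * F x p).
Proof.
move=> cg g0 lF; have /compact_near_coveringP cov := kS.
have := cov R (pinfty_nbhs R) (fun B p => forall x, X x -> `|g p * F x p| <= B) _.
move=> h; have {h} [|M [_ hM]] := h _.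
  move=> p Sp; have [d [B [d0 B0 hF]]] := lF p (SN Sp).
  have [d' d0' hN] : exists2 d, 0 < d & forall q, `|q - p| < d -> N q.
    have : nbhs p N by apply: open_nbhs_nbhs; split => //; exact: SN.
    move=> /nbhs_ballP[e /= e0 he]; exists e => // q qe; apply: he.
    by rewrite -ball_normE /= distrC.
  have /cvgrPdist_lt/(_ 1 ltr01)/nbhs_ballP[d'' /= d0'' hg] := cg p.
  exists ([set q | `|q - p| < Num.min d (Num.min d' d'')], [set M | (`|g p| + 1) * B < M]).
    split; last by exists ((`|g p| + 1) * B); split => //; exact: num_real.
    apply/nbhs_ballP; exists (Num.min d (Num.min d' d'')).
      by rewrite /= !lt_min d0 d0' d0''.
    by move=> q; rewrite -ball_normE /= distrC.
  move=> [q M] /= []; rewrite !lt_min => /andP[q1 /andP[q2 q3]] /ltW BM x Xx.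
  apply: le_trans BM; rewrite normrM; apply: ler_pM => //; last by apply: hF => //; exact: hN.
  have := hg q; rewrite -ball_normE /= distrC => /(_ q3) h1.
  rewrite -[g q](subrKC (g p)); apply: le_trans (ler_normD _ _) _.
  by rewrite lerD2l distrC ltW.
exists (`|M| + 1); first by rewrite addr_ge0.
move=> x p Xx _; have [Sp|nSp] := pselect (S p); last by rewrite g0// mul0r normr0 addr_ge0.
by apply: hM Sp x Xx; apply: le_lt_trans (ler_norm M) _; rewrite ltrDl.
Qed.

(** By induction on the order, with the derivatives of [g] as further cutoffs.
   The product vanishes near every point outside [S], where [F] is arbitrary. *)
Lemma cutoff_nice k (g : E -> R) F : smooth_on [set: E] g -> (forall x, ~ S x -> g x = 0) ->
  nice X N locally_bounded k F -> nice X [set: E] (uniformly_bounded X [set: E]) k (fun x p => g p * F x p).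
Proof.
have oS : open (~` S) by exact: closed_openC.
have nS p : ~ S p -> \near p, ~ S p by move=> nSp; apply: open_nbhs_nbhs.
have aq := uniformly_bounded_adequate X [set: E].
elim: k g F => [|k IH] g F sg g0 nF.
  split => //; apply: (cutoff_uniformly_bounded _ g0 (nice_base nF)) => x.
  exact: differentiable_continuous (sg [::] x I).
have cg : continuous g by move=> x; exact: differentiable_continuous (sg [::] x I).
have [lF [dF nF1]] := nF; split; first exact: cutoff_uniformly_bounded.
have near0 x p : ~ S p -> \near p, 0 = g p * F x p.
  by move=> nSp; apply: filterS (nS p nSp) => q nSq; rewrite g0// mul0r.
have dg0 i x : ~ S x -> 'D_(delta_mx 0 i) g x = 0.
  move=> nSx; rewrite -(pd_cst i 0 x); apply: near_eq_derive.
  by apply: filterS (nS x nSx) => q nSq; rewrite g0.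
split=> [x p Xx _|i].
  have [Sp|nSp] := pselect (S p).
    by apply: differentiableM; [exact: (sg [::])|apply: dF => //; exact: SN].
  by apply: differentiable_near (near0 x p nSp) _; exact: differentiable_cst.
have n1 := IH _ F (smooth_pd i sg) (dg0 i) (nice_le (leqnSn k) nF).
have n2 := IH _ _ sg g0 (nF1 i).
apply: (nice_eq openT aq) (niceD openT aq n1 n2) => x p Xx _.
have [Sp|nSp] := pselect (S p).
  by rewrite pdM//; [exact: (sg [::])|apply: dF => //; exact: SN].
rewrite dg0// g0// !mul0r addr0 -[LHS](pd_cst i 0 p); apply: near_eq_derive.
exact: near0.
Qed.

End Cutoff.

Section Support.
Context {R : realType} {n k : nat}.
Local Notation E := 'rV[R]_n.

Lemma chain_integral_widen (U : set E) (J : chain U k) (w : dchain [set: E] k -> R) :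
  bounded_form w ->
  chain_integral (chain_widen J) w = chain_integral J (fun A => w (widen A)).
Proof. by move=> bw; rewrite /chain_widen chain_integral_pi. Qed.

(** [J] is a limit of Dirac chains supported in [W]. *)
Lemma accessible_eq (J : chain [set: E] k) (S W : set E) (w w' : dchain [set: E] k -> R) :
  accessible J S -> open W -> S `<=` W -> bounded_form w -> bounded_form w' ->
  (forall A, csupp (dval A) `<=` W -> w A = w' A) -> chain_integral J w = chain_integral J w'.
Proof.
move=> aJ oW SW bw bw' ww; have [A [AW cA]] := aJ W oW SW.
have c1 := cvg_comp _ _ cA (@chain_integral_continuous R n [set: E] k w bw J).
have c2 := cvg_comp _ _ cA (@chain_integral_continuous R n [set: E] k w' bw' J).
apply: (real_cvg_unique c1); apply: cvg_trans c2; apply: near_eq_cvg; near=> i.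
by rewrite /= !chain_integral_dirac// ww.
Unshelve. all: by end_near. Qed.

End Support.

(** * Derivative of a determinant *)

Section Determinant.
Context {R : realType} (T : R).
Hypothesis T0 : 0 < T.

Lemma primitive_prod (I : eqType) (r : seq I) (F G : I -> R -> R) : uniq r ->
  (forall i, primitive T (F i) (G i)) ->
  primitive T (fun t => \prod_(i <- r) F i t)
    (fun t => \sum_(i <- r) \prod_(j <- r) (if j == i then G j t else F j t)).
Proof.
move=> + h; elim: r => [_|i r IH /= /andP[ir ur]].
  by apply: primitive_eq (primitive_cst T 1) => t _; rewrite big_nil.
apply: primitive_eq (primitiveM (h i) (IH ur)) => t _; rewrite !big_cons ?eqxx//; congr (_ + _).
  rewrite big_seq [X in _ = _ * X]big_seq; congr (_ * _).
  by apply: eq_bigr => j jr; case: eqP => // ji; move: ir; rewrite -ji jr.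
rewrite mulr_sumr !big_seq; apply: eq_bigr => j jr; rewrite big_cons.
by case: eqP => // ij; move: ir; rewrite ij jr.
Qed.

(** Leibniz' formula gives the sum of the determinants with one row replaced by its
   derivative; each is expanded along that row. *)
Lemma primitive_det m (Z Z' : R -> 'M[R]_m) :
  (forall i j, primitive T (fun t => Z t i j) (fun t => Z' t i j)) ->
  primitive T (fun t => \det (Z t)) (fun t => \sum_i \sum_j Z' t i j * cofactor (Z t) i j).
Proof.
move=> h; pose Y i t : 'M[R]_m := \matrix_(k, j) if k == i then Z' t k j else Z t k j.
have -> : (fun t => \sum_i \sum_j Z' t i j * cofactor (Z t) i j) =
    (fun t => \sum_(s : 'S_m) (-1) ^+ s * \sum_i \prod_k (if k == i then Z' t k (s k) else Z t k (s k))).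
  apply/funext => t; transitivity (\sum_i \det (Y i t)).
    apply: eq_bigr => i _; rewrite (expand_det_row _ i); apply: eq_bigr => j _.
    rewrite /Y mxE eqxx; congr (_ * _); rewrite /cofactor; congr (_ * \det _).
    apply/matrixP => k l; rewrite !mxE; have [e|//] := eqVneq.
    by move: (neq_lift i k); rewrite e eqxx.
  under [LHS]eq_bigr do rewrite /determinant.
  rewrite exchange_big; apply: eq_bigr => s _; rewrite mulr_sumr; apply: eq_bigr => i _.
  by congr (_ * _); apply: eq_bigr => k _; rewrite /Y mxE.
apply: primitive_sum => s; apply: primitiveZ.
have := @primitive_prod _ (index_enum 'I_m) (fun k t => Z t k (s k)) (fun k t => Z' t k (s k))
  (index_enum_uniq _) (fun k => h k (s k)).
by [].
Qed.

(** For Z' = Z G the cofactor sum of [primitive_det] is the trace of G adj(Z) Z. *)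
Lemma liouville m (Z G : R -> 'M[R]_m) :
  (forall i j, primitive T (fun t => Z t i j) (fun t => \sum_l G t l j * Z t i l)) ->
  primitive T (fun t => \det (Z t)) (fun t => (\sum_l G t l l) * \det (Z t)).
Proof.
move=> h; pose Z' t : 'M[R]_m := \matrix_(i, j) \sum_l G t l j * Z t i l.
have dZ : primitive T (fun t => \det (Z t)) (fun t => \sum_i \sum_j Z' t i j * cofactor (Z t) i j).
  by apply: primitive_det => i j; apply: primitive_eq (h i j) => // t _; rewrite mxE.
apply: primitive_eq dZ => // t _.
  under eq_bigr => i _ do under eq_bigr => j _ do rewrite mxE mulr_suml.
  rewrite exchange_big /= mulr_suml.
  under eq_bigr => j _ do rewrite exchange_big /=.
  transitivity (\sum_j \sum_l G t l j * (\adj (Z t) *m Z t) j l).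
    apply: eq_bigr => j _; apply: eq_bigr => l _; rewrite mxE mulr_sumr.
    by apply: eq_bigr => i _; rewrite mxE -mulrA [Z t i l * _]mulrC.
  rewrite mul_adj_mx; apply: eq_bigr => j _; rewrite (bigD1 j)//= big1 ?addr0 ?mxE ?eqxx// => l lj.
  by rewrite mxE eq_sym (negbTE lj) mulr0.
Qed.

End Determinant.

(** * Transport by the flow *)

Section Transport.
Context {R : realType} {n : nat} (U : set 'rV[R]_n.+1) (V : 'rV[R]_n.+1 -> 'rV[R]_n.+1).
Context (N : set 'rV[R]_n.+1) (t0 : R) (phi : R -> 'rV[R]_n.+1 -> 'rV[R]_n.+1) (T : R).
Local Notation m := n.+1.
Local Notation E := 'rV[R]_m.
Hypotheses (oU : open U) (hV : bounded_smooth_field U V) (oN : open N).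
Hypotheses (hphi : is_flow U V N t0 phi) (T0 : 0 < T) (Tt0 : T < t0).
Implicit Types (w : dchain U m -> R).

Let flowU p t : N p -> 0 <= t <= T -> U (phi t p).
Proof.
move=> Np /andP[t1 tT]; have [_ /(_ t)] := hphi Np.
by rewrite t1 (le_lt_trans tT)// => /(_ isT)[].
Qed.

(** In the interior of the time interval the one-sided condition on the increment
   is void. *)
Lemma flow_is_derive p t : N p -> 0 < t < T -> is_derive t 1 (phi^~ p) (V (phi t p)).
Proof.
move=> Np /andP[t1 tT]; have tt0 : t < t0 by exact: lt_trans Tt0.
have [_ /(_ t)] := hphi Np; rewrite (ltW t1) tt0 => /(_ isT)[_ hd].
have cv : h^-1 *: (phi (h *: 1 + t) p - phi t p) @[h --> (0 : R)^'] --> V (phi t p).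
  move=> A /hd; rewrite /time_filter /= => hA.
  have near_in : \forall h \near (0 : R)^', 0 <= t + h < t0.
    exists (Num.min t (t0 - t)); first by rewrite /= lt_min t1 subr_gt0.
    move=> h /=; rewrite sub0r normrN lt_min => /andP[ht hT] _.
    by move: ht hT; rewrite !ltr_norml => /andP[? ?] /andP[? ?]; apply/andP; split; lra.
  apply: filterS2 near_in hA => h hin /(_ hin) /=.
  by rewrite [t + h]addrC /GRing.scale /= mulr1.
split; first by apply/cvg_ex; exists (V (phi t p)).
exact: cvg_lim cv.
Qed.

Lemma flow_comp_primitive p (f : E -> R) : N p -> (forall y, U y -> differentiable f y) ->
  (forall j y, U y -> differentiable (fun y => 'D_(delta_mx 0 j) f y) y) ->
  primitive T (fun t => f (phi t p)) (fun t => \sum_j V (phi t p) 0 j * 'D_(delta_mx 0 j) f (phi t p)).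
Proof.
move=> Np df ddf; have cc := flow_comp_continuous hphi Tt0 Np.
have [hs _] := hV; split; first exact: cc.
  apply: within_continuous_sum => j; apply: within_continuousM.
    by apply: (cc (fun y => V y 0 j)) => y Uy; have [] := diff_coord j (hs [::] y Uy).
  by apply: (cc (fun y => 'D_(delta_mx 0 j) f y)); exact: ddf.
move=> t tT; have tT' : 0 <= t <= T by case/andP: tT => *; rewrite !ltW.
have [dp pE] := flow_is_derive Np tT.
have dphi : differentiable (phi^~ p) t by apply/derivable1_diffP.
have dft := df _ (flowU Np tT').
have dc : differentiable (f \o (phi^~ p)) t by exact: differentiable_comp.
split; first by apply/derivable1_diffP.
have e := congr1 (@^~ 1) (diff_comp dphi dft).
transitivity ('D_1 (f \o (phi^~ p)) t); first by [].
rewrite (deriveE _ dc) [LHS]e [LHS]/= -(deriveE _ dphi) pE (diff_sum _ dft).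
by apply: eq_bigr => j _.
Qed.

Definition jacobian t (p : E) : R :=
  \det (\matrix_(i, j) 'D_(delta_mx 0 i) (fun q => phi t q 0 j) p : 'M[R]_m).

Lemma jacobian_primitive p : N p ->
  primitive T (fun t => jacobian t p) (fun t => (\sum_l pderivs [:: l] V (phi t p) 0 l) * jacobian t p).
Proof.
move=> Np; pose G t : 'M[R]_m := \matrix_(l, j) pderivs [:: l] V (phi t p) 0 j.
have := @liouville R T m (fun t => \matrix_(i, j) 'D_(delta_mx 0 i) (fun q => phi t q 0 j) p) G.
move=> h; apply: primitive_eq (h _) => // [t _|i j].
  by congr (_ * _); apply: eq_bigr => l _; rewrite mxE.
apply: primitive_eq (flow_jacobian_primitive oU hV oN hphi T0 Tt0 Np i j) => t _; first by rewrite mxE.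
by apply: eq_bigr => l _; rewrite !mxE.
Qed.

(** The factor tr DV from the derivative of the Jacobian and the derivative of f
   along V add up to div(f V). *)
Lemma pullback_primitive p w : N p -> bounded_form w ->
  primitive T (fun t => jacobian t p * density w (phi t p)) (fun t => jacobian t p * density (div_form V w) (phi t p)).
Proof.
move=> Np bw; have [_ [df nf]] := density_nice oU 2 bw.
have [hs _] := hV.
have := primitiveM (jacobian_primitive Np) (flow_comp_primitive Np (fun y Uy => df w y erefl Uy)
  (fun j y Uy => (proj1 (proj2 (nf j))) w y erefl Uy)).
apply: primitive_eq => // t tT; have Up := flowU Np tT.
rewrite density_div// /divergence [_ * jacobian t p]mulrC -!mulrA -mulrDr; congr (_ * _).
rewrite mulr_suml -big_split /=; apply: eq_bigr => i _.
rewrite /flux pdM; [|exact: df|by have [] := diff_coord i (hs [::] _ Up)].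
by rewrite (@pderiv_coord _ _ _ _ hV [::])// addrC [X in X + _ = _]mulrC [X in _ + X = _]mulrC.
Qed.

Section Cutoff.
Variables (g : E -> R) (K : set E).
Hypothesis hg : cutoff K N g.
Let S := closure [set x | g x != 0].
Let SN : S `<=` N. Proof. by case: hg. Qed.

Let g0 x : ~ S x -> g x = 0.
Proof.
by move=> nSx; apply/eqP/negPn/negP => gx; apply/nSx/subset_closure.
Qed.

Let T_ := [set t : R | 0 <= t <= T].

Lemma cut_pullbackE w t : scalar w -> 0 <= t <= T -> cut_pullback g (phi t) w =
  @pointwise_form R m U m (fun p a => top_coord a * (g p * (jacobian t p * density w (phi t p)))).
Proof.
move=> lw tT; congr pointwise_form; apply/funext => p; apply/funext => a.
have [Sp|nSp] := pselect (S p); last by rewrite g0// !mul0r mulr0.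
rewrite (form_top _ _ lw) kpush_top (_ : \det _ = jacobian t p).
  by rewrite -mulrA mulrCA.
have dp := flow_differentiable oU hV oN hphi T0 Tt0 (SN Sp) tT.
rewrite /jacobian; congr (\det _); apply/matrixP => i j; rewrite !mxE.
by rewrite (pd_coord i j dp) deriveE.
Qed.

(** The Jacobian is a determinant of derivatives of the flow and the density is
   composed with the flow; the cutoff makes the local bounds global. The index is a
   pair of a time and a form. *)
Lemma pullback_nice r (Y : set (dchain U m -> R)) B : (forall w, Y w -> bounded_form w) ->
  0 <= B -> (forall w, Y w -> bnd r B w) ->
  let X := [set x : R * (dchain U m -> R) | T_ x.1 /\ Y x.2] in
  nice X [set: E] (uniformly_bounded X [set: E]) r (fun x p => g p * (jacobian x.1 p * density x.2 (phi x.1 p))).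
Proof.
move=> bY B0 hB X.
have aq := locally_bounded_adequate X N; have al := locally_lipschitz_adequate T N.
have repar (G : R -> E -> R) : locally_lipschitz T N G -> locally_bounded X N (fun x => G x.1).
  move=> lG p0 Np0; have [d [C [d0 C0 h]]] := lG p0 Np0; exists d, C; split => //.
  by move=> x p [xT _] Np pd; have [] := h x.1 p p xT Np Np pd pd.
apply: (@cutoff_nice _ _ _ X N oN S) => //.
- exact: closed_closure.
- by case: hg.
- by case: hg.
apply: (niceM oN aq).
  apply: (@nice_reparam _ _ _ _ T_ X N N (locally_lipschitz T N) (locally_bounded X N) fst _ _ repar r jacobian) => //.
    by move=> x [].
  apply: (nice_det oN al) => i j.
  apply: (@nice_congr _ _ _ T_ N oN _ r (fun t p => 'D_(delta_mx 0 i) (fun q => phi t q 0 j) p)).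
  + by case: al.
  + by move=> t p _ _; rewrite mxE.
  have [_ [_]] := flow_nice oU hV oN hphi T0 Tt0 r.+1 j; exact.
apply: (@nice_comp _ _ _ _ X N U (locally_bounded X N) (uniformly_bounded X U) (fun x => phi x.1) oN aq _ _ r
  (fun x p => density x.2 p)).
- by move=> x p [xT _] Np; exact: flowU.
- move=> f [C C0 hC] p0 Np0; exists 1, C; split => // x p Xx Np _.
  by apply: hC => //; apply: flowU => //; case: Xx.
- move=> j; apply: (@nice_reparam _ _ _ _ T_ X N N (locally_lipschitz T N) (locally_bounded X N) fst _ _ repar r
    (fun t p => phi t p 0 j)) => //; first by move=> x [].
  exact: (flow_nice oU hV oN hphi T0 Tt0 r j).
have nY : nice Y U (uniformly_bounded Y U) r (fun w p => density w p) by exact: form_nice bY B0 hB.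
apply: (@nice_reparam _ _ _ _ Y X U U (uniformly_bounded Y U) (uniformly_bounded X U) snd _ _ _ _ _ nY) => //.
- by move=> x [].
- by move=> G [C C0 hC]; exists C => // x p [_ Yx] Up; exact: hC.
Qed.

Lemma nice_subset {P : Type} (X : set P) r (F : P -> E -> R) :
  nice X [set: E] (uniformly_bounded X [set: E]) r F -> nice X U (uniformly_bounded X U) r F.
Proof.
apply: (@nice_reparam _ _ _ _ X X [set: E] U _ _ id) => // G [C C0 hC].
by exists C => // x p Xx _; exact: hC.
Qed.

(** From [pullback_nice] for the family of all forms with this bound. *)
Lemma cut_pullback_bnd r B : 0 <= B -> exists2 C, 0 <= C & forall t w, 0 <= t <= T ->
  bounded_form w -> bnd r B w -> bnd r C (cut_pullback g (phi t) w).
Proof.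
move=> B0; pose Y := [set w : dchain U m -> R | bounded_form w /\ bnd r B w].
have := nice_subset (@pullback_nice r Y B (fun w => @proj1 _ _) B0 (fun w => @proj2 _ _)).
set X := [set x | _] => nP.
have [C C0 hC] := @pointwise_form_bnd R m U m _ X (fun _ => _) r (fun _ => nP).
exists C => // t w tT bw hw; rewrite (cut_pullbackE (bounded_scalar bw) tT).
have := hC (t, w) (conj tT (conj bw hw)); congr (bnd _ _ (pointwise_form _)).
by apply/funext => p; apply/funext => a; rewrite top_coordE.
Qed.

Lemma cut_pullback_bounded t w : 0 <= t <= T -> bounded_form w ->
  bounded_form (cut_pullback g (phi t) w).
Proof.
move=> tT bw; have lw := bounded_scalar bw; apply/bounded_formP; split.
  rewrite cut_pullbackE//; apply: pointwise_form_scalar => p; exact: top_coord_scalar.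
move=> r; have [_ /(_ r)[B B0 hB]] := (bounded_formP w).1 bw.
by have [C C0 hC] := cut_pullback_bnd r B0; exists C => //; exact: hC.
Qed.

(** [cut_pullback] as a form on the whole space, to be integrated over the image of
   the chain there, for which the support is defined. *)
Definition pullback_ext t w : dchain [set: E] m -> R :=
  pointwise_form (fun p a => top_coord a * (g p * (jacobian t p * density w (phi t p)))).

Lemma pullback_ext_bounded t w : 0 <= t <= T -> bounded_form w ->
  bounded_form (pullback_ext t w).
Proof.
move=> tT bw; apply/bounded_formP; split.
  by apply: pointwise_form_scalar => p; exact: top_coord_scalar.
move=> r; have [_ /(_ r)[B B0 hB]] := (bounded_formP w).1 bw.
have nP := @pullback_nice r [set w' | bounded_form w' /\ bnd r B w'] B (fun w => @proj1 _ _) B0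
  (fun w => @proj2 _ _).
have [C C0 hC] := @pointwise_form_bnd R m [set: E] m _ _ (fun _ => _) r (fun _ => nP).
exists C => //.
have := hC (t, w) (conj tT (conj bw hB)); congr (bnd _ _ (pointwise_form _)).
by apply/funext => p; apply/funext => a; rewrite top_coordE.
Qed.

Lemma cut_pullback_ext t w A : scalar w -> 0 <= t <= T ->
  cut_pullback g (phi t) w A = pullback_ext t w (widen A).
Proof. by move=> lw tT; rewrite cut_pullbackE. Qed.

(** On a Dirac chain the integral is a finite sum. *)
Lemma cut_pullback_primitive w A : bounded_form w ->
  primitive T (fun t => cut_pullback g (phi t) w A)
    (fun t => cut_pullback g (phi t) (div_form V w) A).
Proof.
move=> bw; have [s us sA] := csupp_seq A; have bd := div_form_bounded oU hV bw.
pose F w t := \sum_(p <- s) top_coord (dval A p) * (g p * (jacobian t p * density w (phi t p))).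
have FE w' t : scalar w' -> 0 <= t <= T -> F w' t = cut_pullback g (phi t) w' A.
  move=> lw tT; rewrite cut_pullbackE// (@pointwise_form_seq _ _ _ _ _ _ s)// ?sA//.
  by move=> p; rewrite top_coord0 mul0r.
apply: (@primitive_eq _ _ (F w) (F (div_form V w))) => [t tT|t tT|].
- exact: FE (bounded_scalar bw) tT.
- exact: FE (bounded_scalar bd) tT.
apply: primitive_sum => p; apply: primitiveZ.
have [Np|nNp] := pselect (N p); first by apply: primitiveZ; exact: pullback_primitive.
have gp : g p = 0 by apply: g0 => /SN.
by apply: primitive_eq (primitive_cst T 0) => t _; rewrite gp mul0r.
Qed.

(** The integrals over Dirac chains converge, with their derivatives, uniformly in
   time by [cut_pullback_bnd]. *)
Lemma integral_primitive (J : chain U m) w : bounded_form w ->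
  primitive T (fun t => chain_integral J (cut_pullback g (phi t) w))
    (fun t => chain_integral J (cut_pullback g (phi t) (div_form V w))).
Proof.
move=> bw; have bd := div_form_bounded oU hV bw.
elim/quotW: J => A.
apply: (@primitive_lim _ _ (fun i t => cut_pullback g (phi t) w (cval A i))
  (fun i t => cut_pullback g (phi t) (div_form V w) (cval A i))).
  by move=> i; exact: cut_pullback_primitive.
have conv w' : bounded_form w' -> forall e, 0 < e -> exists k, forall i, (k <= i)%N ->
    forall t, 0 <= t <= T -> `|cut_pullback g (phi t) w' (cval A i) -
      chain_integral (\pi_(chain U m)%qT A) (cut_pullback g (phi t) w')| <= e.
  move=> bw' e e0; have /asboolP[r cA] := cvalP A.
  have [_ /(_ r)[B B0 hB]] := (bounded_formP w').1 bw'.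
  have [C C0 hC] := cut_pullback_bnd r B0.
  have d0 : 0 < e / (C + 1) by rewrite divr_gt0// ltr_wpDl.
  have [k hk] := cA _ d0; exists k => i ki t tT.
  have bp := cut_pullback_bounded tT bw'.
  have cv : cut_pullback g (phi t) w' (cval A j) @[j --> \oo] -->
      chain_integral (\pi_(chain U m)%qT A) (cut_pullback g (phi t) w').
    exact: (@cvg_chain_integral _ _ _ _ _ bp A).
  have cn : `|cut_pullback g (phi t) w' (cval A i) - cut_pullback g (phi t) w' (cval A j)|
      @[j --> \oo] --> `|cut_pullback g (phi t) w' (cval A i) -
      chain_integral (\pi_(chain U m)%qT A) (cut_pullback g (phi t) w')|.
    by apply: cvg_norm; apply: cvgB => //; exact: cvg_cst.
  apply: (cvgr_to_le cn); exists k => // j kj /=.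
  rewrite -(scalarB _ _ (bounded_scalar bp)).
  have := bnd_bcost_le (bounded_scalar bp) C0 (hC t w' tT bw' hB) (bnorm_bcost_le (hk i j ki kj)).
  move/le_trans; apply; rewrite mulrA ler_pdivrMr ?ltr_wpDl//.
  by rewrite mulrC ler_pM2l// lerDl.
move=> e e0; have [k1 h1] := conv w bw e e0; have [k2 h2] := conv _ bd e e0.
exists (maxn k1 k2) => t tT; split; first by apply: h1 => //; exact: leq_maxl.
by apply: h2 => //; exact: leq_maxr.
Qed.

End Cutoff.

(** Near [K] both cutoffs are 1, and [J] is a limit of Dirac chains supported
   there. *)
Lemma cut_pullback_unique (J : chain U m) (K : set E) g1 g2 t w :
  accessible (chain_widen J) K -> cutoff K N g1 -> cutoff K N g2 -> 0 <= t <= T ->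
  bounded_form w ->
  chain_integral J (cut_pullback g1 (phi t) w) = chain_integral J (cut_pullback g2 (phi t) w).
Proof.
move=> aK h1 h2 tT bw; have lw := bounded_scalar bw.
have ext g : cutoff K N g -> chain_integral J (cut_pullback g (phi t) w) =
    chain_integral (chain_widen J) (pullback_ext g t w).
  move=> hg; have be := pullback_ext_bounded hg tT bw.
  rewrite chain_integral_widen//; congr chain_integral; apply/funext => A.
  exact: (cut_pullback_ext hg A lw tT).
rewrite !ext//; have [_ _ _ [W1 [oW1 KW1 W11]]] := h1; have [_ _ _ [W2 [oW2 KW2 W21]]] := h2.
apply: (accessible_eq aK (openI oW1 oW2)).
- by move=> p Kp; split; [exact: KW1|exact: KW2].
- exact: (pullback_ext_bounded h1).
- exact: (pullback_ext_bounded h2).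
move=> A AW; have [s us sA] := csupp_seq A.
rewrite /pullback_ext !(@pointwise_form_seq _ _ _ _ _ _ s) ?sA//; last 2 first.
- by move=> p; rewrite top_coord0 mul0r.
- by move=> p; rewrite top_coord0 mul0r.
rewrite !big_seq; apply: eq_bigr => p ps.
have [Wp1 Wp2] : (W1 `&` W2) p by apply: AW; rewrite sA.
by rewrite W11// W21.
Qed.

End Transport.

(** * The transport theorem *)

Section FormScaling.
Context {R : realType} {n k : nat} (U : set 'rV[R]_n).
Implicit Types (w : dchain U k -> R).

Lemma scale_formE c w : (fun A => c * w A) = (fun A => (c - 1) * w A + w A).
Proof. by apply/funext => A; rewrite mulrBl mul1r subrK. Qed.

Lemma bounded_formZ c w : bounded_form w -> bounded_form (fun A => c * w A).
Proof. by move=> bw; rewrite scale_formE; exact: bounded_formD. Qed.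

Lemma chain_integral_formZ c w J : bounded_form w ->
  chain_integral J (fun A => c * w A) = c * chain_integral J w.
Proof. by move=> bw; rewrite scale_formE chain_integral_formD// mulrBl mul1r subrK. Qed.

Lemma chain_step_ball (J : chain U k) : exists r e, 0 < e /\ step_ball r e J.
Proof.
elim/quotW: J => A; have /asboolP[r cA] := cvalP A; have [m Am] := cA 1 ltr01.
exists r, (bnorm U r (dval (cval A m)) + 1); split; first by rewrite ltr_wpDl ?bnorm_ge0.
exists A; split => //; exists m => i mi.
have := bnormD r (cval A i - cval A m) (cval A m); rewrite subrK.
by move/le_lt_trans; apply; rewrite addrC ltrD2l; exact: Am.
Qed.

End FormScaling.

Theorem corollary10p3p4 (R : realType) (n : nat) (U : set 'rV[R]_n.+1)
  (V : 'rV[R]_n.+1 -> 'rV[R]_n.+1)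
  (J0 : chain U n.+1) (K N : set 'rV[R]_n.+1)
  (t0 : R) (phi : R -> 'rV[R]_n.+1 -> 'rV[R]_n.+1)
  (J : R -> chain U n.+1)
  (w w' : R -> dchain U n.+1 -> R)
  (hU : open U)
  (hV : bounded_smooth_field U V)
  (hK : is_support (chain_widen J0) K)
  (hKcompact : compact K)
  (hKU : K `<=` U)
  (ht0 : 0 < t0)
  (hN : open N)
  (hKN : K `<=` N)
  (hphi : is_flow U V N t0 phi)
  (hJ : forall t : R, 0 <= t < t0 -> is_pushforward K N (phi t) J0 (J t))
  (hw : forall t : R, 0 <= t < t0 -> bounded_form (w t))
  (hw' : forall t : R, 0 <= t < t0 ->
    bounded_form (w' t) /\ form_time_derivative t0 w t (w' t)) :
  forall t : R, 0 <= t < t0 ->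
    time_derivative t0 (fun s => chain_integral (J s) (w s) : R^o) t
      (chain_integral (J t) (w' t) +
       chain_integral (boundary (J t)) (interior_product V (w t))).
Proof.
move=> t /andP[t1 tt0]; pose T := (t + t0) / 2.
have tT : t < T by rewrite /T; lra.
have Tt0 : T < t0 by rewrite /T; lra.
have T0 : 0 < T by exact: le_lt_trans tT.
have tT' : 0 <= t <= T by rewrite t1 ltW.
have [_ aK _] := hK.
(* A single cutoff serves for all times, by [cut_pullback_unique]. *)
have [|g [hg _]] := hJ 0; first by rewrite lexx.
have tt : 0 <= t < t0 by rewrite t1.
have bw := hw t tt; have [bw' dw] := hw' t tt.
have bd := div_form_bounded hU hV bw.
have [r [e [e0 J0e]]] := chain_step_ball J0.
have [I [C [C0 Jint sol Ibnd]]] : exists I C, [/\ 0 <= C,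
    forall s om, 0 <= s <= T -> bounded_form om -> chain_integral (J s) om = I s om,
    forall om, bounded_form om -> primitive T (fun s => I s om) (fun s => I s (div_form V om)) &
    forall s om, 0 <= s <= T -> bounded_form om -> bnd r 1 om -> `|I s om| <= C].
  have [C C0 hC] := cut_pullback_bnd hU hV hN hphi T0 Tt0 hg r (@ler01 R).
  exists (fun s om => chain_integral J0 (cut_pullback g (phi s) om)), (C * e); split.
  - by rewrite mulr_ge0// ltW.
  - move=> s om sT bom; have [|g' [hg' Jg']] := hJ s.
      by case/andP: sT => -> /le_lt_trans; apply.
    by rewrite Jg'// (cut_pullback_unique hU hV hN hphi T0 Tt0 aK hg' hg sT bom).
  - by move=> om; exact: (integral_primitive hU hV hN hphi T0 Tt0 hg J0).
  - move=> s om sT bom b1.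
    exact: (chain_integral_bound (cut_pullback_bounded hU hV hN hphi T0 Tt0 hg sT bom)
      C0 (hC s om sT bom b1) J0e).
rewrite (boundary_formula hU hV _ bw).
have [c1 _ _] := sol _ bw'.
have [_ c2 _] := sol _ bw.
rewrite /time_derivative; apply/cvgrPdist_le => eps eps0.
have eps3 : 0 < eps / 3 by rewrite divr_gt0.
have /within_continuousP/(_ t tT' _ eps3)[d1 d10 hd1] := c1.
have /within_continuousP/(_ t tT' _ eps3)[d2 d20 hd2] := c2.
(* C bounds the integrals over the J_s of the forms of B^r norm at most 1. *)
pose del := eps / 3 / (C + 1).
have Ce0 : 0 < C + 1 by rewrite ltr_wpDl.
have del0 : 0 < del by rewrite divr_gt0.
have FF : Filter (time_filter t0 t) by exact: within_filter.
pose eta h (A : dchain U n.+1) := h^-1 * (w (t + h) A - w t A) - w' t A.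
have small_eta : \forall h \near time_filter t0 t, (fnorm r (eta h) < del%:E)%E.
  apply: (dw r [set x | (x < del%:E)%E]); apply: open_nbhs_nbhs; split => /=.
    exact: open_ereal_lt_ereal.
  by rewrite lte_fin.
pose d := Num.min d1 (Num.min d2 (T - t)).
have d0 : 0 < d by rewrite !lt_min d10 d20 subr_gt0.
have small_h : \forall h \near time_filter t0 t, [/\ 0 <= t + h < t0, h != 0 & `|h| < d].
  by exists d => // h /=; rewrite sub0r normrN.
apply: filterS2 small_eta small_h => h he [thT h0].
rewrite !lt_min => /andP[hd1' /andP[hd2' hT]].
have sT : 0 <= t + h <= T.
  case/andP: thT => -> _ /=; have := le_lt_trans (ler_norm h) hT; lra.
have sh : t + h - t = h by rewrite addrC addKr.
have bs := hw (t + h) thT.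
have beta : bounded_form (eta h).
  have := bounded_formD (-1) bw' (bounded_formZ h^-1 (bounded_formD (-1) bw bs)).
  by congr bounded_form; apply/funext => A; rewrite /eta !mulN1r addrC [- _ + _]addrC.
have seta := bounded_scalar beta.
have b1 : bnd r 1 (fun A => del^-1 * eta h A).
  move=> s p a sr ip; have := (fnorm_bnd r seta (ltW del0)).1 (ltW he) s p a sr ip.
  by rewrite normrM gtr0_norm ?invr_gt0// ler_pdivrMl// mul1r.
have E1 : `|chain_integral (J (t + h)) (eta h)| <= eps / 3.
  have bz := bounded_formZ del^-1 beta.
  have := Ibnd _ _ sT bz b1; rewrite -(Jint _ _ sT bz) chain_integral_formZ// normrM.
  rewrite gtr0_norm ?invr_gt0// ler_pdivrMl// => /le_trans; apply.
  by rewrite /del mulrAC ler_pdivrMr// ler_pM2l// lerDl.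
have E2 := hd1 (t + h) sT; rewrite sh in E2; have {}E2 := E2 hd1'.
have E3 := @primitive_mvt R T _ _ (I t (div_form V (w t))) (eps / 3) t (t + h) (sol _ bw) tT' sT.
rewrite sh in E3; have {}E3 := E3 (fun x xT xh => ltW (hd2 x xT (le_lt_trans xh hd2'))).
have Ws : chain_integral (J (t + h)) (w (t + h)) = h * (chain_integral (J (t + h)) (eta h) +
    I (t + h) (w' t)) + I (t + h) (w t).
  have bsum := bounded_formD 1 beta bw'; rewrite -!Jint//.
  rewrite -[X in h * (X + _)]mul1r -(chain_integral_formD 1 _ beta bw').
  rewrite -(chain_integral_formD h _ bsum bw); congr chain_integral; apply/funext => A.
  by rewrite /eta; field.
rewrite (Jint _ _ tT' bw') (Jint _ _ tT' bd) (Jint _ _ tT' bw).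
rewrite Ws {Ws}; move: E1 E2 E3; move: (chain_integral _ (eta h)) => a.
move: (I (t + h) (w' t)) (I t (w' t)) (I (t + h) (w t)) (I t (w t)) (I t (div_form V (w t))) => b x c z y E1 E2 E3.
(* The three summands are the error of the difference quotient of the forms, the
   variation of the integral of w'_t, and the case of a fixed form. *)
have -> : x + y - h^-1 *: (h * (a + b) + c - z) =
    - (a + ((b - x) + h^-1 * (c - z - h * y))).
  by rewrite /GRing.scale /=; field.
rewrite normrN; apply: le_trans (ler_normD _ _) _.
have -> : eps = eps / 3 + (eps / 3 + eps / 3) by field.
apply: lerD => //; apply: le_trans (ler_normD _ _) _; apply: lerD; first exact: ltW.
by rewrite normrM normfV mulrC ler_pdivrMr ?normr_gt0.
Qed.
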